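(* Let $\mathbb{D}$ denote $S^2$, $\mathbb{C}$ or the unit disk of $\mathbb{C}$. Let $\mathcal{F}:\mathbb{D}\rightarrow SO^+(1,n+3)/SO^+(1,3)\times SO(n)$ be a strongly conformally harmonic map whose normalized potential is of the form $$\eta=\lambda^{-1}\begin{pmatrix}0&\hat B_1\\-\hat B_1^tI_{1,3}&0\end{pmatrix}dz,\qquad \hat B_1=\begin{pmatrix}\hat f_{11}&\hat f_{12}&\cdots&\hat f_{1n}\\-\hat f_{11}&-\hat f_{12}&\cdots&-\hat f_{1n}\\ \hat f_{31}&\hat f_{32}&\cdots&\hat f_{3n}\\ i\hat f_{31}&i\hat f_{32}&\cdots&i\hat f_{3n}\end{pmatrix},$$ with $\hat f_{ij}$ meromorphic on $\mathbb{D}$, and suppose that the maximal rank of $\hat B_1$ is $2$. Then $\mathcal F$ cannot be the conformal Gauss map of a Willmore surface. In particular, there exist strongly conformally harmonic maps which are not the conformal Gauss map of any Willmore map.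
   Context: Groups. $I_{1,k}=\mathrm{diag}(-1,1,\dots,1)$ with $k$ entries equal to $1$; $\mathbb{R}^{1,n+3}$ is $\mathbb{R}^{n+4}$ with $\langle x,y\rangle=x^tI_{1,n+3}y$. $G=SO^+(1,n+3)$ is the identity component of $\{A\in Mat(n+4,\mathbb{R}): A^tI_{1,n+3}A=I_{1,n+3},\ \det A=1\}$; $K=SO^+(1,3)\times SO(n)$ is embedded block-diagonally. $G/K$ is the Grassmannian of oriented 4-dimensional Lorentzian subspaces of $\mathbb{R}^{1,n+3}$, $gK$ corresponding to the span of the first four columns of $g$. $G^{\mathbb{C}}=SO(1,n+3,\mathbb{C})$, $\sigma(A)=DAD^{-1}$ with $D=\mathrm{diag}(-I_4,I_n)$, and $\mathfrak{g}=\mathfrak{k}\oplus\mathfrak{p}$ is the eigenspace decomposition of $\sigma$. Strongly conformally harmonic maps. For a (local) lift $F$ into $G$ of $\mathcal F$ with complex coordinate $z$, write $\alpha=F^{-1}dF=\begin{pmatrix}A_1&B_1\\-B_1^tI_{1,3}&A_2\end{pmatrix}dz+\begin{pmatrix}\bar A_1&\bar B_1\\-\bar B_1^tI_{1,3}&\bar A_2\end{pmatrix}d\bar z$ with $B_1\in Mat(4\times n,\mathbb{C})$. A harmonic map $\mathcal F$ is strongly conformal (then called a strongly conformally harmonic map) if $B_1^tI_{1,3}B_1=0$. Normalized potential. With $\alpha=\alpha_{\mathfrak p}'+\alpha_{\mathfrak k}+\alpha_{\mathfrak p}''$ (the $\mathfrak k$-part and the $(1,0)$, $(0,1)$ parts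 of the $\mathfrak p$-part), harmonicity means $\alpha_\lambda=\lambda^{-1}\alpha_{\mathfrak p}'+\alpha_{\mathfrak k}+\lambda\alpha_{\mathfrak p}''$ is flat for all $\lambda\in S^1$. Fix a base point $p$ (with $z(p)=0$ and $\mathcal F(p)=IK$); an extended frame is a solution $F(z,\bar z,\lambda)$ of $F^{-1}dF=\alpha_\lambda$ with $F|_{p}=I$. Loops $\gamma$ in $G^{\mathbb{C}}$ are twisted if $\gamma(-\lambda)=\sigma(\gamma(\lambda))$. Near $p$ there is a unique Birkhoff decomposition $F=F_-F_+$ into twisted loops, $F_+$ extending holomorphically (in $G^{\mathbb{C}}$) to $|\lambda|<1$ and $F_-$ extending holomorphically to $|\lambda|>1$ including $\infty$ with $F_-|_{\lambda=\infty}=I$. $F_-$ is meromorphic in $z$ and extends meromorphically to $\mathbb{D}$; $\eta=F_-^{-1}dF_-=\lambda^{-1}\eta_{-1}dz$ is the normalized potential. Willmore maps. For a conformal immersion $y:M\to S^{n+2}$ with $z=u+iv$, put $Y=e^{-\rho}(1,y)\in\mathbb{R}^{1,n+3}$ with $\rho$ any real function; the conformal Gauss map of $y$ sends a point to the 4-dimensional Lorentzian subspace spanned by $Y,Y_{z\bar z},Y_u,Y_v$, oriented by this ordered basis (independent of the choices). $y$ is Willmore (a Willmore surface) if it is a critical immersion of the Willmore functional; equivalently its conformal Gauss map is harmonic. A smooth map $y:M\to S^{n+2}$ is a Willmore map if it is a conformal Willmore immersion on an open dense subset of $M$; its conformal Gauss map is then defined on that subset. *)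

(* Defs.v *)
From HB Require Import structures.
From mathcomp Require Import all_boot all_order all_algebra.
From mathcomp Require Import complex.
From mathcomp Require Import all_classical all_reals all_analysis.

Set Implicit Arguments.
Unset Strict Implicit.
Unset Printing Implicit Defensive.

Import Order.TTheory GRing.Theory Num.Theory.
Import numFieldNormedType.Exports.

Local Open Scope classical_set_scope.
Local Open Scope complex_scope.
Local Open Scope ring_scope.

(** * Real and complex differentiation *)

(* The topology and norm that every numFieldType has, made visible on R[i]. *)
HB.instance Definition _ (R : realType) :=
  NormedModule.copy R[i] (R[i] : numClosedFieldType)^o.

(* C^k on an open set: all iterated directional derivatives up to order k
   exist and are continuous there. *)
Fixpoint is_Ck (R : realType) (V : normedModType R) (k : nat) (U : set V)
    (f : V -> R) : Prop :=
  (forall x, U x -> {for x, continuous f}) /\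
  match k with
  | 0%N => True
  | k'.+1 => forall v : V,
      (forall x, U x -> derivable f x v) /\ is_Ck k' U (fun x => 'D_v f x)
  end.

Definition smooth (R : realType) (V : normedModType R) (U : set V)
  (f : V -> R) : Prop := forall k, is_Ck k U f.

Definition smooth_mx (R : realType) (V : normedModType R) (m p : nat)
    (U : set V) (f : V -> 'M[R]_(m, p)) : Prop :=
  forall i j, smooth U (fun x => f x i j).

Definition smooth_cmx (R : realType) (V : normedModType R) (m p : nat)
    (U : set V) (f : V -> 'M[R[i]]_(m, p)) : Prop :=
  forall i j, smooth U (fun x => complex.Re (f x i j)) /\
              smooth U (fun x => complex.Im (f x i j)).

(* A point (u, v) of the coordinate plane R * R stands for z = u + i v. *)
Definition cplx (R : realType) (x : R * R) : R[i] := x.1 +i* x.2.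

Definition dir_u (R : realType) : R * R := (1, 0).
Definition dir_v (R : realType) : R * R := (0, 1).
Arguments dir_u : clear implicits.
Arguments dir_v : clear implicits.

Definition pd_mx (R : realType) (m p : nat) (w : R * R)
    (f : R * R -> 'M[R]_(m, p)) (x : R * R) : 'M[R]_(m, p) :=
  \matrix_(i, j) 'D_w (fun y => f y i j) x.

Definition pd_cmx (R : realType) (m p : nat) (w : R * R)
    (f : R * R -> 'M[R[i]]_(m, p)) (x : R * R) : 'M[R[i]]_(m, p) :=
  \matrix_(i, j) ('D_w (fun y => complex.Re (f y i j)) x +i*
                  'D_w (fun y => complex.Im (f y i j)) x).

Definition d_z (R : realType) (m p : nat) (f : R * R -> 'M[R[i]]_(m, p))
    (x : R * R) : 'M[R[i]]_(m, p) :=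
  2^-1 *: (pd_cmx (dir_u R) f x - 'i *: pd_cmx (dir_v R) f x).

Definition d_zbar (R : realType) (m p : nat) (f : R * R -> 'M[R[i]]_(m, p))
    (x : R * R) : 'M[R[i]]_(m, p) :=
  2^-1 *: (pd_cmx (dir_u R) f x + 'i *: pd_cmx (dir_v R) f x).

Definition holomorphic_at (R : realType) (f : R[i] -> R[i]) (a : R[i]) : Prop :=
  \forall z \near a, derivable f z 1.

Definition pole_at (R : realType) (f : R[i] -> R[i]) (a : R[i]) : Prop :=
  exists (m : nat) (g : R[i] -> R[i]),
    [/\ (0 < m)%N, holomorphic_at g a, g a != 0 &
        \forall z \near a, z != a -> f z = g z / (z - a) ^+ m].

(* The value of f at a pole is irrelevant; away from its poles f is required to
   take its holomorphic values. *)
Definition meromorphic_at (R : realType) (f : R[i] -> R[i]) (a : R[i]) : Prop :=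
  holomorphic_at f a \/ pole_at f a.

(** * The Riemann surfaces S^2, C and the unit disk *)

Inductive surface := Sphere | Plane | Disk.

(* All three surfaces are subsets of the Riemann sphere [option R[i]], None
   being the point at infinity; a map on a surface is a function on
   [option R[i]] whose values outside of the surface are irrelevant.
   The atlas consists of the coordinate z (chart false) and, for the sphere
   only, of w = 1/z (chart true). *)
Definition chart (R : realType) (c : bool) (z : R[i]) : option R[i] :=
  if c then (if z == 0 then None else Some z^-1) else Some z.

Definition chart_dom (R : realType) (D : surface) (c : bool) : set R[i] :=
  match D, c with
  | Sphere, _ => setT
  | Plane, false => setT
  | Disk, false => [set z | `|z| < 1]
  | _, true => set0
  end.

(* The part of the subset O of D covered by chart c, in real coordinates. *)
Definition chart_set (R : realType) (D : surface) (O : set (option R[i]))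
    (c : bool) : set (R * R) :=
  [set x | chart_dom D c (cplx x) /\ O (chart c (cplx x))].

Definition open_in (R : realType) (D : surface) (O : set (option R[i])) : Prop :=
  forall c, open (chart_set D O c).

Definition dense_in (R : realType) (D : surface) (O : set (option R[i])) : Prop :=
  forall c (U : set (R * R)), open U -> U !=set0 ->
    U `<=` chart_set D setT c -> (U `&` chart_set D O c) !=set0.

Definition meromorphic_on (R : realType) (D : surface)
    (f : option R[i] -> R[i]) : Prop :=
  forall c z, chart_dom D c z -> meromorphic_at (fun w => f (chart c w)) z.

(* The largest rank of B, over the points of D at which no entry of B has a
   pole, is r. *)
Definition max_rank (R : realType) (D : surface) (m p : nat)
    (B : option R[i] -> 'M[R[i]]_(m, p)) (r : nat) : Prop :=
  let regular c z := chart_dom D c z /\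
    forall i j, holomorphic_at (fun w => B (chart c w) i j) z in
  (forall c z, regular c z -> (\rank (B (chart c z)) <= r)%N) /\
  (exists c z, regular c z /\ \rank (B (chart c z)) = r).

(** * Groups *)

(* I_{1,m-1} = diag(-1, 1, ..., 1) *)
Definition lor (T : nzRingType) (m : nat) : 'M[T]_m :=
  diag_mx (\row_(i < m) if i == 0%N :> nat then - 1 else 1).
Arguments lor : clear implicits.

(* SO(1, m-1), over the reals or over the complex numbers *)
Definition SO1 (T : comNzRingType) (m : nat) : set 'M[T]_m :=
  [set A | A^T *m lor T m *m A = lor T m /\ \det A = 1].
Arguments SO1 : clear implicits.

(* SO^+(1, m-1) *)
Definition SO1plus (R : realType) (m : nat) : set 'M[R]_m :=
  connected_component (SO1 R m) 1%:M.
Arguments SO1plus : clear implicits.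

Definition SO (R : realType) (m : nat) : set 'M[R]_m :=
  [set A | A^T *m A = 1%:M /\ \det A = 1].
Arguments SO : clear implicits.

Definition Kgrp (R : realType) (n : nat) : set 'M[R]_(4 + n) :=
  [set k | exists A1 A2, [/\ SO1plus R 4 A1, SO R n A2 & k = block_mx A1 0 0 A2]].

(* The point gK of G/K; maps into G/K are maps F into sets of matrices whose
   values have this form. *)
Definition cosetK (R : realType) (n : nat) (g : 'M[R]_(4 + n)) :
    set 'M[R]_(4 + n) :=
  [set g *m k | k in @Kgrp R n].

Definition sigma_mx (R : realType) (n : nat) : 'M[R[i]]_(4 + n) :=
  block_mx (- 1%:M) 0 0 1%:M.

Definition sigma (R : realType) (n : nat) (A : 'M[R[i]]_(4 + n)) :
    'M[R[i]]_(4 + n) :=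
  sigma_mx R n *m A *m invmx (sigma_mx R n).

Definition kpart (R : realType) (n : nat) (A : 'M[R[i]]_(4 + n)) :=
  2^-1 *: (A + sigma A).
Definition ppart (R : realType) (n : nat) (A : 'M[R[i]]_(4 + n)) :=
  2^-1 *: (A - sigma A).

(** * Strongly conformally harmonic maps *)

(* F is a smooth lift into G, over the coordinate region U of chart c. *)
Definition local_lift (R : realType) (n : nat) (D : surface)
    (FF : option R[i] -> set 'M[R]_(4 + n)) (c : bool) (U : set (R * R))
    (F : R * R -> 'M[R]_(4 + n)) : Prop :=
  [/\ open U, U `<=` chart_set D setT c, smooth_mx U F &
      forall x, U x -> SO1plus R (4 + n) (F x) /\
                       FF (chart c (cplx x)) = cosetK (F x)].

(* F^-1 dF = mc_z F dz + mc_zbar F dzbar *)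
Definition mc_z (R : realType) (m : nat) (F : R * R -> 'M[R[i]]_m)
  (x : R * R) : 'M[R[i]]_m := invmx (F x) *m d_z F x.
Definition mc_zbar (R : realType) (m : nat) (F : R * R -> 'M[R[i]]_m)
  (x : R * R) : 'M[R[i]]_m := invmx (F x) *m d_zbar F x.

Definition complexify (R : realType) (m p : nat) (F : R * R -> 'M[R]_(m, p))
    (x : R * R) : 'M[R[i]]_(m, p) :=
  map_mx (fun a : R => a%:C) (F x).

(* The dz- and dzbar-coefficients of
   lambda^-1 alpha_p' + alpha_k + lambda alpha_p''. *)
Definition alpha_z (R : realType) (n : nat) (F : R * R -> 'M[R]_(4 + n))
    (l : R[i]) (x : R * R) : 'M[R[i]]_(4 + n) :=
  let a := mc_z (complexify F) x in l^-1 *: ppart a + kpart a.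
Definition alpha_zbar (R : realType) (n : nat) (F : R * R -> 'M[R]_(4 + n))
    (l : R[i]) (x : R * R) : 'M[R[i]]_(4 + n) :=
  let b := mc_zbar (complexify F) x in kpart b + l *: ppart b.

(* d beta + beta /\ beta = 0 for beta = a dz + b dzbar *)
Definition flat (R : realType) (m : nat) (U : set (R * R))
    (a b : R * R -> 'M[R[i]]_m) : Prop :=
  forall x, U x -> d_z b x - d_zbar a x + (a x *m b x - b x *m a x) = 0.

Definition B1 (R : realType) (n : nat) (F : R * R -> 'M[R]_(4 + n))
    (x : R * R) : 'M[R[i]]_(4, n) :=
  ursubmx (mc_z (complexify F) x).

Definition smooth_map (R : realType) (n : nat) (D : surface)
    (FF : option R[i] -> set 'M[R]_(4 + n)) : Prop :=
  forall c x, chart_set D setT c x ->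
    exists U F, U x /\ local_lift D FF c U F.

Definition harmonic_map (R : realType) (n : nat) (D : surface)
    (FF : option R[i] -> set 'M[R]_(4 + n)) : Prop :=
  smooth_map D FF /\
  forall c U F, local_lift D FF c U F ->
    forall l : R[i], `|l| = 1 -> flat U (alpha_z F l) (alpha_zbar F l).

Definition strongly_conformally_harmonic (R : realType) (n : nat) (D : surface)
    (FF : option R[i] -> set 'M[R]_(4 + n)) : Prop :=
  harmonic_map D FF /\
  forall c U F, local_lift D FF c U F ->
    forall x, U x -> (B1 F x)^T *m lor R[i] 4 *m B1 F x = 0.

(** * The normalized potential *)

Definition twisted (R : realType) (n : nat) (g : R[i] -> 'M[R[i]]_(4 + n)) :
    Prop :=
  forall l : R[i], `|l| = 1 -> g (- l) = sigma (g l).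

(* E extends the loop g, within G^C, to the closed unit disk, holomorphically in
   the interior. *)
Definition disk_extension (R : realType) (n : nat)
    (g E : R[i] -> 'M[R[i]]_(4 + n)) : Prop :=
  [/\ forall l : R[i], `|l| = 1 -> E l = g l,
      forall l : R[i], `|l| <= 1 -> SO1 R[i] (4 + n) (E l),
      forall i j, {within [set l : R[i] | `|l| <= 1],
                     continuous (fun l => E l i j)} &
      forall (l : R[i]) i j, `|l| < 1 -> holomorphic_at (fun m => E m i j) l].

(* FF(p) = IK at the base point p = {z = 0}, and E is the extended frame, with
   E|_p = I, over the neighbourhood V of p. *)
Definition extended_frame (R : realType) (n : nat) (D : surface)
    (FF : option R[i] -> set 'M[R]_(4 + n)) (V : set (R * R))
    (E : R * R -> R[i] -> 'M[R[i]]_(4 + n)) : Prop :=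
  exists F : R * R -> 'M[R]_(4 + n),
    [/\ local_lift D FF false V F, V 0, F 0 = 1%:M &
      forall l : R[i], `|l| = 1 ->
        [/\ smooth_cmx V (fun x => E x l), E 0 l = 1%:M &
            forall x, V x ->
              [/\ E x l \in unitmx,
                  mc_z (fun y => E y l) x = alpha_z F l x &
                  mc_zbar (fun y => E y l) x = alpha_zbar F l x]]].

(* For each x in V, E x = Em x * Ep x is the Birkhoff decomposition.  The
   extension of Em x to |l| > 1 and to infinity is expressed in the variable
   1 / l. *)
Definition birkhoff (R : realType) (n : nat) (V : set (R * R))
    (E Em Ep : R * R -> R[i] -> 'M[R[i]]_(4 + n)) : Prop :=
  forall x, V x ->
    [/\ forall l : R[i], `|l| = 1 -> E x l = Em x l *m Ep x l,
        twisted (Em x), twisted (Ep x),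
        exists Xp, disk_extension (Ep x) Xp &
        exists Xm, disk_extension (fun w => Em x w^-1) Xm /\ Xm 0 = 1%:M].

Definition potential_mx (R : realType) (n : nat) (B : 'M[R[i]]_(4, n)) :
    'M[R[i]]_(4 + n) :=
  block_mx 0 B (- (B^T *m lor R[i] 4)) 0.

(* eta = l^-1 (potential_mx B) dz is the normalized potential of FF: B is
   meromorphic on D, and Em^-1 dEm = eta near the base point.  As a meromorphic
   form on D, eta is determined by its germ there. *)
Definition normalized_potential (R : realType) (n : nat) (D : surface)
    (FF : option R[i] -> set 'M[R]_(4 + n))
    (B : option R[i] -> 'M[R[i]]_(4, n)) : Prop :=
  (forall i j, meromorphic_on D (fun p => B p i j)) /\
  exists V E Em Ep,
    [/\ extended_frame D FF V E, birkhoff V E Em Ep &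
      forall l : R[i], `|l| = 1 ->
        smooth_cmx V (fun x => Em x l) /\
        forall x, V x ->
          mc_z (fun y => Em y l) x = l^-1 *: potential_mx (B (Some (cplx x))) /\
          mc_zbar (fun y => Em y l) x = 0].

Definition special_B (R : realType) (n : nat)
    (f1 f3 : 'I_n -> option R[i] -> R[i]) (p : option R[i]) :
    'M[R[i]]_(4, n) :=
  \matrix_(i, j) nth 0 [:: f1 j p; - f1 j p; f3 j p; 'i * f3 j p] i.

(** * Willmore surfaces and their conformal Gauss maps *)

Definition dot (R : realType) (m : nat) (a b : 'cV[R]_m) : R :=
  (a^T *m b) 0 0.

Definition in_chart (R : realType) (m : nat) (y : option R[i] -> 'cV[R]_m)
    (c : bool) (x : R * R) : 'cV[R]_m :=
  y (chart c (cplx x)).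

(* The Willmore integrand (|H|^2 - K + 1) dA of an immersed surface y in the unit
   sphere: N is the projection onto its normal space, II a b is the second
   fundamental form, and the Gauss equation gives
   K = 1 + (<II_uu, II_vv> - |II_uv|^2) / det g. *)
Definition willmore_density (R : realType) (m : nat) (y : R * R -> 'cV[R]_m)
    (x : R * R) : R :=
  let u := dir_u R in
  let v := dir_v R in
  let g a b := dot (pd_mx a y x) (pd_mx b y x) in
  let detg := g u u * g v v - g u v ^+ 2 in
  let T : 'M[R]_(m, 1 + (1 + 1)) :=
    row_mx (y x) (row_mx (pd_mx u y x) (pd_mx v y x)) in
  let N : 'M[R]_m := 1%:M - T *m invmx (T^T *m T) *m T^T in
  let II a b := N *m pd_mx a (pd_mx b y) x in
  let H := (2 * detg)^-1 *:
    (g v v *: II u u - (2 * g u v) *: II u v + g u u *: II v v) in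
  let K := 1 + (dot (II u u) (II v v) - dot (II u v) (II u v)) / detg in
  (dot H H - K + 1) * Num.sqrt detg.

Definition willmore_functional (R : realType) (m : nat) (C : set (R * R))
    (y : R * R -> 'cV[R]_m) : R :=
  Rintegral (lebesgue_measure \x lebesgue_measure)%E C (willmore_density y).

(* Y is a smooth variation, through maps into the unit sphere, of the surface y
   over U; it is supported in C. *)
Definition variation (R : realType) (m : nat) (U C : set (R * R))
    (y : R * R -> 'cV[R]_m) (e : R) (Y : R -> R * R -> 'cV[R]_m) : Prop :=
  [/\ smooth_mx [set q : R * (R * R) | `|q.1| < e /\ U q.2]
        (fun q : R * (R * R) => Y q.1 q.2),
      forall t x, `|t| < e -> U x -> dot (Y t x) (Y t x) = 1,
      forall x, U x -> Y 0 x = y x &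
      forall t x, `|t| < e -> U x -> ~ C x -> Y t x = y x].

Definition willmore_critical (R : realType) (m : nat) (U : set (R * R))
    (y : R * R -> 'cV[R]_m) : Prop :=
  forall (C : set (R * R)) (e : R) (Y : R -> R * R -> 'cV[R]_m),
    compact C -> C `<=` U -> 0 < e -> variation U C y e Y ->
    is_derive (0 : R) 1 (fun t => willmore_functional C (Y t)) 0.

Definition smooth_sphere_map (R : realType) (m : nat) (D : surface)
    (O : set (option R[i])) (y : option R[i] -> 'cV[R]_m) : Prop :=
  forall c, smooth_mx (chart_set D O c) (in_chart y c) /\
    forall x, chart_set D O c x -> dot (in_chart y c x) (in_chart y c x) = 1.

Definition conformal_immersion (R : realType) (m : nat) (D : surface)
    (O : set (option R[i])) (y : option R[i] -> 'cV[R]_m) : Prop :=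
  forall c x, chart_set D O c x ->
    let yu := pd_mx (dir_u R) (in_chart y c) x in
    let yv := pd_mx (dir_v R) (in_chart y c) x in
    [/\ 0 < dot yu yu, dot yu yu = dot yv yv & dot yu yv = 0].

(* A conformal Willmore immersion of the open subset O of D.  Criticality is
   tested on the variations supported in one chart: by a partition of unity and
   the linearity of the first variation, these suffice. *)
Definition willmore_immersion (R : realType) (m : nat) (D : surface)
    (O : set (option R[i])) (y : option R[i] -> 'cV[R]_m) : Prop :=
  [/\ smooth_sphere_map D O y, conformal_immersion D O y &
      forall c, willmore_critical (chart_set D O c) (in_chart y c)].

Definition willmore_surface (R : realType) (m : nat) (D : surface)
    (y : option R[i] -> 'cV[R]_m) : Prop :=
  willmore_immersion D setT y.

Definition light_lift (R : realType) (n : nat) (rho : R * R -> R)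
    (y : R * R -> 'cV[R]_(3 + n)) (x : R * R) : 'cV[R]_(4 + n) :=
  expR (- rho x) *: (col_mx 1%:M (y x) : 'cV[R]_(1 + (3 + n))).

(* On O, FF is the conformal Gauss map of y: FF = gK where the first four
   columns of g and (Y, Y_{z zbar}, Y_u, Y_v) are bases, with the same
   orientation, of the same space. *)
Definition conformal_Gauss_map (R : realType) (n : nat) (D : surface)
    (O : set (option R[i])) (y : option R[i] -> 'cV[R]_(3 + n))
    (FF : option R[i] -> set 'M[R]_(4 + n)) : Prop :=
  forall c, exists rho : R * R -> R, smooth (chart_set D O c) rho /\
    forall x, chart_set D O c x ->
      let u := dir_u R in
      let v := dir_v R in
      let Y := light_lift rho (in_chart y c) in
      let Yzzbar := 4^-1 *: (pd_mx u (pd_mx u Y) x + pd_mx v (pd_mx v Y) x) in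
      let frame : 'M[R]_(4 + n, 1 + (1 + (1 + 1))) :=
        row_mx (Y x) (row_mx Yzzbar (row_mx (pd_mx u Y x) (pd_mx v Y x))) in
      exists (g : 'M[R]_(4 + n)) (P : 'M[R]_4),
        [/\ SO1plus R (4 + n) g, FF (chart c (cplx x)) = cosetK g,
            0 < \det P & frame = lsubmx g *m P].

Definition willmore_map_with_Gauss_map (R : realType) (n : nat) (D : surface)
    (y : option R[i] -> 'cV[R]_(3 + n))
    (FF : option R[i] -> set 'M[R]_(4 + n)) : Prop :=
  smooth_sphere_map D setT y /\
  exists O, [/\ open_in D O, dense_in D O, willmore_immersion D O y &
                conformal_Gauss_map D O y FF].

(* Main.v *)
(* Let e = (1,-1,0,0) and let W be the isotropic plane of C^4 spanned by e and (0,0,1,i);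
   it contains the columns of B^ = special_B f1 f3.  The values of the potential raise the
   filtration 0 < W < W^perp < C^(4+n), so that F_- is a polynomial of degree 2 in 1/l
   which fixes W pointwise.  The extended frame F is real for |l| = 1, which makes F_+ a
   polynomial of degree 2 in l.  Two facts follow from its value k = F_+(0), which is
   block diagonal.  First, k alpha_p' = eta_{-1} k, so that B_1 and B^ have the same rank.
   Secondly, F^-1 e = F_+^-1 e is real on the circle and holomorphic in the disk, hence
   independent of l and equal to k^-1 e: the null vector e lies in the Lorentzian subspace
   F(x) for all x.
   Let F be the conformal Gauss map of y, with light-like lift Y.  Both Y and e are in
   F(x) with their first derivatives, hence their coordinates in the frame are orthogonal
   to the columns of B_1.  Where B_1 has rank 2, its column space is an isotropic plane of
   C^4, equal to its own orthogonal; hence <Y, e> = 0.  By the identity theorem for the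
   minors of B^ this holds on a nonempty open set.  There the first coordinate of the unit
   vector y is -1, so y is constant and not an immersion.
   An example for the second part is F(z) = exp(Re z N) K, where n = 1 and N is the
   potential matrix of B = e.  The subspace F(z) contains e, and e is also the derivative
   of the normal vector of F(z), up to a factor; so again <Y, e> = 0 on an open set. *)

From HB Require Import structures.
Require Import Defs.
From mathcomp Require Import all_boot all_order all_algebra.
From mathcomp Require Import complex.
From mathcomp Require Import all_classical all_reals all_analysis.
From mathcomp Require Import ring lra.
Set Implicit Arguments.
Unset Strict Implicit.
Unset Printing Implicit Defensive.

Import Order.TTheory GRing.Theory Num.Theory.
Import numFieldNormedType.Exports.
Local Open Scope classical_set_scope.
Local Open Scope complex_scope.
Local Open Scope ring_scope.

(** * Goursat's theorem on a rectangle *)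

(** The loops are given on the circle, with extensions that are only continuous on the closed disk.
    What is used about such functions comes from the mean value property, in one form: a real part
    that is nonnegative on the circle and nonpositive at the centre vanishes on the circle. The mean
    value property is Goursat's theorem for f(exp w) dw on rectangles of the w-plane, the integral
    along each side being the increment of a primitive. The extension of F_+ to the disk is given
    separately for each x, so its value k at the centre comes with no derivative in x. As F_+ has
    degree 2 in l, k is its mean over the four fourth roots of unity, and the relation for k is the
    mean of the relations at these points. Harmonicity of the example is a condition on every lift.
    A lift is exp(Re z N) K(z) with K block diagonal, and its flatness involves the second
    derivatives of K, hence their symmetry. *)

Lemma mvt_le (R : realType) (f df : R -> R) (a b M : R) : a <= b ->
  (forall x, a <= x <= b -> is_derive x 1 f (df x)) ->
  (forall x, a <= x <= b -> df x <= M) -> f b - f a <= M * (b - a).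
Proof.
move=> ab fdf dfM.
have cf : {within `[a, b], continuous f}.
  by apply: derivable_within_continuous => x; rewrite in_itv/= => /fdf [].
have [|c] := @MVT_segment _ f df a b ab _ cf.
  by move=> x; rewrite in_itv/= => /andP[/ltW ax /ltW xb]; apply: fdf; rewrite ax.
rewrite in_itv/= => /dfM cM ->.
by apply: ler_wpM2r => //; rewrite subr_ge0.
Qed.

Lemma mvt_norm (R : realType) (f df : R -> R) (a b M : R) : a <= b ->
  (forall x, a <= x <= b -> is_derive x 1 f (df x)) ->
  (forall x, a <= x <= b -> `|df x| <= M) -> `|f b - f a| <= M * (b - a).
Proof.
move=> ab fdf dfM; rewrite ler_norml; apply/andP; split; last first.
  by apply: (mvt_le ab fdf) => x /dfM; apply: le_trans; rewrite ler_norm.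
rewrite lerNl.
have -> : - (f b - f a) = - f b - (- f a) by ring.
apply: (@mvt_le _ (fun x => - f x) (fun x => - df x)) => //.
  by move=> x /fdf ?; exact: is_deriveN.
by move=> x /dfM; apply: le_trans; rewrite -normrN ler_norm.
Qed.

Lemma ex_primitive (R : realType) (g : R -> R) (a b : R) : continuous g ->
  exists G : R -> R, forall x, a < x < b -> is_derive x 1 G (g x).
Proof.
move=> cg; exists (fun x => \int[@lebesgue_measure R]_(t in `[a, x]) g t)%R.
move=> x /andP[ax xb].
have [||h1 h2] := @continuous_FTC1 R g (BLeft a) x b xb _ _ (cg x).
- by apply: continuous_compact_integrable; [exact: segment_compact|
     exact: continuous_subspaceT].
- by [].
apply: (DeriveDef h1); rewrite -derive1E; exact: h2.
Qed.

Lemma nested_segments (R : realType) (u v : nat -> R) :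
  (forall n, u n <= u n.+1) -> (forall n, v n.+1 <= v n) ->
  (forall n, u n <= v n) -> exists x, forall n, u n <= x <= v n.
Proof.
move=> um vm uv.
have um' n k : u n <= u (n + k)%N.
  by elim: k => [|k]; rewrite ?addn0// addnS => /le_trans; exact.
have vm' n k : v (n + k)%N <= v n.
  by elim: k => [|k]; rewrite ?addn0// addnS; apply: le_trans.
have ubv n : ubound (range u) (v n).
  move=> _ [m _ <-].
  rewrite (le_trans (um' m n))// (le_trans (uv _))// addnC; exact: vm'.
exists (sup (range u)) => n; apply/andP; split.
  by apply: ub_le_sup; [exists (v 0%N)|exists n].
by apply: ge_sup; [exists (u 0%N), 0%N|exact: ubv].
Qed.

(** [bad n s t] speaks of the rectangle with lower left corner (s, t) and sides L / 2^n and M / 2^n.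
    Each bad rectangle has a bad quarter; the nested quarters have a common point. *)
Lemma bisection (R : realType) (bad : nat -> R -> R -> Prop) (L M s0 t0 : R) :
  0 <= L -> 0 <= M -> bad 0%N s0 t0 ->
  (forall n s t, bad n s t -> exists i j : bool,
     bad n.+1 (s + i%:R * (L / 2 ^+ n.+1)) (t + j%:R * (M / 2 ^+ n.+1))) ->
  exists s t, forall n, exists s' t', [/\ bad n s' t',
    s' <= s <= s' + L / 2 ^+ n & t' <= t <= t' + M / 2 ^+ n].
Proof.
move=> L0 M0 bad0 badS.
have [F FP] : exists F : nat -> R * R -> R * R, forall n p, bad n p.1 p.2 ->
    bad n.+1 (F n p).1 (F n p).2 /\ exists i j : bool,
      F n p = (p.1 + i%:R * (L / 2 ^+ n.+1), p.2 + j%:R * (M / 2 ^+ n.+1)).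
  (* The choice is made for all triples (n, s, t), with the default (0, 0) where the rectangle is
     not bad. *)
  have /choice[F FP] : forall q : nat * (R * R), exists r : R * R,
    bad q.1 q.2.1 q.2.2 -> bad q.1.+1 r.1 r.2 /\ exists i j : bool,
      r = (q.2.1 + i%:R * (L / 2 ^+ q.1.+1), q.2.2 + j%:R * (M / 2 ^+ q.1.+1)).
    move=> [n [s t]]/=; have [/badS[i [j ?]]|nb] := pselect (bad n s t).
      by eexists => _; split; last by exists i, j.
    by exists (0, 0).
  by exists (fun n p => F (n, p)) => n p; exact: (FP (n, p)).
pose x := fix x n := if n is m.+1 then F m (x m) else (s0, t0).
have xb n : bad n (x n).1 (x n).2 by elim: n => //= n /FP[].
have half (K : R) n : K / 2 ^+ n = K / 2 ^+ n.+1 + K / 2 ^+ n.+1.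
  by rewrite exprS; field.
have step (K : R) n (i : bool) : 0 <= K ->
    0 <= i%:R * (K / 2 ^+ n.+1) <= K / 2 ^+ n.+1.
  move=> K0; have ? : 0 <= K / 2 ^+ n.+1 by rewrite divr_ge0.
  by case: i; rewrite ?mul1r ?mul0r lexx ?andbT.
have nest (c : R * R -> R) (K c0 : R) : 0 <= K ->
  (forall n, exists i : bool, c (x n.+1) = c (x n) + i%:R * (K / 2 ^+ n.+1)) ->
  exists s, forall n, c (x n) <= s <= c (x n) + K / 2 ^+ n.
  move=> K0 cx; apply: (nested_segments (u := fun n => c (x n))
    (v := fun n => c (x n) + K / 2 ^+ n)) => n.
  - by have [i ->] := cx n; rewrite lerDl; case/andP: (step K n i K0).
  - have [i ->] := cx n; rewrite (half K n).
    by have := step K n i K0; lra.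
  - by rewrite lerDl divr_ge0.
have [|s sP] := nest fst L s0 L0.
  by move=> n; have /FP[_ [i [j /= ->]]] := xb n; exists i.
have [|t tP] := nest snd M t0 M0.
  by move=> n; have /FP[_ [i [j /= ->]]] := xb n; exists j.
by exists s, t => n; exists (x n).1, (x n).2; split.
Qed.

Section goursat.
Variables (R : realType) (P Q A B : R -> R -> R) (a b c d : R).
Hypotheses (ab : a <= b) (cd : c <= d).
Hypothesis dA : forall s t, a <= s <= b -> c <= t <= d ->
  is_derive s 1 (A ^~ t) (P s t).
Hypothesis dB : forall s t, a <= s <= b -> c <= t <= d ->
  is_derive t 1 (B s) (Q s t).
(* P ds + Q dt is closed: the derivative q of P in t is the derivative of Q in s. *)
Hypothesis dPQ : forall s0 t0, a <= s0 <= b -> c <= t0 <= d ->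
  exists p q r : R, forall eps : R, 0 < eps -> exists2 dl : R, 0 < dl & forall s t,
    a <= s <= b -> c <= t <= d -> `|s - s0| < dl -> `|t - t0| < dl ->
    `|P s t - (P s0 t0 + p * (s - s0) + q * (t - t0))| <= eps * (`|s - s0| + `|t - t0|) /\
    `|Q s t - (Q s0 t0 + q * (s - s0) + r * (t - t0))| <= eps * (`|s - s0| + `|t - t0|).

(* The integral of P ds + Q dt along the boundary of [s, s + x] * [t, t + y]. *)
Let Phi (s t x y : R) : R := A (s + x) t - A s t + (B (s + x) (t + y) - B (s + x) t)
  - (A (s + x) (t + y) - A s (t + y)) - (B s (t + y) - B s t).

(** A closed affine form has integral zero around the rectangle, so only the error of the affine
    approximation counts: at most eps * (x + y), on a boundary of length 2 * (x + y). *)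
Let Phi_small (s0 t0 p q r eps s t x y : R) : 0 <= x -> 0 <= y ->
  a <= s -> s + x <= b -> c <= t -> t + y <= d ->
  s <= s0 <= s + x -> t <= t0 <= t + y -> 0 <= eps ->
  (forall s' t', s <= s' <= s + x -> t <= t' <= t + y ->
    `|P s' t' - (P s0 t0 + p * (s' - s0) + q * (t' - t0))| <= eps * (`|s' - s0| + `|t' - t0|) /\
    `|Q s' t' - (Q s0 t0 + q * (s' - s0) + r * (t' - t0))| <= eps * (`|s' - s0| + `|t' - t0|)) ->
  `|Phi s t x y| <= 2 * eps * (x + y) ^+ 2.
Proof.
move=> x0 y0 as_ sb ct td s0i t0i eps0 H.
have dist s' t' : s <= s' <= s + x -> t <= t' <= t + y ->
    eps * (`|s' - s0| + `|t' - t0|) <= eps * (x + y).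
  move=> hs ht; apply: ler_wpM2l => //; apply: lerD; rewrite ler_norml; lra.
have HA t' : t <= t' <= t + y -> `|A (s + x) t' - A s t' - (P s0 t0 * x +
    p / 2 * ((s + x - s0) ^+ 2 - (s - s0) ^+ 2) + q * (t' - t0) * x)|
    <= eps * (x + y) * x.
  move=> ht.
  pose G u := A u t' - (P s0 t0 * u + p / 2 * (u - s0) ^+ 2 + q * (t' - t0) * u).
  have := @mvt_norm R G (fun u => P u t' - (P s0 t0 + p * (u - s0) + q * (t' - t0)))
    s (s + x) (eps * (x + y)) _ _ _.
  have -> : G (s + x) - G s = A (s + x) t' - A s t' - (P s0 t0 * x +
    p / 2 * ((s + x - s0) ^+ 2 - (s - s0) ^+ 2) + q * (t' - t0) * x).
    by rewrite /G; ring.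
  have -> : s + x - s = x by ring.
  apply.
  - by rewrite lerDl.
  - move=> u hu; have := @dA u t' _ _ => dAu.
    have {}dAu : is_derive u 1 (A ^~ t') (P u t') by apply: dAu; lra.
    rewrite /G; apply: is_derive_eq.
    by rewrite /GRing.scale/=; field.
  - by move=> u hu; have [h _] := H u t' hu ht; exact: le_trans h (dist _ _ hu ht).
have HB s' : s <= s' <= s + x -> `|B s' (t + y) - B s' t - (Q s0 t0 * y +
    r / 2 * ((t + y - t0) ^+ 2 - (t - t0) ^+ 2) + q * (s' - s0) * y)|
    <= eps * (x + y) * y.
  move=> hs.
  pose G u := B s' u - (Q s0 t0 * u + r / 2 * (u - t0) ^+ 2 + q * (s' - s0) * u).
  have := @mvt_norm R G (fun u => Q s' u - (Q s0 t0 + q * (s' - s0) + r * (u - t0)))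
    t (t + y) (eps * (x + y)) _ _ _.
  have -> : G (t + y) - G t = B s' (t + y) - B s' t - (Q s0 t0 * y +
    r / 2 * ((t + y - t0) ^+ 2 - (t - t0) ^+ 2) + q * (s' - s0) * y).
    by rewrite /G; ring.
  have -> : t + y - t = y by ring.
  apply.
  - by rewrite lerDl.
  - move=> u hu; have := @dB s' u _ _ => dBu.
    have {}dBu : is_derive u 1 (B s') (Q s' u) by apply: dBu; lra.
    rewrite /G; apply: is_derive_eq.
    by rewrite /GRing.scale/=; field.
  - by move=> u hu; have [_ h] := H s' u hs hu; exact: le_trans h (dist _ _ hs hu).
have t1 : t <= t <= t + y by lra.
have t2 : t <= t + y <= t + y by lra.
have s1 : s <= s <= s + x by lra.
have s2 : s <= s + x <= s + x by lra.
move: (HA _ t1) (HA _ t2) (HB _ s1) (HB _ s2).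
rewrite !ler_norml => /andP[a1 a2] /andP[a3 a4] /andP[b1 b2] /andP[b3 b4].
have -> : 2 * eps * (x + y) ^+ 2 =
  2 * (eps * (x + y) * x) + 2 * (eps * (x + y) * y) by ring.
by rewrite /Phi; apply/andP; split; lra.
Qed.

(** Goursat's subdivision: if the integral has modulus K > 0, some quarter carries at least K / 4,
    and so on. At the limit point the form is differentiable, so the n-th integral is at most 2 *
    eps * (L / 2^n)^2, which is below K / 4^n for small eps. *)
Lemma goursat : A b c - A a c + (B b d - B b c) - (A b d - A a d)
  - (B a d - B a c) = 0.
Proof.
have -> : A b c - A a c + (B b d - B b c) - (A b d - A a d)
  - (B a d - B a c) = Phi a c (b - a) (d - c).
  by rewrite /Phi !(addrC a) !(addrC c) !subrK.
apply/eqP; apply: contrapT => /negP Phi0.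
pose K : R := `|Phi a c (b - a) (d - c)|.
have K0 : 0 < K by rewrite normr_gt0.
pose x n := (b - a) / 2 ^+ n; pose y n := (d - c) / 2 ^+ n.
pose bad n s t := [/\ a <= s /\ s + x n <= b, c <= t /\ t + y n <= d &
  K / 4 ^+ n <= `|Phi s t (x n) (y n)|].
have x0 n : 0 <= x n by rewrite divr_ge0// subr_ge0.
have y0 n : 0 <= y n by rewrite divr_ge0// subr_ge0.
have xS n : x n = x n.+1 + x n.+1 by rewrite /x exprS; field.
have yS n : y n = y n.+1 + y n.+1 by rewrite /y exprS; field.
have [||||s0 [t0 st0]] := @bisection R bad (b - a) (d - c) a c.
- by rewrite subr_ge0.
- by rewrite subr_ge0.
- by rewrite /bad /x /y !expr0 !divr1; split; [split => //; lra|split => //; lra|].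
- move=> n s t [[as_ sb] [ct td] KP].
  pose u := x n.+1; pose v := y n.+1.
  have PhiE : Phi s t (x n) (y n) = Phi s t u v + Phi (s + u) t u v
      + Phi s (t + v) u v + Phi (s + u) (t + v) u v.
    by rewrite /Phi xS yS -/u -/v !addrA; ring.
  have : exists i j : bool, K / 4 ^+ n.+1 <=
      `|Phi (s + i%:R * u) (t + j%:R * v) u v|.
    apply: contrapT => no.
    have lt (i j : bool) : `|Phi (s + i%:R * u) (t + j%:R * v) u v| < K / 4 ^+ n.+1.
      by rewrite ltNge; apply/negP => ?; apply: no; exists i, j.
    have := lt false false; have := lt true false; have := lt false true.
    have := lt true true; rewrite !mul1r !mul0r !addr0.
    have E : K / 4 ^+ n = 4 * (K / 4 ^+ n.+1) by rewrite exprS; field.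
    rewrite PhiE E in KP; move=> l1 l2 l3 l4; move: KP; apply/negP.
    rewrite -ltNge.
    apply: le_lt_trans (ler_normD _ _) _.
    apply: le_lt_trans (lerD (ler_normD _ _) (lexx _)) _.
    apply: le_lt_trans (lerD (lerD (ler_normD _ _) (lexx _)) (lexx _)) _.
    by lra.
  move=> [i [j Kij]]; exists i, j; rewrite -/(x n.+1) -/(y n.+1) -/u -/v.
  have u0 : 0 <= u := x0 _; have v0 : 0 <= v := y0 _.
  rewrite xS yS -/u -/v in sb td.
  split; last by [].
  + by case: (i); rewrite ?mul1r ?mul0r -/u; lra.
  + by case: (j); rewrite ?mul1r ?mul0r -/v; lra.
have [s1 [t1 [[[h1 h2] [h3 h4] _] h5 h6]]] := st0 0%N.
have s0i : a <= s0 <= b by rewrite -/(x _) in h5; lra.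
have t0i : c <= t0 <= d by rewrite -/(y _) in h6; lra.
have [p [q [r PQ]]] := dPQ s0i t0i.
pose L := (b - a) + (d - c).
have L0 : 0 <= L by rewrite /L; lra.
(* Chosen so that 2 * eps * L^2 < K; the summand 1 keeps the denominator nonzero when L = 0. *)
pose eps := K / (4 * (L + 1) ^+ 2).
have L1 : 0 < (L + 1) ^+ 2 by apply: exprn_gt0; rewrite (ltr_pwDr ltr01 L0).
have eps0 : 0 < eps by rewrite divr_gt0// mulr_gt0.
have [dl dl0 dlP] := PQ _ eps0.
have [n nP] : exists n, L / 2 ^+ n < dl.
  exists (Num.bound (L / dl)).
  rewrite ltr_pdivrMr ?exprn_gt0// mulrC -ltr_pdivrMr//.
  apply: lt_le_trans (archi_boundP (divr_ge0 L0 (ltW dl0))) _.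
  by rewrite -natrX ler_nat ltnW// ltn_expl.
have [s [t [[[sa sb] [tc td] KP] hs ht]]] := st0 n.
rewrite -/(x n) in hs; rewrite -/(y n) in ht.
have xy : x n + y n = L / 2 ^+ n by rewrite /x /y /L; field.
have := @Phi_small s0 t0 p q r eps s t (x n) (y n) (x0 n) (y0 n) sa sb tc td
  hs ht (ltW eps0).
have x0n := x0 n; have y0n := y0 n.
move=> H; have {}H : `|Phi s t (x n) (y n)| <= 2 * eps * (x n + y n) ^+ 2.
  have xydl : x n + y n < dl by rewrite xy.
  clear -x0n y0n hs ht sa sb tc td dlP xydl H.
  by apply: H => s' t' hs' ht'; apply: dlP; rewrite ?ltr_norml; lra.
have := le_trans KP H.
rewrite xy expr_div_n -exprM mulnC exprM.
have -> : (2 : R) ^+ 2 = 4 by ring.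
rewrite mulrA ler_pM2r ?invr_gt0 ?exprn_gt0//.
apply/negP; rewrite -ltNge /eps.
have -> : 2 * (K / (4 * (L + 1) ^+ 2)) * L ^+ 2 = K * (2 * L ^+ 2 / (4 * (L + 1) ^+ 2)).
  by field; rewrite (gt_eqF (ltr_pwDr ltr01 L0)).
rewrite gtr_pMr// ltr_pdivrMr ?mulr_gt0//.
suff : L ^+ 2 < (L + 1) ^+ 2 by move: (L ^+ 2) ((L + 1) ^+ 2) L1 => X Y; lra.
by rewrite ltrXn2r// ltr_pwDr.
Unshelve. all: exact: (ltr_pwDr ltr01 L0).
Qed.

End goursat.

(** * The complex modulus and the exponential *)

Section cabs.
Variable R : realType.
Implicit Types z w : R[i].

(** The norm of [R[i]] takes its values in [R[i]]; this is its real-valued form, for estimates in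
    the ordered field [R]. *)
Definition cabs z : R := complex.Re `|z|.

Lemma cabsE z : `|z| = (cabs z)%:C%C.
Proof. by rewrite /cabs normc_def. Qed.

Lemma cabs_ge0 z : 0 <= cabs z.
Proof. by rewrite -ler0c -cabsE. Qed.

Lemma cabsM z w : cabs (z * w) = cabs z * cabs w.
Proof. by apply: (@complexI R); rewrite rmorphM/= -!cabsE normrM. Qed.

Lemma cabsN z : cabs (- z) = cabs z.
Proof. by apply: (@complexI R); rewrite -!cabsE normrN. Qed.

Lemma cabsD z w : cabs (z + w) <= cabs z + cabs w.
Proof. by rewrite -lecR rmorphD/= -!cabsE ler_normD. Qed.

Lemma cabs0 : cabs 0 = 0.
Proof. by apply: (@complexI R); rewrite -!cabsE normr0. Qed.

Lemma cabs_eq0 z : (cabs z == 0) = (z == 0).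
Proof. by rewrite -[RHS]normr_eq0 cabsE -(inj_eq (@complexI R)). Qed.

Lemma cabs_gt0 z : (0 < cabs z) = (z != 0).
Proof. by rewrite lt_def cabs_eq0 cabs_ge0 andbT. Qed.

Lemma cabs_real (r : R) : cabs r%:C%C = `|r|.
Proof. by rewrite /cabs normc_def/= expr0n/= addr0 sqrtr_sqr. Qed.

Lemma cabs_ge_Re z : `|complex.Re z| <= cabs z.
Proof. by rewrite -lecR -cabsE; exact: normc_ge_Re. Qed.

Lemma cabs_ge_Im z : `|complex.Im z| <= cabs z.
Proof.
rewrite -(sqrtr_sqr (complex.Im z)) /cabs normc_def/= ler_wsqrtr//.
by rewrite lerDr sqr_ge0.
Qed.

Lemma cabs_le z : cabs z <= `|complex.Re z| + `|complex.Im z|.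
Proof.
case: z => a b /=; have -> : a +i* b = a%:C%C + (0 +i* b).
  by rewrite /GRing.add/= addr0 add0r.
apply: le_trans (cabsD _ _) _; rewrite cabs_real lerD2l.
by rewrite /cabs normc_def/= expr0n/= add0r sqrtr_sqr.
Qed.

Lemma cabs_lt z (e : R[i]) : 0 < e -> (`|z| < e) = (cabs z < complex.Re e).
Proof.
move=> e0; have /RRe_real <- : e \is Num.real by rewrite realE ltW.
by rewrite cabsE ltcR.
Qed.

Lemma cabs_sqr z : cabs z ^+ 2 = complex.Re z ^+ 2 + complex.Im z ^+ 2.
Proof. by rewrite /cabs normc_def/= sqr_sqrtr// addr_ge0 ?sqr_ge0. Qed.

Lemma norm_lt1 z : (`|z| < 1) = (cabs z < 1).
Proof. by rewrite cabs_lt. Qed.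

Lemma norm_le1 z : (`|z| <= 1) = (cabs z <= 1).
Proof. by rewrite cabsE lecR. Qed.

Lemma nearC z (P : set R[i]) :
  (\forall w \near z, P w) <->
  exists2 d : R, 0 < d & forall w, cabs (w - z) < d -> P w.
Proof.
split=> [/nbhs_ballP[e /= e0 eP]|[d d0 dP]].
  exists (complex.Re e) => [|w wz].
    by move: e0; rewrite ltcE/= => /andP[].
  by apply: eP; rewrite /ball/= distrC cabs_lt.
apply/nbhs_ballP; exists d%:C%C => /=; first by rewrite ltcR.
by move=> w; rewrite /ball/= distrC cabs_lt ?ltcR//; exact: dP.
Qed.

Lemma within_cvgC (D : set R[i]) (f : R[i] -> R[i]) z l :
  f @ within D (nbhs z) --> l -> forall e : R, 0 < e ->
  exists2 d : R, 0 < d & forall w, D w -> cabs (w - z) < d -> cabs (f w - l) < e.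
Proof.
move=> /cvgrPdist_lt fl e e0.
have := fl e%:C%C; rewrite ltcR => /(_ e0) /nearC[d d0 dP]; exists d => // w Dw wz.
by have := dP w wz Dw; rewrite distrC cabs_lt ?ltcR.
Qed.

Lemma cvgC_within (D : set R[i]) (f : R[i] -> R[i]) z l :
  (forall e : R, 0 < e -> exists2 d : R, 0 < d &
     forall w, D w -> cabs (w - z) < d -> cabs (f w - l) < e) ->
  f @ within D (nbhs z) --> l.
Proof.
move=> fl; apply/cvgrPdist_lt => e e0.
have [|d d0 dP] := fl (complex.Re e); first by move: e0; rewrite ltcE => /andP[].
by apply/nearC; exists d => // w wz Dw; rewrite /= distrC cabs_lt//; exact: dP.
Qed.

End cabs.

(** Together with [approx_is_derive], differentiability as a first-order estimate, which passes
    through changes of variable without dividing by an increment. *)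
Lemma derive_approx (K : numFieldType) (f : K -> K) (z d : K) :
  is_derive z 1 f d -> forall e, 0 < e ->
  \forall w \near z, `|f w - (f z + d * (w - z))| <= e * `|w - z|.
Proof.
move=> [fz <-] e e0.
have /cvgrPdist_le/(_ _ e0) := fz; rewrite /= -/('D_1 f z).
move=> /nbhs_ballP[dl /= dl0 dlP].
apply/nbhs_ballP; exists dl => //= w zw.
have [->|wz] := eqVneq w z; first by rewrite !subrr mulr0 addr0 subrr normr0 mulr0.
move: zw; rewrite /ball/= distrC => zw.
have := dlP (w - z); rewrite /ball/= sub0r normrN subr_eq0 => /(_ zw wz).
rewrite [_%:A]mulr1 subrK -(ler_pM2r (x := `|w - z|)) ?normr_gt0 ?subr_eq0//.
rewrite -normrM => h; apply: le_trans _ h; rewrite -[leLHS]normrN le_eqVlt.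
by apply/orP/or_introl/eqP; congr `|_|; rewrite /GRing.scale/=; field; rewrite subr_eq0.
Qed.

Lemma approx_is_derive (K : numFieldType) (f : K -> K) (z d : K) :
  (forall e, 0 < e ->
  \forall w \near z, `|f w - (f z + d * (w - z))| <= e * `|w - z|) ->
  is_derive z 1 f d.
Proof.
move=> fd.
have c : h^-1 *: (f (h *: 1 + z) - f z) @[h --> 0^'] --> d.
  apply/cvgrPdist_le => e e0.
  have /nbhs_ballP[dl /= dl0 dlP] := fd e e0.
  apply/nbhs_ballP; exists dl => //= h; rewrite /ball/= sub0r normrN => hdl h0.
  have := dlP (h + z); rewrite /ball/= opprD addrCA subrr addr0 normrN => /(_ hdl).
  rewrite [_%:A]mulr1 addrK -(ler_pM2r (x := `|h|^-1)) ?invr_gt0 ?normr_gt0//.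
  rewrite mulfK ?normr_eq0// -normfV -normrM -normrN; congr (`|_| <= _).
  by rewrite /GRing.scale/=; field.
by apply: DeriveDef; [apply/cvg_ex; exists d|apply: cvg_lim].
Qed.

Lemma derive_approxC (R : realType) (f : R[i] -> R[i]) (z d : R[i]) :
  is_derive z 1 f d -> forall e : R, 0 < e -> exists2 dl : R, 0 < dl &
  forall w, cabs (w - z) < dl -> cabs (f w - (f z + d * (w - z))) <= e * cabs (w - z).
Proof.
move=> fz e e0; have := derive_approx fz; move=> /(_ e%:C%C); rewrite ltcR.
move=> /(_ e0)/nearC[dl dl0 dlP]; exists dl => // w /dlP.
by rewrite !cabsE -rmorphM/= lecR.
Qed.

Section polar.
Variable R : realType.
Implicit Types s t : R.

Definition cis t : R[i] := cos t +i* sin t.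
(** The exponential of s + i t: logarithmic polar coordinates on the punctured plane, with s < 0
    inside the unit disk. *)
Definition cexp s t : R[i] := (expR s)%:C%C * cis t.

Lemma cabs_cis t : cabs (cis t) = 1.
Proof. by rewrite /cabs normc_def/= cos2Dsin2 sqrtr1. Qed.

Lemma cisD s t : cis (s + t) = cis s * cis t.
Proof. by rewrite /cis cosD sinD [sin s * _ + _]addrC. Qed.

Lemma cis0 : cis 0 = 1.
Proof. by rewrite /cis cos0 sin0. Qed.

Lemma cis2pi : cis (pi *+ 2) = 1.
Proof. by rewrite /cis cos2pi sin2pi. Qed.

Lemma cabs_cexp s t : cabs (cexp s t) = expR s.
Proof. by rewrite cabsM cabs_cis mulr1 cabs_real ger0_norm// expR_ge0. Qed.

Lemma cexpD s t s' t' : cexp (s + s') (t + t') = cexp s t * cexp s' t'.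
Proof. by rewrite /cexp cisD expRD rmorphM/= mulrACA. Qed.

Lemma cexp_approx0 (e : R) : 0 < e -> exists2 dl : R, 0 < dl &
  forall s t, `|s| < dl -> `|t| < dl ->
  cabs (cexp s t - (1 + (s +i* t))) <= e * (`|s| + `|t|).
Proof.
(* The factor 8 is the sum 3 + 3 + 2 of the coefficients of e' * |t| in the bounds [c1] and [c2]. *)
move=> e0; have [e' [e'0 e'1 e'e]] : exists e' : R, [/\ 0 < e', e' <= 1 & 8 * e' <= e].
  exists (Num.min 1 (e / 8)); rewrite lt_min ltr01 divr_gt0// ge_min lexx.
  by split=> //; have : Num.min 1 (e / 8) <= e / 8; [rewrite ge_min lexx orbT|lra].
have /nbhs_ballP[d1 /= d10 H1] := (derive_approx (is_derive_expR (0 : R)) e'0).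
have /nbhs_ballP[d2 /= d20 H2] := (derive_approx (is_derive_cos (0 : R)) e'0).
have /nbhs_ballP[d3 /= d30 H3] := (derive_approx (is_derive_sin (0 : R)) e'0).
exists (Num.min e' (Num.min d1 (Num.min d2 d3))).
  by rewrite !lt_min e'0 d10 d20 d30.
move=> s t; rewrite !lt_min => /and4P[se s1 _ _] /and4P[te _ t2 t3].
have := H1 s; rewrite /ball/= sub0r normrN => /(_ s1).
have := H2 t; rewrite /ball/= sub0r normrN => /(_ t2).
have := H3 t; rewrite /ball/= sub0r normrN => /(_ t3).
rewrite expR0 cos0 sin0 !subr0 mul1r oppr0 mul0r addr0 add0r mul1r.
move=> hs hc he.
apply: le_trans (cabs_le _) _ => /=.
rewrite !mul0r !subr0 !addr0.
have es0 := expR_ge0 s.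
have s0 := normr_ge0 s; have t0 := normr_ge0 t.
have es3 : expR s <= 3.
  have : `|expR s - (1 + s)| <= 1 by nra.
  by move: se he; rewrite !ltr_norml !ler_norml; lra.
have es1 : `|expR s - 1| <= 2 * `|s|.
  have -> : expR s - 1 = (expR s - (1 + s)) + s by ring.
  by apply: le_trans (ler_normD _ _) _; nra.
have c1 : `|expR s * cos t - (1 + s)| <= e' * `|s| + 3 * (e' * `|t|).
  have -> : expR s * cos t - (1 + s) = (expR s - (1 + s)) + expR s * (cos t - 1).
    by ring.
  apply: le_trans (ler_normD _ _) _; apply: lerD => //.
  by rewrite normrM ger0_norm// ler_pM.
have c2 : `|expR s * sin t - t| <= 3 * (e' * `|t|) + 2 * `|s| * `|t|.
  have -> : expR s * sin t - t = expR s * (sin t - t) + (expR s - 1) * t by ring.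
  apply: le_trans (ler_normD _ _) _; rewrite !normrM (ger0_norm es0).
  by apply: lerD; apply: ler_pM.
rewrite ?add0r ?mulr0 ?addr0.
have : `|s| * `|t| <= e' * `|t| by apply: ler_wpM2r => //; exact: ltW.
nra.
Qed.

End polar.

(** * Holomorphic functions on the unit disk *)

Lemma derivable_continuous (K : numFieldType) (f : K -> K) (z : K) :
  derivable f z 1 -> {for z, continuous f}.
Proof. by move=> /derivable1_diffP; exact: differentiable_continuous. Qed.

Section mean.
Variable R : realType.
Implicit Types (f : R[i] -> R[i]) (z : R[i]).

Definition closed_disk : set R[i] := [set z | `|z| <= 1].

(* Differentiability at 0 is not required, so that the class contains the
   quotients (f z - f 0) / z. *)
Definition hol f := {within closed_disk, continuous f} /\
  forall z, z != 0 -> `|z| < 1 -> derivable f z 1.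

Lemma hol_cont f z : hol f -> `|z| <= 1 -> forall e : R, 0 < e ->
  exists2 d : R, 0 < d & forall w, `|w| <= 1 -> cabs (w - z) < d ->
  cabs (f w - f z) < e.
Proof.
move=> [/subspace_continuousP fc _] z1; exact: (within_cvgC (fc z z1)).
Qed.

(** f(exp w) has the derivative f'(z0) * z0 at w0 = s0 + i t0. Writing exp w = z0 * exp(w - w0)
    reduces the exponential to its estimate at 0. *)
Lemma hol_polar f (s0 t0 : R) : hol f -> s0 < 0 -> exists D : R[i],
  forall e : R, 0 < e -> exists2 dl : R, 0 < dl & forall s t : R,
  `|s - s0| < dl -> `|t - t0| < dl ->
  cabs (f (cexp s t) - (f (cexp s0 t0) + D * ((s - s0) +i* (t - t0))))
    <= e * (`|s - s0| + `|t - t0|).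
Proof.
move=> [_ fd] s00; set z0 := cexp s0 t0.
have z01 : cabs z0 < 1 by rewrite cabs_cexp expR_lt1.
have /derivableP dfz : derivable f z0 1.
  by apply: fd; rewrite ?norm_lt1// -cabs_gt0 cabs_cexp expR_gt0.
set d := 'D_1 f z0 in dfz; exists (d * z0) => e e0.
have C0 := cabs_ge0 d.
have [e1 [e10 e11 e1e]] : exists e1 : R, [/\ 0 < e1, e1 <= 1 & cabs d * e1 <= e / 2].
  exists (Num.min 1 (e / 2 / (cabs d + 1))).
  have h : 0 < e / 2 / (cabs d + 1) by rewrite !divr_gt0//; lra.
  rewrite lt_min ltr01 h ge_min lexx; split => //.
  have : Num.min 1 (e / 2 / (cabs d + 1)) <= e / 2 / (cabs d + 1).
    by rewrite ge_min lexx orbT.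
  move=> /(ler_wpM2l C0)/le_trans; apply.
  have c1 : 0 < cabs d + 1 by lra.
  by rewrite mulrCA ler_piMr ?ler_pdivrMr//; lra.
have [dl1 dl10 dl1P] := cexp_approx0 e10.
have e40 : 0 < e / 4 by lra.
have [dl2 dl20 dl2P] := derive_approxC dfz e40.
exists (Num.min dl1 (dl2 / 4)); first by rewrite lt_min dl10; lra.
move=> s t; rewrite !lt_min => /andP[s1 s2] /andP[t1 t2].
have := dl1P _ _ s1 t1; set N := `|s - s0| + `|t - t0|.
have N0 : 0 <= N by rewrite addr_ge0.
have ze : cabs ((s - s0) +i* (t - t0)) <= N by rewrite (le_trans (cabs_le _)).
set ze_ := (_ +i* _) in ze *.
set rho := _ - (1 + ze_) => rhoN.
have wE : cexp s t = z0 * (1 + ze_ + rho).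
  rewrite /rho /z0 addrC subrK -cexpD; congr cexp; ring.
have wz : cabs (cexp s t - z0) <= 2 * N.
  have -> : cexp s t - z0 = z0 * (ze_ + rho) by rewrite wE; ring.
  rewrite cabsM (le_trans (ler_wpM2r (cabs_ge0 _) (ltW z01)))// mul1r.
  by rewrite (le_trans (cabsD _ _))//; nra.
have := dl2P (cexp s t).
have -> : f (cexp s t) - (f z0 + d * z0 * ze_) =
  (f (cexp s t) - (f z0 + d * (cexp s t - z0))) + d * (z0 * rho).
  by rewrite wE; ring.
move=> H; have {}H := H _; apply: le_trans (cabsD _ _) _.
have h1 : cabs (d * (z0 * rho)) <= e / 2 * N.
  rewrite cabsM (cabsM z0); apply: le_trans (ler_wpM2r N0 e1e); rewrite -mulrA.
  apply: ler_wpM2l => //; apply: le_trans rhoN.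
  by rewrite ler_piMl ?cabs_ge0// ltW.
have h2 : cabs (f (cexp s t) - (f z0 + d * (cexp s t - z0))) <= e / 4 * (2 * N).
  apply: le_trans (H _) _; last by apply: ler_wpM2l => //; lra.
  by apply: le_lt_trans wz _; rewrite /N; lra.
by apply: le_trans (lerD h2 h1) _; lra.
Qed.

(** The Cauchy-Riemann equations in the coordinates (s, t), with complex derivative p + i q: the
    form Im f ds + Re f dt, which is the imaginary part of f(exp w) dw, is closed. *)
Lemma hol_polar_real f (s0 t0 : R) : hol f -> s0 < 0 -> exists p q : R,
  forall e : R, 0 < e -> exists2 dl : R, 0 < dl & forall s t : R,
  `|s - s0| < dl -> `|t - t0| < dl ->
  `|complex.Im (f (cexp s t)) - (complex.Im (f (cexp s0 t0)) + q * (s - s0) + p * (t - t0))|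
     <= e * (`|s - s0| + `|t - t0|) /\
  `|complex.Re (f (cexp s t)) - (complex.Re (f (cexp s0 t0)) + p * (s - s0) + (- q) * (t - t0))|
     <= e * (`|s - s0| + `|t - t0|).
Proof.
move=> hf s00; have [[p q] D] := hol_polar t0 hf s00; exists p, q => e e0.
have [dl dl0 dlP] := D e e0; exists dl => // s t hs ht.
have := dlP s t hs ht; case: (f (cexp s t)) => a b; case: (f (cexp s0 t0)) => a0 b0.
move=> H; split.
- apply: le_trans H; apply: le_trans (cabs_ge_Im _) => /=.
  by rewrite le_eqVlt; apply/orP/or_introl/eqP; congr `|_|; ring.
- apply: le_trans H; apply: le_trans (cabs_ge_Re _) => /=.
  by rewrite le_eqVlt; apply/orP/or_introl/eqP; congr `|_|; ring.
Qed.

Let T : R := pi *+ 2.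
Let T0 : 0 < T. Proof. by rewrite /T mulr2n addr_gt0// pi_gt0. Qed.

Lemma hol_cont_t f (s : R) : hol f -> s < 0 ->
  continuous (fun t => complex.Re (f (cexp s t))).
Proof.
move=> hf s0 t; have [p [q D]] := hol_polar_real t hf s0.
suff : is_derive t 1 (fun t => complex.Re (f (cexp s t))) (- q).
  by move=> [dt _]; exact: derivable_continuous dt.
apply: approx_is_derive => e e0; have [dl dl0 dlP] := D e e0.
apply/nbhs_ballP; exists dl => // t'; rewrite /ball/= distrC => tt'.
have := dlP s t' _ tt'; rewrite subrr normr0 add0r => /(_ dl0)[_].
by rewrite ?mulr0 ?addr0.
Qed.

(** Truncating s at b < 0 keeps the point inside the disk, which makes the function continuous on
    the whole line, as [ex_primitive] requires. *)
Lemma hol_cont_s f (t b : R) : hol f -> b < 0 ->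
  continuous (fun s => complex.Im (f (cexp (Num.min s b) t))).
Proof.
move=> hf b0 s.
have m0 : Num.min s b < 0 by rewrite gt_min b0 orbT.
have [p [q D]] := hol_polar_real t hf m0.
suff : is_derive (Num.min s b) 1 (fun s => complex.Im (f (cexp s t))) q.
  move=> [/derivable_continuous dt _].
  apply: (@continuous_comp _ _ _ (fun s => Num.min s b) (fun s => complex.Im (f (cexp s t)))) => //.
  by apply: (@continuous_min _ _ id (cst b)) => //; exact: cst_continuous.
apply: approx_is_derive => e e0; have [dl dl0 dlP] := D e e0.
apply/nbhs_ballP; exists dl => // t'; rewrite /ball/= distrC => tt'.
have := dlP t' t tt'; rewrite subrr normr0 addr0 => /(_ dl0)[].
by rewrite ?mulr0 ?addr0.
Qed.

Lemma is_derive0_cst (g : R -> R) (a b : R) : a <= b ->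
  (forall x, a <= x <= b -> is_derive x 1 g 0) -> g b = g a.
Proof.
move=> ab dg; suff : `|g b - g a| <= 0 * (b - a).
  by rewrite mul0r normr_le0 subr_eq0 => /eqP.
by apply: (mvt_norm ab dg) => x _; rewrite normr0.
Qed.

(** The increment of G is the integral of Re f over the circle of radius exp s. In Goursat's theorem
    on [s1, s] x [0, 2 pi] the sides t = 0 and t = 2 pi are the same segment of the disk and cancel,
    so the integral does not depend on s; letting s tend to minus infinity, continuity at 0 gives
    its value. *)
Lemma mean_value f (s : R) (G : R -> R) : hol f -> s < 0 ->
  (forall t, 0 <= t <= T -> is_derive t 1 G (complex.Re (f (cexp s t)))) ->
  G T - G 0 = T * complex.Re (f 0).
Proof.
move=> hf s0 dG.
have /choice[B BP] : forall s1 : R, exists B : R -> R, s1 < 0 ->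
    forall t, - 1 < t < T + 1 -> is_derive t 1 B (complex.Re (f (cexp s1 t))).
  move=> s1; case: (ltP s1 0) => s10; last by exists id.
  by have [B BP] := ex_primitive (-1) (T + 1) (hol_cont_t hf s10); exists B => _.
have dB s1 t : s1 < 0 -> 0 <= t <= T -> is_derive t 1 (B s1) (complex.Re (f (cexp s1 t))).
  by move=> s10 ht; apply: BP => //; lra.
have VG : G T - G 0 = B s T - B s 0.
  have := @is_derive0_cst (fun t => G t - B s t) 0 T (ltW T0) _.
  have dd t : 0 <= t <= T -> is_derive t 1 (fun t => G t - B s t) 0.
    move=> ht; have dGt := dG t ht; have dBt := dB s t s0 ht.
    by apply: is_derive_eq; rewrite subrr.
  by move=> /(_ dd) => h; lra.
have VV s1 : s1 <= s -> B s T - B s 0 = B s1 T - B s1 0.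
  move=> s1s.
  pose g (t u : R) : R := complex.Im (f (cexp (Num.min u s) t)).
  have prim (t : R) : exists A : R -> R, forall u : R, s1 - 1 < u < s + 1 -> is_derive u 1 A (g t u).
    have := @ex_primitive R (g t) (s1 - 1) (s + 1) (hol_cont_s (t := t) hf s0).
    exact.
  have [A0 A0P] := prim 0.
  have gT : g T = g 0.
    by apply/funext => u; rewrite /g /cexp cis2pi cis0.
  (* The same primitive serves t = 0 and t = T, where the integrands agree by periodicity, so that
     the two sides cancel exactly. *)
  pose A u t := if t == 0 then A0 u else if t == T then A0 u else
     sval (cid (prim t)) u.
  have AP u t : s1 <= u <= s -> is_derive u 1 (A ^~ t) (complex.Im (f (cexp u t))).
    move=> hu; have us : Num.min u s = u by rewrite min_l; lra.
    have hu' : s1 - 1 < u < s + 1 by lra.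
    rewrite /A; have [->|t0] := eqVneq t 0.
      by have := A0P u hu'; rewrite /g us.
    have [->|tT] := eqVneq t T.
      by have := A0P u hu'; rewrite -gT /g us.
    by case: cid => At /= /(_ u hu'); rewrite /g us.
  have := @goursat R (fun s t => complex.Im (f (cexp s t)))
     (fun s t => complex.Re (f (cexp s t))) A B s1 s 0 T s1s (ltW T0) _ _ _.
  have AT u : A u T = A u 0 by rewrite /A !eqxx; case: eqP.
  rewrite !AT => H; have {}H := H _ _ _.
  suff: A s 0 - A s1 0 + (B s T - B s 0) - (A s 0 - A s1 0) - (B s1 T - B s1 0) = 0.
    by lra.
  apply: H.
  - by move=> u t hu ht; exact: AP.
  - by move=> u t hu ht; apply: dB => //; lra.
  - move=> u0 t0 hu0 ht0; have u00 : u0 < 0 by lra.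
    have [p [q D]] := hol_polar_real t0 hf u00; exists q, p, (- q) => e e0.
    have [dl dl0 dlP] := D e e0; exists dl => // u t _ _ hu ht.
    exact: dlP.
apply/eqP; rewrite -subr_eq0 -normr_le0 VG; apply/ler_addgt0Pr => e e0.
rewrite add0r.
have eT : 0 < e / T by rewrite divr_gt0.
have [|d d0 dP] := @hol_cont f 0 hf _ _ eT; first by rewrite normr0 ler01.
have [s1 s1s s1d] : exists2 s1, s1 <= s & expR s1 < d.
  exists (Num.min s (ln (d / 2))); first by rewrite ge_min lexx.
  apply: (@le_lt_trans _ _ (d / 2)); last by lra.
  rewrite -[leRHS]lnK ?posrE ?divr_gt0// ler_expR.
  by rewrite ge_min lexx orbT.
have s10 : s1 < 0 by lra.
rewrite (VV s1)//.
pose g t := B s1 t - t * complex.Re (f 0).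
have -> : B s1 T - B s1 0 - T * complex.Re (f 0) = g T - g 0 by rewrite /g; ring.
apply: le_trans (@mvt_norm _ g (fun t => complex.Re (f (cexp s1 t)) - complex.Re (f 0)) 0 T (e / T) (ltW T0) _ _) _.
- move=> t ht; have dBt := dB s1 t s10 ht; rewrite /g; apply: is_derive_eq.
  by rewrite /GRing.scale/=; ring.
- move=> t ht; rewrite -raddfB /=; apply: le_trans (cabs_ge_Re _) _.
  apply/ltW/dP; first by rewrite norm_le1 cabs_cexp expR_le1 ltW.
  by rewrite subr0 cabs_cexp.
by rewrite subr0 divfK// gt_eqF.
Qed.

End mean.

Lemma mvt_ge (R : realType) (f df : R -> R) (a b M : R) : a <= b ->
  (forall x, a <= x <= b -> is_derive x 1 f (df x)) ->
  (forall x, a <= x <= b -> M <= df x) -> M * (b - a) <= f b - f a.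
Proof.
move=> ab fdf Mdf.
suff : - f b - (- f a) <= (- M) * (b - a) by lra.
apply: (@mvt_le _ (fun x => - f x) (fun x => - df x)) => //.
  by move=> x /fdf ?; exact: is_deriveN.
by move=> x /Mdf; rewrite lerN2.
Qed.

(** * Operations on holomorphic functions of the disk *)

Section hol_closure.
Variable R : realType.
Implicit Types (f g : R[i] -> R[i]) (z c : R[i]).

Lemma hol_cst c : hol (fun _ => c).
Proof.
split=> [|z _ _]; last exact: derivable_cst.
by apply: continuous_subspaceT; exact: cst_continuous.
Qed.

Lemma hol_id : hol (fun z : R[i] => z).
Proof.
split=> [|z _ _]; last exact: derivable_id.
by apply: continuous_subspaceT => z.
Qed.

Lemma holD f g : hol f -> hol g -> hol (fun z => f z + g z).
Proof.
move=> [/subspace_continuousP fc fd] [/subspace_continuousP gc gd]; split.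
  by apply/subspace_continuousP => z z1; apply: cvgD; [exact: fc|exact: gc].
by move=> z z0 z1; apply: derivableD; [exact: fd|exact: gd].
Qed.

Lemma holM f g : hol f -> hol g -> hol (fun z => f z * g z).
Proof.
move=> [/subspace_continuousP fc fd] [/subspace_continuousP gc gd]; split.
  by apply/subspace_continuousP => z z1; apply: cvgM; [exact: fc|exact: gc].
by move=> z z0 z1; apply: derivableM; [exact: fd|exact: gd].
Qed.

Lemma holN f : hol f -> hol (fun z => - f z).
Proof.
move=> hf; rewrite (_ : (fun _ => _) = (fun z => -1 * f z)); last first.
  by apply/funext => z; rewrite mulN1r.
exact: (holM (hol_cst (-1)) hf).
Qed.

Lemma hol_prod (I : Type) (r : seq I) (F : I -> R[i] -> R[i]) :
  (forall i, hol (F i)) -> hol (fun z => \prod_(i <- r) F i z).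
Proof.
move=> hF; elim: r => [|i r IH].
  rewrite (_ : (fun _ => _) = (fun=> 1)); first exact: hol_cst.
  by apply/funext => z; rewrite big_nil.
rewrite (_ : (fun _ => _) = (fun z => F i z * \prod_(i <- r) F i z)).
  exact: (holM (hF i) IH).
by apply/funext => z; rewrite big_cons.
Qed.

Lemma derivable_scale f z c : derivable f (c * z) 1 ->
  derivable (fun w => f (c * w)) z 1.
Proof.
move=> /derivableP; set d := 'D_1 f _ => fd.
suff : is_derive z 1 (fun w => f (c * w)) (d * c) by case.
have c0 := cabs_ge0 c; have c1 : 0 < cabs c + 1 by lra.
have c1' : 0 < (cabs c + 1)%:C%C by rewrite ltcR.
apply: approx_is_derive => e e0; have := derive_approx fd (divr_gt0 e0 c1').
move=> /nearC[dl dl0 dlP]; apply/nearC; exists (dl / (cabs c + 1)).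
  by rewrite divr_gt0.
move=> w wz; have := dlP (c * w); rewrite -mulrBr => H.
rewrite -mulrA; apply: le_trans (H _) _.
  rewrite cabsM; apply: (@le_lt_trans _ _ ((cabs c + 1) * cabs (w - z))).
    by rewrite ler_wpM2r ?cabs_ge0//; lra.
  by rewrite -ltr_pdivlMl// mulrC.
rewrite normrM mulrA ler_wpM2r// mulrAC ler_pdivrMr// ler_wpM2l ?ltW//.
by rewrite cabsE ltcR; lra.
Qed.

Lemma hol_rot f c : `|c| = 1 -> hol f -> hol (fun z => f (c * z)).
Proof.
move=> c1 hf; split=> [|z z0 z1]; last first.
  apply: derivable_scale; case: hf => _; apply; last by rewrite normrM c1 mul1r.
  by rewrite mulf_neq0// -normr_eq0 c1 oner_eq0.
apply/subspace_continuousP => z z1; apply: cvgC_within => e e0.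
have [|d d0 dP] := hol_cont hf _ e0 (z := c * z).
  by rewrite normrM c1 mul1r.
exists d => // w w1 wz; apply: dP; first by rewrite normrM c1 mul1r.
have c1' : cabs c = 1 by apply: (@complexI R); rewrite -cabsE c1.
by rewrite -mulrBr cabsM c1' mul1r.
Qed.

Lemma cabs_conj z : cabs z^*%C = cabs z.
Proof. by apply: (@complexI R); rewrite -!cabsE normcJ. Qed.

Lemma derivable_conj f z : derivable f z^*%C 1 ->
  derivable (fun w => (f w^*%C)^*%C) z 1.
Proof.
move=> /derivableP; set d := 'D_1 f _ => fd.
suff : is_derive z 1 (fun w => (f w^*%C)^*%C) d^*%C by case.
apply: approx_is_derive => e e0; have := derive_approx fd e0.
move=> /nearC[dl dl0 dlP]; apply/nearC; exists dl => // w wz.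
have := dlP w^*%C; rewrite -[w^*%C - z^*%C]rmorphB/= cabs_conj => /(_ wz).
rewrite -[leLHS]normcJ normcJ.
rewrite -[X in _ -> X <= _]normcJ; congr (`|_| <= _); last by rewrite normcJ.
by rewrite [RHS]rmorphB [X in _ = _ - X]rmorphD [X in _ = _ - (_ + X)]rmorphM/= !conjcK.
Qed.

Lemma hol_conj f : hol f -> hol (fun z => (f z^*%C)^*%C).
Proof.
move=> hf; split=> [|z z0 z1]; last first.
  apply: derivable_conj; case: hf => _; apply; last by rewrite normcJ.
  by rewrite conjc_eq0.
apply/subspace_continuousP => z z1; apply: cvgC_within => e e0.
have [|d d0 dP] := hol_cont hf _ e0 (z := z^*%C); first by rewrite normcJ.
exists d => // w w1 wz; rewrite -rmorphB/= cabs_conj; apply: dP.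
  by rewrite normcJ.
by rewrite -rmorphB/= cabs_conj.
Qed.

Lemma near_neqC z c : z != c -> \forall w \near z, w != c.
Proof.
move=> zc; apply/nearC; exists (cabs (z - c)); first by rewrite cabs_gt0 subr_eq0.
by move=> w; apply: contraTneq => ->; rewrite -cabsN opprB ltxx.
Qed.

Lemma hol_div f (d : R[i]) : hol f -> f 0 = 0 -> is_derive (0 : R[i]) 1 f d ->
  hol (fun z => if z == 0 then d else f z / z).
Proof.
move=> hf f0 df; split=> [|z z0 z1]; last first.
  apply: (@near_eq_derivable _ _ _ (fun w => f w / w)).
    by apply: filterS (near_neqC z0) => w /negbTE ->.
  apply: (@derivableM _ _ f (fun w => w^-1)); first by case: hf => _; exact.
  by apply: (@derivableV _ _ id) => //; exact: derivable_id.
apply/subspace_continuousP => z z1; rewrite /from_subspace.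
have [->|z0] := eqVneq z 0; rewrite ?eqxx ?(negbTE z0).
  apply: cvgC_within => e e0.
  have e20 : 0 < e / 2 by lra.
  have [dl dl0 dlP] := derive_approxC df e20.
  exists dl => // w _ wd.
  have [w0|w0] := eqVneq w 0; first by rewrite ?w0 ?eqxx subrr cabs0.
  have := dlP w wd; rewrite f0 add0r subr0 => H.
  have w0' : 0 < cabs w by rewrite cabs_gt0.
  rewrite -(ltr_pM2r w0') -cabsM mulrBl divfK//; apply: le_lt_trans H _.
  by rewrite ltr_pM2r//; lra.
have h : (fun w => f w * w^-1) @ within (@closed_disk R) (nbhs z) --> f z * z^-1.
  apply: cvgM; first by case: hf => /subspace_continuousP + _; exact.
  by apply: cvgV => //; apply: cvg_within_filter; exact: cvg_id.
apply: cvgC_within => e e0; have [dl dl0 dlP] := within_cvgC h e0.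
exists (Num.min dl (cabs z)); first by rewrite lt_min dl0 cabs_gt0.
move=> w w1; rewrite lt_min => /andP[wd wz].
have /negbTE -> : w != 0.
  by apply: contraTneq wz => ->; rewrite sub0r cabsN ltxx.
exact: dlP.
Qed.

End hol_closure.

(** * Boundary values on the unit circle *)

Lemma cis_surj (R : realType) (z : R[i]) : `|z| = 1 ->
  exists2 t : R, - pi <= t <= pi & z = cis t.
Proof.
move=> z1; have : cabs z ^+ 2 = 1.
  by rewrite (_ : cabs z = 1) ?expr1n//; apply: (@complexI R); rewrite -cabsE z1.
rewrite cabs_sqr; case: z z1 => a b z1 /= ab.
have a1 : -1 <= a <= 1 by have := sqr_ge0 b; nra.
have sE : sin (acos a) = `|b|.
  by rewrite sin_acos// -sqrtr_sqr; congr Num.sqrt; lra.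
have [p0 p1] : 0 <= acos a <= pi /\ 0 <= pi :> R.
  by rewrite acos_ge0// acos_lepi// pi_ge0.
have [b0|b0] := leP 0 b.
  exists (acos a); first by lra.
  by rewrite /cis acosK ?in_itv//= sE ger0_norm.
exists (- acos a); first by lra.
by rewrite /cis cosN sinN acosK ?in_itv//= sE ltr0_norm ?opprK.
Qed.

Section boundary.
Variable R : realType.
Implicit Types (f g : R[i] -> R[i]) (z c : R[i]).

Let T : R := pi *+ 2.
Let T0 : 0 < T. Proof. by rewrite /T mulr2n addr_gt0// pi_gt0. Qed.

Lemma cexp_near (d : R) : 0 < d -> exists2 a : R, 0 < a &
  forall s t : R, `|s| < a -> `|t| < a -> cabs (cexp s t - 1) < d.
Proof.
move=> d0; have [a a0 aP] := @cexp_approx0 R 1 ltr01.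
exists (Num.min a (d / 4)); first by rewrite lt_min a0; lra.
move=> s t; rewrite !lt_min => /andP[sa sd] /andP[ta td].
have -> : cexp s t - 1 = (cexp s t - (1 + (s +i* t))) + (s +i* t) by ring.
apply: le_lt_trans (cabsD _ _) _.
by have := aP s t sa ta; have := cabs_le (s +i* t) => /=; lra.
Qed.

(** Continuity up to the circle gives the bound on a small polar box at each boundary point;
    compactness of [0, 2 pi] makes the width of the boxes uniform. *)
Lemma hol_near_circle f (e : R) : hol f -> 0 < e ->
  (forall z, `|z| = 1 -> 0 <= complex.Re (f z)) ->
  exists2 a : R, 0 < a & forall s t : R, - a < s <= 0 -> 0 <= t <= T ->
    - e <= complex.Re (f (cexp s t)).
Proof.
move=> hf e0 fpos.
have /compact_near_coveringP := @segment_compact R 0 T.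
move=> /(_ R (nbhs (0 : R)) (fun s t => s <= 0 -> - e <= complex.Re (f (cexp s t)))).
move=> /(_ (nbhs_filter _))[|a /= a0 aP].
- move=> t _.
  have ct : `|cis t| = 1 :> R[i] by rewrite cabsE cabs_cis.
  have [|d d0 dP] := hol_cont hf _ e0 (z := cis t); first by rewrite ct.
  have [a a0 aP] := cexp_near d0.
  exists (ball t a, ball 0 a).
    by split; apply/nbhs_ballP; exists a.
  move=> [t' s] /= []; rewrite /ball/= sub0r normrN distrC => tt sa s0.
  have := dP (cexp s t'); rewrite norm_le1 cabs_cexp expR_le1 s0 => /(_ isT).
  have -> : cexp s t' - cis t = cis t * (cexp s (t' - t) - 1).
    rewrite mulrBr mulr1; congr (_ - _).
    rewrite -[cis t]mul1r -[1]/((1 : R)%:C%C) -expR0 -/(cexp 0 t) -cexpD.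
    by congr cexp; ring.
  rewrite cabsM cabs_cis mul1r => /(_ (aP _ _ sa tt)).
  move=> H; have := fpos _ ct; have := cabs_ge_Re (f (cexp s t') - f (cis t)).
  rewrite raddfB/= => h1 h2; move: (le_lt_trans h1 H); rewrite ltr_norml; lra.
exists a => // s t sa tT; apply: (aP s) => //; rewrite /=.
- by rewrite sub0r normrN ltr_norml; lra.
- by lra.
Qed.

(* The mean value property, on circles whose radius tends to 1. *)
Lemma hol_Re_boundary f : hol f ->
  (forall z, `|z| = 1 -> 0 <= complex.Re (f z)) -> complex.Re (f 0) <= 0 ->
  forall z, `|z| = 1 -> complex.Re (f z) = 0.
Proof.
move=> hf fpos f0 c c1; apply/eqP; rewrite eq_le fpos// andbT leNgt; apply/negP => fc.
(* Rotation carries the point where the real part is positive to 1, that is to t = 0. *)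
pose F z := f (c * z).
have hF : hol F by exact: hol_rot.
have Fpos z : `|z| = 1 -> 0 <= complex.Re (F z).
  by move=> z1; apply: fpos; rewrite normrM c1 z1 mulr1.
have F0 : complex.Re (F 0) <= 0 by rewrite /F mulr0.
pose dl := complex.Re (f c) / 2.
have dl0 : 0 < dl by rewrite /dl; lra.
have [|d d0 dP] := hol_cont hF _ dl0 (z := 1); first by rewrite normr1.
have [a a0 aP] := cexp_near d0.
pose tau := Num.min (a / 2) T.
have tau0 : 0 < tau by rewrite lt_min T0 andbT; lra.
have [taua tauT] : tau <= a / 2 /\ tau <= T by rewrite !ge_min !lexx orbT.
(* The real part is at least dl on an arc of angle tau and at least -e on the rest. With this e the
   integral is at least dl * tau / 2 > 0, against a mean that is not positive. *)
pose e := dl * tau / (2 * T).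
have e0 : 0 < e by rewrite !(divr_gt0, mulr_gt0).
have [b b0 bP] := hol_near_circle hF e0 Fpos.
pose s := - (Num.min a b / 2).
have m0 : 0 < Num.min a b by rewrite lt_min a0.
have [ma mb] : Num.min a b <= a /\ Num.min a b <= b by rewrite !ge_min !lexx orbT.
have s0 : s < 0 by rewrite /s; lra.
have sa : `|s| < a by rewrite ltr0_norm// /s; lra.
have sb : - b < s <= 0 by rewrite /s; lra.
have [G GP] := @ex_primitive R _ (- 1) (T + 1) (hol_cont_t hF s0).
have GP' t : 0 <= t <= T -> is_derive t 1 G (complex.Re (F (cexp s t))).
  by move=> ht; apply: GP; lra.
have mean := mean_value hF s0 GP'.
have : dl * (tau - 0) <= G tau - G 0.
  apply: (@mvt_ge _ _ (fun t => complex.Re (F (cexp s t)))) => //; first exact: ltW.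
    by move=> t ht; apply: GP'; lra.
  move=> t ht; have := dP (cexp s t); rewrite norm_le1 cabs_cexp expR_le1 ltW// => /(_ isT).
  have ta : `|t| < a by rewrite ger0_norm; lra.
  move=> /(_ (aP _ _ sa ta)) /(le_lt_trans (cabs_ge_Re _)).
  by rewrite raddfB/= {2}/F mulr1 ltr_norml /dl; lra.
have : (- e) * (T - tau) <= G T - G tau.
  apply: (@mvt_ge _ _ (fun t => complex.Re (F (cexp s t)))) => //.
    by move=> t ht; apply: GP'; lra.
  by move=> t ht; apply: bP => //; lra.
have TF : T * complex.Re (F 0) <= 0 by rewrite pmulr_rle0.
have eT : e * T = dl * tau / 2.
  by rewrite /e; field; rewrite ?(gt_eqF T0, gt_eqF (pi_gt0 R)).
have et : 0 <= e * tau by rewrite mulr_ge0// ltW.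
have dt : 0 < dl * tau by rewrite mulr_gt0.
rewrite -/T in mean; lra.
Qed.

(** Otherwise 1 - f / f(0) would have real part 1 on the circle and the value 0 at the centre. *)
Lemma hol_zero_boundary f : hol f -> (forall z, `|z| = 1 -> f z = 0) -> f 0 = 0.
Proof.
move=> hf f0; apply/eqP; apply: contrapT => /negP fn0.
have /hol_Re_boundary H : hol (fun z => 1 + - (f 0)^-1 * f z).
  exact: (holD (hol_cst 1) (holM (hol_cst (- (f 0)^-1)) hf)).
have : complex.Re (1 + - (f 0)^-1 * f 1) = 0.
  apply: H; last by rewrite normr1.
  - by move=> z z1; rewrite (f0 z z1) mulr0 addr0/= ler01.
  - by rewrite mulNr mulVf// subrr.
by rewrite (f0 1 (normr1 _)) mulr0 addr0 => /eqP; rewrite /= oner_eq0.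
Qed.

(** On the circle f * g is |f|^2, which is nonnegative, while f * g vanishes at the centre. *)
Lemma hol_conj_boundary f g : hol f -> hol g -> f 0 * g 0 = 0 ->
  (forall z, `|z| = 1 -> g z = (f z)^*%C) -> forall z, `|z| = 1 -> f z = 0.
Proof.
move=> hf hg fg0 fg z z1.
have := @hol_Re_boundary (fun z => f z * g z) (holM hf hg) _ _ z z1.
have fgE w : `|w| = 1 -> f w * g w = (cabs (f w) ^+ 2)%:C%C.
  by move=> w1; rewrite fg// -sqr_normc cabsE rmorphXn.
rewrite (fgE z z1)/= => H; apply/eqP; rewrite -cabs_eq0 -sqrf_eq0; apply/eqP/H.
- by move=> w w1; rewrite (fgE w w1)/= sqr_ge0.
- by rewrite fg0.
Qed.

(** Liouville's theorem for a function that extends holomorphically to both sides of the circle: the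
    outer extension is the conjugate of g after reflection in the circle. *)
Lemma hol_conj_cst f g : hol f -> hol g ->
  (forall z, `|z| = 1 -> f z = (g z)^*%C) -> forall z, `|z| = 1 -> f z = f 0.
Proof.
move=> hf hg fg z z1; apply/eqP; rewrite -subr_eq0; apply/eqP.
apply: (@hol_conj_boundary (fun z => f z - f 0) (fun z => g z - (f 0)^*%C) _ _ _ _ z z1).
- exact: (holD hf (hol_cst (- f 0))).
- exact: (holD hg (hol_cst (- (f 0)^*%C))).
- by rewrite subrr mul0r.
- by move=> w w1; rewrite (fg w w1) [RHS]rmorphB/= conjcK.
Qed.

Lemma hol_real_cst f : hol f -> (forall z, `|z| = 1 -> complex.Im (f z) = 0) ->
  forall z, `|z| = 1 -> f z = f 0.
Proof.
move=> hf fr; apply: (hol_conj_cst hf hf) => z /fr.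
by case: (f z) => a b /= ->; rewrite oppr0.
Qed.

Lemma is_derive_quadratic (a b c : R[i]) :
  is_derive (0 : R[i]) 1 (fun w => a + b * w + c * w ^+ 2) b.
Proof.
apply: approx_is_derive => e e0.
have eE : (complex.Re e)%:C%C = e by apply/RRe_real; rewrite realE ltW.
move: e0; rewrite -eE ltcR => e0.
have c0 := cabs_ge0 c; have c1 : 0 < cabs c + 1 by lra.
apply/nearC; exists (complex.Re e / (cabs c + 1)); first by rewrite divr_gt0.
move=> w; rewrite !subr0 ltr_pdivlMr// => wd.
have -> : a + b * w + c * w ^+ 2 - (a + b * 0 + c * 0 ^+ 2 + b * w) = c * w * w by ring.
rewrite normrM ler_wpM2r// cabsE lecR cabsM.
by have := cabs_ge0 w; lra.
Qed.

(** In Fourier terms, f has frequencies at least 0 and z^2 times the conjugate of q has frequencies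
    at most 2. Removing c0 + c1 z + c2 z^2 from f, and its reversal from q, leaves g and h with g =
    z^2 times the conjugate of h. Then g / z and h / z are conjugate on the circle, and g / z
    vanishes at 0 because g has a double zero there. *)
Lemma hol_quadratic f q : hol f -> hol q -> derivable f 0 1 -> derivable q 0 1 ->
  (forall z, `|z| = 1 -> f z = z ^+ 2 * (q z)^*%C) ->
  exists a b, forall z, `|z| = 1 -> f z = f 0 + a * z + b * z ^+ 2.
Proof.
move=> hf hq /derivableP; set c1 := 'D_1 f 0 => df /derivableP; set d1 := 'D_1 q 0 => dq fq.
pose c0 := f 0; pose c2 := (q 0)^*%C.
exists c1, c2 => z z1; apply/eqP; rewrite -subr_eq0; apply/eqP.
pose g w := f w - (c0 + c1 * w + c2 * w ^+ 2).
pose h w := q w - (c0^*%C * w ^+ 2 + c1^*%C * w + c2^*%C).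
have hX2 : hol (fun w : R[i] => w ^+ 2) by exact: (holM (@hol_id R) (@hol_id R)).
have hg : hol g.
  exact: (holD hf (holN (holD (holD (hol_cst c0) (holM (hol_cst c1) (@hol_id R)))
    (holM (hol_cst c2) hX2)))).
have hh : hol h.
  exact: (holD hq (holN (holD (holD (holM (hol_cst c0^*%C) hX2)
    (holM (hol_cst c1^*%C) (@hol_id R))) (hol_cst c2^*%C)))).
have dg : is_derive (0 : R[i]) 1 g 0.
  by have := is_deriveB df (is_derive_quadratic c0 c1 c2); rewrite subrr.
have dh : is_derive (0 : R[i]) 1 h (d1 - c1^*%C).
  rewrite (_ : h = q - (fun w => c2^*%C + c1^*%C * w + c0^*%C * w ^+ 2)).
    exact: (is_deriveB dq (is_derive_quadratic _ _ _)).
  apply/funext => w; transitivity (q w - (c2^*%C + c1^*%C * w + c0^*%C * w ^+ 2)).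
    by rewrite /h; congr (_ - _); ring.
  by [].
have g0 : g 0 = 0 by rewrite /g /c0; ring.
have h0 : h 0 = 0 by rewrite /h /c2 conjcK; ring.
have HG := hol_div hg g0 dg; have HH := hol_div hh h0 dh.
have z0 (w : R[i]) : `|w| = 1 -> w != 0 by move=> w1; rewrite -normr_eq0 w1 oner_eq0.
have zz (w : R[i]) : `|w| = 1 -> w^*%C = w^-1.
  by move=> w1; rewrite invc_norm w1 expr1n invr1 mul1r.
have := hol_conj_boundary HG HH _ _ z1; rewrite (negbTE (z0 z z1)) eqxx mul0r.
move=> H; have : g z / z = 0.
  apply: H => // w w1; rewrite (negbTE (z0 w w1)).
  have gE : (g w)^*%C = w^-1 ^+ 2 * q w - (c0^*%C + c1^*%C * w^-1 + c2^*%C * w^-1 ^+ 2).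
    rewrite /g (fq w w1) -(zz w w1) [LHS]rmorphB [X in X - _]rmorphM [X in _ - X]rmorphD.
    rewrite [X in _ - (X + _)]rmorphD [X in _ - (_ + X)]rmorphM [X in _ - (_ + X + _)]rmorphM.
    by rewrite /= conjcK !rmorphXn.
  rewrite [RHS]rmorphM/= conjc_inv (zz w w1) invrK gE /h.
  by field; exact: z0.
by move/eqP; rewrite mulf_eq0 invr_eq0 (negbTE (z0 z z1)) orbF => /eqP.
Qed.

End boundary.

(** * The identity theorem for meromorphic functions *)

Section identity.
Variable R : realType.
Implicit Types (f g : R[i] -> R[i]) (z w p a c : R[i]).

Lemma near_pick p c (d : R) : 0 < d -> exists w, [/\ w != p, w != c & cabs (w - p) < d].
Proof.
move=> d0; have [e1 e2] : cabs (d / 2)%:C%C < d /\ cabs (d / 4)%:C%C < d.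
  by rewrite !cabs_real !ger0_norm; lra.
have n1 (r : R) : 0 < r -> p + r%:C%C != p.
  by move=> r0; rewrite -subr_eq0 addrAC subrr add0r -cabs_eq0 cabs_real normr_eq0 gt_eqF.
have [cE|cE] := eqVneq (p + (d / 2)%:C%C) c; last first.
  exists (p + (d / 2)%:C%C); split=> //; first by apply: n1; lra.
  by rewrite addrAC subrr add0r.
exists (p + (d / 4)%:C%C); split; first by apply: n1; lra.
- rewrite -cE (inj_eq (addrI p)) (inj_eq (@complexI R)) neq_lt; apply/orP; left; lra.
- by rewrite addrAC subrr add0r.
Qed.

Lemma hol_disk f : (forall z, `|z| <= 1 -> derivable f z 1) -> hol f.
Proof.
move=> fd; split=> [|z _ /ltW z1]; last exact: fd.
apply: continuous_in_subspaceT => z; rewrite inE => z1.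
exact/derivable_continuous/fd.
Qed.

(* A point of the circle of center [w0] through [a] can be rotated into the disk
   around [a] where [g] vanishes: the product of finitely many rotations of [g]
   about [w0] vanishes on that circle, hence at [w0]. *)
Lemma vanishing_propagates g a (r rho : R) :
  (forall z, cabs (z - a) < r -> derivable g z 1) -> 0 < rho ->
  (forall z, cabs (z - a) < rho -> g z = 0) ->
  forall z, cabs (z - a) < r / 2 -> g z = 0.
Proof.
move=> gd rho0 ga w0 w0r; have [w0a|w0a] := eqVneq w0 a.
  by apply: ga; rewrite w0a subrr cabs0.
pose v := w0 - a; have v0 : 0 < cabs v by rewrite cabs_gt0 subr_eq0.
have [x x0 xP] := cexp_near (divr_gt0 rho0 v0).
pose tau := x / 2; have tau0 : 0 < tau by rewrite /tau; lra.
(* For z = cis t with t in [-pi, pi], the first j with j * tau > 2 pi - t brings the angle j * tau +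
   t within tau of a full turn; 3 pi bounds 2 pi - t, whence this number of rotations. *)
pose N := (Num.truncn (3 * pi / tau)).+2.
pose F (j : nat) z := g (w0 - v * cis (j%:R * tau) * z).
have c1 (t : R) : `|cis t| = 1 by rewrite cabsE cabs_cis.
have hF j : hol (F j).
  apply: hol_disk => z z1.
  have -> : F j = (fun y => g (y + w0)) \o (fun z => (- (v * cis (j%:R * tau))) * z).
    by apply/funext => y; rewrite /F/= mulNr addrC.
  apply: (@derivable_scale _ (fun y => g (y + w0))).
  set u := - _ * z.
  have dg : derivable g (u + w0) 1.
    apply: gd; have -> : u + w0 - a = v + u by rewrite /v; ring.
    apply: le_lt_trans (cabsD _ _) _.
    have : cabs u <= cabs v.
      rewrite /u cabsM cabsN cabsM cabs_cis mulr1 ler_piMr ?cabs_ge0//.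
      by rewrite -norm_le1.
    by rewrite -/v in w0r; lra.
  have /derivableP dg' := dg.
  have : is_derive u 1 (fun y => g (y + w0)) ('D_1 g (u + w0)).
    apply: approx_is_derive => e e0; have := derive_approx dg' e0.
    move=> /nearC[d d0 dP]; apply/nearC; exists d => // w wu.
    have := dP (w + w0); have -> : w + w0 - (u + w0) = w - u by ring.
    exact.
  by case.
pose P z := \prod_(j <- iota 0 N) F j z.
have hP : hol P by exact: hol_prod.
have P0 : P 0 = 0.
  apply: hol_zero_boundary => // z z1.
  have [t tpi zt] := cis_surj z1.
  pose j := (Num.truncn ((2 * pi - t) / tau)).+1.
  have q0 : 0 <= (2 * pi - t) / tau by rewrite divr_ge0 ?(ltW tau0)//; lra.
  have /andP[j1 j2] := truncn_itv q0.
  have jt1 : 2 * pi - t < j%:R * tau by rewrite -ltr_pdivrMr.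
  have jt2 : j%:R * tau <= 2 * pi - t + tau.
    have : (Num.truncn ((2 * pi - t) / tau))%:R * tau <= 2 * pi - t.
      by rewrite -ler_pdivlMr.
    by rewrite /j -natr1; lra.
  have jN : (j < N)%N.
    rewrite ltnS ltnS; apply: le_truncn.
    by rewrite ler_pM2r ?invr_gt0//; lra.
  have Fj : F j z = 0.
    apply: ga; rewrite zt.
    have -> : w0 - v * cis (j%:R * tau) * cis t - a =
        - v * (cexp 0 (j%:R * tau + t - pi *+ 2) - 1).
      have -> : cexp 0 (j%:R * tau + t - pi *+ 2) = cis (j%:R * tau) * cis t.
        rewrite /cexp expR0 mul1r -[LHS]mulr1 -(cis2pi R) -!cisD.
        by congr cis; ring.
      by rewrite /v; ring.
    rewrite cabsM cabsN mulrC -ltr_pdivlMr//.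
    apply: xP; first by rewrite normr0.
    have p2 : pi *+ 2 = 2 * pi :> R by ring.
    by rewrite p2 ger0_norm; rewrite /tau in jt1 jt2 *; lra.
  have jI : j \in iota 0 N by rewrite mem_iota.
  by rewrite /P (big_rem _ jI) -[LHS]/(F j z * _) Fj mul0r.
move: P0; rewrite /P => /eqP; rewrite prodf_seq_eq0 => /hasP[j _ /=].
by rewrite /F mulr0 subr0 => /eqP.
Qed.

(* As [meromorphic_at], in a form closed under products and differences. *)
Definition laurent f a := exists (m : nat) (g : R[i] -> R[i]),
  holomorphic_at g a /\ \forall z \near a, z != a -> f z = g z / (z - a) ^+ m.

Lemma meromorphic_laurent f a : meromorphic_at f a -> laurent f a.
Proof.
move=> [hf|[m [g [_ hg _ fg]]]]; last by exists m, g.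
exists 0%N, f; split=> //; near=> z => _; by rewrite expr0 divr1.
Unshelve. all: by end_near. Qed.

Lemma derivable_subX a z n : derivable (fun w => (w - a) ^+ n) z 1.
Proof.
elim: n => [|n IH].
  rewrite (_ : (fun _ => _) = cst 1); first exact: derivable_cst.
  by apply/funext => w; rewrite expr0.
rewrite (_ : (fun _ => _) = (fun w => w - a) * (fun w => (w - a) ^+ n)).
  have d1 : derivable ((id : R[i] -> R[i]) - cst a) z 1.
    by apply: derivableB; [exact: derivable_id|exact: derivable_cst].
  exact: (derivableM d1 IH).
by apply/funext => w; rewrite exprS.
Qed.

Lemma laurentM f g a : laurent f a -> laurent g a ->
  laurent (fun z => f z * g z) a.
Proof.
move=> [m [F [hF fF]]] [n [G [hG gG]]]; exists (m + n)%N, (fun z => F z * G z).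
split; first by apply: filterS2 hF hG => z Fz Gz; exact: (derivableM Fz Gz).
near=> z => za; have -> : f z = F z / (z - a) ^+ m by apply: (near fF z).
have -> : g z = G z / (z - a) ^+ n by apply: (near gG z).
by rewrite exprD invfM mulrACA.
Unshelve. all: by end_near. Qed.

Lemma laurentB f g a : laurent f a -> laurent g a ->
  laurent (fun z => f z - g z) a.
Proof.
move=> [m [F [hF fF]]] [n [G [hG gG]]].
exists (m + n)%N, (fun z => F z * (z - a) ^+ n - G z * (z - a) ^+ m).
split.
  apply: filterS2 hF hG => z Fz Gz.
  rewrite (_ : (fun _ => _) = F * (fun w => (w - a) ^+ n) - G * (fun w => (w - a) ^+ m)).
    have dn := @derivable_subX a z n; have dm := @derivable_subX a z m.
    by apply: derivableB; [exact: (derivableM Fz dn)|exact: (derivableM Gz dm)].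
  by apply/funext.
near=> z => za; have -> : f z = F z / (z - a) ^+ m by apply: (near fF z).
have -> : g z = G z / (z - a) ^+ n by apply: (near gG z).
have zm k : (z - a) ^+ k != 0 by rewrite expf_neq0// subr_eq0.
by rewrite exprD; field; rewrite !zm.
Unshelve. all: by end_near. Qed.

(** The neighbourhoods are punctured because the value at a pole is arbitrary. *)
Definition punctured0 f p := \forall w \near p, w != p -> f w = 0.

(** The set of points near which f vanishes is open and closed, poles included. *)
Lemma punctured0_dichotomy f p : laurent f p ->
  (\forall q \near p, punctured0 f q) \/ (\forall q \near p, ~ punctured0 f q).
Proof.
move=> [m [g [/nearC[d1 d10 gd] /nearC[d2 d20 fg]]]].
pose d := Num.min d1 d2; have d0 : 0 < d by rewrite lt_min d10.
have [dd1 dd2] : d <= d1 /\ d <= d2 by rewrite !ge_min !lexx orbT.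
have d80 : 0 < d / 8 by lra.
have [[q qp fq]|no] := pselect (exists2 q, cabs (q - p) < d / 8 & punctured0 f q); last first.
  right; apply/nearC; exists (d / 8) => // q qp fq; apply: no; by exists q.
left.
have /nearC[e e0 eP] := fq.
have e'0 : 0 < Num.min e (d / 8) by rewrite lt_min e0.
have [b [bq bp]] := near_pick q p e'0; rewrite lt_min => /andP[be bd].
have g0 z : cabs (z - p) < d / 8 -> g z = 0.
  move=> zp.
  pose s := Num.min (Num.min (cabs (b - q)) (cabs (b - p))) (e - cabs (b - q)).
  have s0 : 0 < s by rewrite !lt_min !cabs_gt0 !subr_eq0 bq bp subr_gt0.
  (* The centre b is close to q but differs from p and q, so that f, and with it the numerator g,
     vanishes around b. The disk of radius 3/4 d about b stays where g is differentiable, and its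
     half contains the disk of radius d / 8 about p. *)
  apply: (@vanishing_propagates g b (3 / 4 * d) s) => //.
  - move=> w wb; apply: gd.
    have -> : w - p = (w - b) + ((b - q) + (q - p)) by ring.
    by have := cabsD (w - b) ((b - q) + (q - p)); have := cabsD (b - q) (q - p); lra.
  - move=> w; rewrite !lt_min => /andP[/andP[w1 w2] w3].
    have wp : w != p by apply: contraTneq w2 => ->; rewrite -cabsN opprB ltxx.
    have wq : w != q by apply: contraTneq w1 => ->; rewrite -cabsN opprB ltxx.
    have wpd : cabs (w - p) < d2.
      have -> : w - p = (w - b) + ((b - q) + (q - p)) by ring.
      have := cabsD (w - b) ((b - q) + (q - p)); have := cabsD (b - q) (q - p).
      by lra.
    have := fg w wpd wp; rewrite (eP w _ wq); last first.
      have -> : w - q = (w - b) + (b - q) by ring.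
      by have := cabsD (w - b) (b - q); lra.
    move/esym/eqP; rewrite mulf_eq0 invr_eq0 expf_eq0 subr_eq0 (negbTE wp) andbF orbF.
    by move/eqP.
  - have -> : z - b = (z - p) + ((p - q) + (q - b)) by ring.
    have := cabsD (z - p) ((p - q) + (q - b)); have := cabsD (p - q) (q - b).
    rewrite -(cabsN (p - q)) -(cabsN (q - b)) !opprB; lra.
have f0 z : cabs (z - p) < d / 8 -> z != p -> f z = 0.
  by move=> zp zp'; rewrite fg ?g0 ?mul0r//; lra.
apply/nearC; exists (d / 8) => // c cp; apply/nearC.
have [->|cp'] := eqVneq c p; first by exists (d / 8).
exists (Num.min (cabs (c - p)) (d / 8 - cabs (c - p))).
  by rewrite lt_min cabs_gt0 !subr_eq0 cp' subr_gt0.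
move=> w; rewrite lt_min => /andP[w1 w2] _; apply: f0.
  have -> : w - p = (w - c) + (c - p) by ring.
  by have := cabsD (w - c) (c - p); lra.
by apply: contraTneq w1 => ->; rewrite -cabsN opprB ltxx.
Qed.

(** Connectedness of [0, 1] by calculus: the indicator of the parameters t such that f vanishes near
    t z is locally constant by the dichotomy, so its derivative is 0. *)
Lemma punctured0_segment f z :
  (forall t : R, 0 <= t <= 1 -> laurent f (t%:C%C * z)) ->
  punctured0 f 0 -> punctured0 f z.
Proof.
move=> fl f0.
have [Zt ZtE] : exists Zt : R -> bool, forall t, punctured0 f (t%:C%C * z) <-> Zt t.
  exists (fun t => `[< punctured0 f (t%:C%C * z) >]) => t.
  exact: (rwP (asboolP _)).
have : (Zt 1)%:R = (Zt 0%R)%:R :> R.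
  apply: (is_derive0_cst (g := fun t => (Zt t)%:R)) => // t ht.
  suff h : \forall s \near t, Zt t = Zt s.
    have h' : \forall s \near t, cst ((Zt t)%:R : R) s = (Zt s)%:R.
      by apply: filterS h => s ->.
    apply: (near_eq_is_derive h'); exact: is_derive_cst.
  have z0 := cabs_ge0 z.
  have aux (P : R[i] -> Prop) : (\forall q \near t%:C%C * z, P q) ->
      \forall s \near t, P (s%:C%C * z).
    move=> /nearC[d d0 dP]; apply/nbhs_ballP; exists (d / (cabs z + 1)) => /=.
      by rewrite divr_gt0//; lra.
    move=> s; rewrite /ball/= => st; apply: dP.
    rewrite -mulrBl -rmorphB/= cabsM cabs_real distrC.
    apply: (@le_lt_trans _ _ (`|t - s| * (cabs z + 1))).
      by apply: ler_wpM2l => //; lra.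
    by rewrite -ltr_pdivlMr//; lra.
  have [h|h] := punctured0_dichotomy (fl t ht).
    have Ztt : Zt t by apply/ZtE; exact: nbhs_singleton h.
    by apply: filterS (aux _ h) => s /ZtE ->.
  have Ztt : Zt t = false by apply/negbTE/negP => /ZtE; exact: nbhs_singleton h.
  by apply: filterS (aux _ h) => s hs; rewrite Ztt; apply/esym/negbTE/negP => /ZtE.
have -> : Zt 0 by apply/ZtE; rewrite mul0r.
have [h _|_ /eqP] := boolP (Zt 1).
  by move/ZtE : h; rewrite mul1r.
by rewrite eq_sym oner_eq0.
Qed.

Lemma dense_zero f z : {for z, continuous f} ->
  (forall d : R, 0 < d -> exists2 w, cabs (w - z) < d & f w = 0) -> f z = 0.
Proof.
move=> fc zs; apply/eqP; apply: contrapT => /negP fz.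
have fz0 : 0 < cabs (f z) by rewrite cabs_gt0.
have /nearC[d d0 dP] : \forall w \near z, cabs (f w - f z) < cabs (f z).
  have /cvgrPdist_lt/(_ (cabs (f z))%:C%C) := fc; rewrite ltcR => /(_ fz0).
  by apply: filterS => w; rewrite distrC cabs_lt ?ltcR.
have [w wz w0] := zs d d0; have := dP w wz.
by rewrite w0 sub0r cabsN ltxx.
Qed.

Lemma punctured0_dense f z : punctured0 f z ->
  forall d : R, 0 < d -> exists2 w, cabs (w - z) < d & f w = 0.
Proof.
move=> /nearC[e e0 eP] d d0.
have m0 : 0 < Num.min e d by rewrite lt_min e0.
have [w [wz _]] := near_pick z z m0; rewrite lt_min => /andP[we wd].
by exists w => //; exact: eP.
Qed.

Lemma inv_continuousC z : z != 0 -> forall d : R, 0 < d ->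
  exists2 e : R, 0 < e & forall w, cabs (w - z) < e -> cabs (w^-1 - z^-1) < d.
Proof.
move=> z0 d d0.
have dV : derivable (fun w : R[i] => w^-1) z 1.
  by apply: (@derivableV _ _ id) => //; exact: derivable_id.
have /cvgrPdist_lt/(_ d%:C%C) := derivable_continuous dV.
rewrite ltcR => /(_ d0) /nearC[e e0 eP]; exists e => // w /eP.
by rewrite distrC cabs_lt ?ltcR.
Qed.

(** The domain of the coordinate z is star-shaped about 0, so the vanishing spreads along segments.
    In the coordinate 1/z a point is approached by some w != 0, and zeros near 1/w are carried back
    by inversion; continuity then gives the value at the point itself. *)
Lemma meromorphic_identity (D : surface) (F : option R[i] -> R[i]) :
  (forall (c : bool) z, chart_dom D c z -> laurent (fun w => F (chart c w)) z) ->
  punctured0 (fun w => F (Some w)) 0 ->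
  forall (c : bool) z, chart_dom D c z -> {for z, continuous (fun w => F (chart c w))} ->
  F (chart c z) = 0.
Proof.
move=> Fl F0.
have Z z : chart_dom D false z -> punctured0 (fun w => F (Some w)) z.
  move=> Dz; apply: punctured0_segment F0 => t ht.
  have := Fl false (t%:C%C * z); apply.
  case: D Dz {Fl} => //=; rewrite !norm_lt1 cabsM cabs_real ger0_norm; last by lra.
  by move=> z1; have := cabs_ge0 z; nra.
move=> [] z Dz Fc; last exact: (@dense_zero (fun w => F (chart false w)) z Fc (punctured0_dense (Z z Dz))).
have {Dz} D0 : D = Sphere by case: D Dz {Fl Z}.
subst D; apply: (@dense_zero (fun w => F (chart true w)) z Fc) => d d0.
have d20 : 0 < d / 2 by lra.
have [w [w0 _ wz]] : exists w, [/\ w != 0, true & cabs (w - z) < d / 2].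
  have [->|z0] := eqVneq z 0; last by exists z; rewrite z0 subrr cabs0.
  by have [w [w0 _ wd]] := near_pick 0 0 d20; exists w.
have [e e0 eP] := inv_continuousC (invr_neq0 w0) d20.
have e'0 : 0 < Num.min e (cabs w^-1) by rewrite lt_min e0 cabs_gt0 invr_eq0.
have [v vw vF] := punctured0_dense (Z w^-1 I) e'0.
move: vw; rewrite lt_min => /andP[ve vw].
have v0 : v != 0 by apply: contraTneq vw => ->; rewrite sub0r cabsN ltxx.
exists v^-1; last by rewrite /chart invr_eq0 (negbTE v0) invrK.
have -> : v^-1 - z = (v^-1 - w) + (w - z) by ring.
apply: le_lt_trans (cabsD _ _) _.
by have := eP v ve; rewrite invrK; lra.
Qed.

End identity.

(** * Wirtinger calculus for matrices *)

Section wirtinger.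
Variable R : realType.
Notation V := (R * R)%type.

Definition is_der (w : V) (h : V -> R[i]) (x : V) (d : R[i]) :=
  is_derive x w (fun y => complex.Re (h y)) (complex.Re d) /\
  is_derive x w (fun y => complex.Im (h y)) (complex.Im d).

Lemma is_der_cst w (c : R[i]) x : is_der w (fun=> c) x 0.
Proof. by split; exact: is_derive_cst. Qed.

Lemma is_derD w h k x d e : is_der w h x d -> is_der w k x e ->
  is_der w (fun y => h y + k y) x (d + e).
Proof.
move=> [h1 h2] [k1 k2]; split.
  rewrite (_ : (fun _ => _) = (fun y => complex.Re (h y)) + (fun y => complex.Re (k y))).
    by rewrite raddfD; exact: is_deriveD.
  by apply/funext => y; rewrite raddfD.
rewrite (_ : (fun _ => _) = (fun y => complex.Im (h y)) + (fun y => complex.Im (k y))).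
  by rewrite raddfD; exact: is_deriveD.
by apply/funext => y; rewrite raddfD.
Qed.

Lemma ReD (z w : R[i]) : complex.Re (z + w) = complex.Re z + complex.Re w.
Proof. by case: z; case: w. Qed.

Lemma ImD (z w : R[i]) : complex.Im (z + w) = complex.Im z + complex.Im w.
Proof. by case: z; case: w. Qed.

Lemma ReM (z w : R[i]) : complex.Re (z * w) =
  complex.Re z * complex.Re w - complex.Im z * complex.Im w.
Proof. by case: z; case: w. Qed.

Lemma ImM (z w : R[i]) : complex.Im (z * w) =
  complex.Re z * complex.Im w + complex.Im z * complex.Re w.
Proof. by case: z; case: w. Qed.

Lemma is_derM w h k x d e : is_der w h x d -> is_der w k x e ->
  is_der w (fun y => h y * k y) x (d * k x + h x * e).
Proof.
move=> [h1 h2] [k1 k2]; split.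
  rewrite (_ : (fun _ => _) = (fun y => complex.Re (h y)) * (fun y => complex.Re (k y))
    - (fun y => complex.Im (h y)) * (fun y => complex.Im (k y))); last first.
    by apply/funext => y; rewrite ReM.
  apply: (is_derive_eq (is_deriveB (is_deriveM h1 k1) (is_deriveM h2 k2))).
  by rewrite ReD !ReM /GRing.scale/=; ring.
rewrite (_ : (fun _ => _) = (fun y => complex.Re (h y)) * (fun y => complex.Im (k y))
    + (fun y => complex.Im (h y)) * (fun y => complex.Re (k y))); last first.
  by apply/funext => y; rewrite ImM.
apply: (is_derive_eq (is_deriveD (is_deriveM h1 k2) (is_deriveM h2 k1))).
by rewrite ImD !ImM /GRing.scale/=; ring.
Qed.

Lemma is_der_conj w h x d : is_der w h x d -> is_der w (fun y => (h y)^*%C) x d^*%C.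
Proof.
move=> [h1 h2]; split.
  rewrite (_ : (fun _ => _) = (fun y => complex.Re (h y))); first by case: d h1 h2.
  by apply/funext => y; case: (h y).
rewrite (_ : (fun _ => _) = - (fun y => complex.Im (h y))).
  by case: d h1 h2 => d1 d2 /= h1 h2; exact: is_deriveN.
by apply/funext => y; rewrite -[RHS]/(- complex.Im (h y)); case: (h y).
Qed.

Lemma is_der_sum w (I : Type) (r : seq I) (h : I -> V -> R[i]) x (d : I -> R[i]) :
  (forall i, is_der w (h i) x (d i)) ->
  is_der w (fun y => \sum_(i <- r) h i y) x (\sum_(i <- r) d i).
Proof.
move=> hd; elim: r => [|i r IH].
  rewrite big_nil (_ : (fun _ => _) = (fun=> 0)); first exact: is_der_cst.
  by apply/funext => y; rewrite big_nil.
rewrite big_cons (_ : (fun _ => _) = (fun y => h i y + \sum_(i <- r) h i y)).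
  exact: is_derD (hd i) IH.
by apply/funext => y; rewrite big_cons.
Qed.

(* a and b are the derivatives of f with respect to z and to its conjugate. *)
Definition is_W m p (f : V -> 'M[R[i]]_(m, p)) x (a b : 'M[R[i]]_(m, p)) :=
  forall i j, is_der (dir_u R) (fun y => f y i j) x (a i j + b i j) /\
              is_der (dir_v R) (fun y => f y i j) x ('i * (a i j - b i j)).

Lemma pd_cmxE m p w (f : V -> 'M[R[i]]_(m, p)) x (d : 'M[R[i]]_(m, p)) :
  (forall i j, is_der w (fun y => f y i j) x (d i j)) -> pd_cmx w f x = d.
Proof.
move=> fd; apply/matrixP => i j; have [h1 h2] := fd i j; rewrite mxE.
by rewrite (derive_val (is_derive := h1)) (derive_val (is_derive := h2)); case: (d i j).
Qed.

Lemma is_W_pd m p (f : V -> 'M[R[i]]_(m, p)) x a b : is_W f x a b ->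
  pd_cmx (dir_u R) f x = a + b /\ pd_cmx (dir_v R) f x = 'i *: (a - b).
Proof.
move=> fW; split; apply: pd_cmxE => i j; have [h1 h2] := fW i j; first by rewrite mxE.
by rewrite !mxE.
Qed.

Lemma ii1 : ('i : R[i]) * 'i = -1.
Proof. by rewrite -expr2 sqrCi. Qed.

Lemma d_zE m p (f : V -> 'M[R[i]]_(m, p)) x a b : is_W f x a b -> d_z f x = a.
Proof.
move=> /is_W_pd[uE vE]; rewrite /d_z uE vE scalerA ii1 scaleN1r opprK.
by apply/matrixP => i j; rewrite !mxE; field.
Qed.

Lemma d_zbarE m p (f : V -> 'M[R[i]]_(m, p)) x a b : is_W f x a b -> d_zbar f x = b.
Proof.
move=> /is_W_pd[uE vE]; rewrite /d_zbar uE vE scalerA ii1 scaleN1r opprB.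
by apply/matrixP => i j; rewrite !mxE; field.
Qed.

Lemma is_Wd m p (f : V -> 'M[R[i]]_(m, p)) x :
  (forall i j, [/\ derivable (fun y => complex.Re (f y i j)) x (dir_u R),
     derivable (fun y => complex.Im (f y i j)) x (dir_u R),
     derivable (fun y => complex.Re (f y i j)) x (dir_v R) &
     derivable (fun y => complex.Im (f y i j)) x (dir_v R)]) ->
  is_W f x (d_z f x) (d_zbar f x).
Proof.
move=> fd i j; have [f1 f2 f3 f4] := fd i j.
have i2 : (2 : R[i]) != 0 by rewrite pnatr_eq0.
have -> : d_z f x i j + d_zbar f x i j = pd_cmx (dir_u R) f x i j.
  rewrite /d_z /d_zbar; move: (pd_cmx (dir_u R) f x) (pd_cmx (dir_v R) f x) => A B.
  by rewrite !mxE; field.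
have -> : 'i * (d_z f x i j - d_zbar f x i j) = pd_cmx (dir_v R) f x i j.
  rewrite /d_z /d_zbar; move: (pd_cmx (dir_u R) f x) (pd_cmx (dir_v R) f x) => A B.
  rewrite !mxE; move: (A i j) (B i j) => a b.
  have -> : 'i * (2^-1 * (a - 'i * b) - 2^-1 * (a + 'i * b)) = - (('i * 'i) * b) by field.
  by rewrite ii1; ring.
by rewrite !mxE; split; split; exact/derivableP.
Qed.

Lemma smooth_derivable (W : normedModType R) (U : set W) (f : W -> R) x w :
  smooth U f -> U x -> derivable f x w.
Proof. by move=> /(_ 1%N)[_ /(_ w)[h _]]; exact: h. Qed.

Lemma smooth_is_W m p (f : V -> 'M[R[i]]_(m, p)) U x : smooth_cmx U f -> U x ->
  is_W f x (d_z f x) (d_zbar f x).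
Proof.
move=> fs Ux; apply: is_Wd => i j; have [h1 h2] := fs i j.
by split; apply: smooth_derivable Ux.
Qed.

Lemma complexify_is_W m p (f : V -> 'M[R]_(m, p)) x :
  (forall i j, derivable (fun y => f y i j) x (dir_u R) /\
     derivable (fun y => f y i j) x (dir_v R)) ->
  is_W (complexify f) x (d_z (complexify f) x) (d_zbar (complexify f) x).
Proof.
move=> fs; apply: is_Wd => i j; have [h1 h2] := fs i j.
rewrite (_ : (fun y => complex.Re _) = fun y => f y i j); last first.
  by apply/funext => y; rewrite !mxE.
rewrite (_ : (fun y => complex.Im _) = cst 0); last first.
  by apply/funext => y; rewrite !mxE.
by split; [exact: h1|exact: derivable_cst|exact: h2|exact: derivable_cst].
Qed.

Lemma is_W_cst m p (c : 'M[R[i]]_(m, p)) x : is_W (fun=> c) x 0 0.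
Proof.
by move=> i j; rewrite !mxE addr0 subr0 mulr0; split; exact: is_der_cst.
Qed.

Lemma is_WD m p (f g : V -> 'M[R[i]]_(m, p)) x a b c d :
  is_W f x a b -> is_W g x c d -> is_W (fun y => f y + g y) x (a + c) (b + d).
Proof.
move=> fW gW i j; have [f1 f2] := fW i j; have [g1 g2] := gW i j.
rewrite (_ : (fun y => _) = (fun y => f y i j + g y i j)); last first.
  by apply/funext => y; rewrite mxE.
rewrite !mxE; split.
  by rewrite addrACA; exact: is_derD.
have -> : 'i * (a i j + c i j - (b i j + d i j)) =
  'i * (a i j - b i j) + 'i * (c i j - d i j) by ring.
exact: is_derD.
Qed.

Lemma is_WM m p q (f : V -> 'M[R[i]]_(m, p)) (g : V -> 'M[R[i]]_(p, q)) x a b c d :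
  is_W f x a b -> is_W g x c d ->
  is_W (fun y => f y *m g y) x (a *m g x + f x *m c) (b *m g x + f x *m d).
Proof.
move=> fW gW i j.
rewrite (_ : (fun y => _) = (fun y => \sum_k f y i k * g y k j)); last first.
  by apply/funext => y; rewrite mxE.
rewrite !mxE -!big_split/=; split.
  apply: is_der_sum => k.
  have -> : a i k * g x k j + f x i k * c k j + (b i k * g x k j + f x i k * d k j)
    = (a i k + b i k) * g x k j + f x i k * (c k j + d k j) by ring.
  by have [f1 _] := fW i k; have [g1 _] := gW k j; exact: is_derM.
rewrite -sumrB mulr_sumr; apply: is_der_sum => k.
have -> : 'i * (a i k * g x k j + f x i k * c k j - (b i k * g x k j + f x i k * d k j))
    = ('i * (a i k - b i k)) * g x k j + f x i k * ('i * (c k j - d k j)) by ring.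
by have [_ f1] := fW i k; have [_ g1] := gW k j; exact: is_derM.
Qed.

Lemma is_WMl m p q (c : 'M[R[i]]_(m, p)) (g : V -> 'M[R[i]]_(p, q)) x a b :
  is_W g x a b -> is_W (fun y => c *m g y) x (c *m a) (c *m b).
Proof.
by move=> /(is_WM (is_W_cst c x)); rewrite !mul0mx !add0r.
Qed.

Lemma is_WMr m p q (c : 'M[R[i]]_(p, q)) (g : V -> 'M[R[i]]_(m, p)) x a b :
  is_W g x a b -> is_W (fun y => g y *m c) x (a *m c) (b *m c).
Proof.
by move=> gW; have := is_WM gW (is_W_cst c x); rewrite !mulmx0 !addr0.
Qed.

Lemma is_WZ m p (c : R[i]) (g : V -> 'M[R[i]]_(m, p)) x a b :
  is_W g x a b -> is_W (fun y => c *: g y) x (c *: a) (c *: b).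
Proof.
move=> /(is_WMl c%:M); rewrite !mul_scalar_mx; congr is_W.
by apply/funext => y; rewrite mul_scalar_mx.
Qed.

Lemma is_WB m p (f g : V -> 'M[R[i]]_(m, p)) x a b c d :
  is_W f x a b -> is_W g x c d -> is_W (fun y => f y - g y) x (a - c) (b - d).
Proof.
move=> fW /(is_WZ (-1)) gW; have := is_WD fW gW; rewrite !scaleN1r; congr is_W.
by apply/funext => y; rewrite scaleN1r.
Qed.

Lemma is_WT m p (g : V -> 'M[R[i]]_(m, p)) x a b :
  is_W g x a b -> is_W (fun y => (g y)^T) x a^T b^T.
Proof.
move=> gW i j; rewrite !mxE (_ : (fun y => _) = (fun y => g y j i)); first exact: gW.
by apply/funext => y; rewrite mxE.
Qed.

Lemma conjCi' : ('i : R[i])^*%C = - 'i.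
Proof. by rewrite -complexiE; congr (_ +i* _); rewrite oppr0. Qed.

Lemma conjCM (z w : R[i]) : (z * w)^*%C = z^*%C * w^*%C.
Proof. exact: rmorphM. Qed.

Lemma conjCB (z w : R[i]) : (z - w)^*%C = z^*%C - w^*%C.
Proof. exact: rmorphB. Qed.

Lemma is_W_conj m p (g : V -> 'M[R[i]]_(m, p)) x a b : is_W g x a b ->
  is_W (fun y => map_mx conjc (g y)) x (map_mx conjc b) (map_mx conjc a).
Proof.
move=> gW i j; have [g1 g2] := gW i j; rewrite !mxE.
rewrite (_ : (fun y => _) = (fun y => (g y i j)^*%C)); last first.
  by apply/funext => y; rewrite mxE.
split.
  by rewrite addrC -rmorphD/=; exact: is_der_conj.
have -> : 'i * ((b i j)^*%C - (a i j)^*%C) = ('i * (a i j - b i j))^*%C.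
  by rewrite conjCM conjCB conjCi'; ring.
exact: is_der_conj.
Qed.

Lemma is_W_near m p (f g : V -> 'M[R[i]]_(m, p)) x a b :
  (\forall y \near x, f y = g y) -> is_W f x a b -> is_W g x a b.
Proof.
move=> fg fW i j; have [[f1 f2] [f3 f4]] := fW i j.
have hR : \forall y \near x, complex.Re (f y i j) = complex.Re (g y i j).
  by apply: filterS fg => y ->.
have hI : \forall y \near x, complex.Im (f y i j) = complex.Im (g y i j).
  by apply: filterS fg => y ->.
split; split.
- exact: (near_eq_is_derive hR f1).
- exact: (near_eq_is_derive hI f2).
- exact: (near_eq_is_derive hR f3).
- exact: (near_eq_is_derive hI f4).
Qed.

Lemma is_W_uniq m p (f : V -> 'M[R[i]]_(m, p)) x a b c d :
  is_W f x a b -> is_W f x c d -> a = c /\ b = d.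
Proof. by move=> h1 h2; rewrite -(d_zE h1) -(d_zE h2) -(d_zbarE h1) -(d_zbarE h2). Qed.

Lemma slice_u (h : V -> R) (s t l : R) :
  is_derive (s, t) (dir_u R) h l -> is_derive s 1 (fun y => h (y, t)) l.
Proof.
have E : (fun k : R => k^-1 *: ((h \o shift (s, t)) (k *: dir_u R) - h (s, t))) =
  (fun k : R => k^-1 *: (((fun y => h (y, t)) \o shift s) (k *: (1 : R)) - h (s, t))).
  apply/funext => k /=; congr (_ *: (h _ - _)).
  rewrite -[LHS]/(k * _ + _, k * _ + _)/=; congr pair; rewrite ?mulr0 ?add0r//.
move=> [hd <-]; apply: DeriveDef; first by move: hd; rewrite /derivable E.
by rewrite /derive E.
Qed.

Lemma slice_v (h : V -> R) (s t l : R) :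
  is_derive (s, t) (dir_v R) h l -> is_derive t 1 (fun y => h (s, y)) l.
Proof.
have E : (fun k : R => k^-1 *: ((h \o shift (s, t)) (k *: dir_v R) - h (s, t))) =
  (fun k : R => k^-1 *: (((fun y => h (s, y)) \o shift t) (k *: (1 : R)) - h (s, t))).
  apply/funext => k /=; congr (_ *: (h _ - _)).
  rewrite -[LHS]/(k * _ + _, k * _ + _)/=; congr pair; rewrite ?mulr0 ?add0r//.
move=> [hd <-]; apply: DeriveDef; first by move: hd; rewrite /derivable E.
by rewrite /derive E.
Qed.

Lemma ball_plane (x y : V) (r : R) : ball x r y <-> `|y.1 - x.1| < r /\ `|y.2 - x.2| < r.
Proof. by rewrite (distrC y.1) (distrC y.2). Qed.

Lemma const_on_segment (g : R -> R) (a b : R) :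
  (forall x, Num.min a b <= x <= Num.max a b -> is_derive x 1 g 0) -> g a = g b.
Proof.
move=> dg; have [ab|/ltW ba] := leP a b.
  by apply/esym/is_derive0_cst => // x hx; apply: dg; rewrite min_l// max_r.
by apply/is_derive0_cst => // x hx; apply: dg; rewrite min_r// max_l.
Qed.

(** Balls of R * R are squares, so the path from x0 to x parallel to the axes stays inside. *)
Lemma const_on_ball (h : V -> R) (x0 : V) (r : R) :
  (forall x, ball x0 r x -> is_derive x (dir_u R) h 0 /\ is_derive x (dir_v R) h 0) ->
  forall x, ball x0 r x -> h x = h x0.
Proof.
move=> hd [x y] /ball_plane[/= hx hy]; case: x0 hd hx hy => a b hd /= hx hy.
have -> : h (x, y) = h (a, y).
  apply: (const_on_segment (g := fun s => h (s, y))) => s hs.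
  apply: slice_u; apply: (hd (s, y) _).1; apply/ball_plane; split => //=.
  move: hs hx; rewrite !ltr_norml; have [xa|xa] := leP x a; lra.
apply: (const_on_segment (g := fun s => h (a, s))) => s hs.
apply: slice_v; apply: (hd (a, s) _).2; apply/ball_plane; split => //=.
  by rewrite subrr normr0; exact: le_lt_trans hx.
by move: hs hy; rewrite !ltr_norml; have [xa|xa] := leP y b; lra.
Qed.

Lemma is_W0_const m p (f : V -> 'M[R[i]]_(m, p)) (x0 : V) (r : R) :
  (forall x, ball x0 r x -> is_W f x 0 0) -> forall x, ball x0 r x -> f x = f x0.
Proof.
move=> fW x xr; apply/matrixP => i j.
have fd y : ball x0 r y -> is_der (dir_u R) (fun y => f y i j) y 0 /\
    is_der (dir_v R) (fun y => f y i j) y 0.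
  by move=> /fW /(_ i j); rewrite !mxE addr0 subr0 mulr0.
have hR : complex.Re (f x i j) = complex.Re (f x0 i j).
  by apply: (const_on_ball (h := fun y => complex.Re (f y i j))) xr => y /fd[[? _] [? _]].
have hI : complex.Im (f x i j) = complex.Im (f x0 i j).
  by apply: (const_on_ball (h := fun y => complex.Im (f y i j))) xr => y /fd[[_ ?] [_ ?]].
by move: hR hI; case: (f x i j) => ? ?; case: (f x0 i j) => ? ? /= -> ->.
Qed.

End wirtinger.

(** * The group SO(1, m-1) *)

Section SO1.
Variables (T : comNzRingType) (m : nat).
Implicit Types A B : 'M[T]_m.
Notation J := (lor T m).

Lemma lorT : J^T = J.
Proof. by rewrite /lor tr_diag_mx. Qed.

Lemma lorK : J *m J = 1%:M.
Proof.
rewrite /lor mulmx_diag; apply/matrixP => i j; rewrite !mxE.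
by case: ifP => _; rewrite ?mulrNN ?mulr1.
Qed.

(** The inverse on SO(1, m-1), linear in the entries of [A] and defined for every matrix:
    derivatives and holomorphic dependence on a parameter pass through it directly. *)
Definition lorinv A : 'M[T]_m := J *m A^T *m J.

Lemma SO1_mulV A : SO1 T m A -> lorinv A *m A = 1%:M.
Proof. by move=> [AJA _]; rewrite /lorinv -!mulmxA (mulmxA A^T) AJA lorK. Qed.

Lemma SO1_mulVr A : SO1 T m A -> A *m lorinv A = 1%:M.
Proof. by move=> /SO1_mulV /mulmx1C. Qed.

Lemma lorinvM A B : lorinv (A *m B) = lorinv B *m lorinv A.
Proof. by rewrite /lorinv trmx_mul !mulmxA -[_ *m J *m J]mulmxA lorK mulmx1. Qed.

Lemma SO1_AJAT A : SO1 T m A -> A *m J *m A^T = J.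
Proof.
move=> /SO1_mulVr; rewrite /lorinv !mulmxA => /(congr1 (mulmx^~ J)).
by rewrite -!mulmxA lorK mulmx1 mul1mx.
Qed.

Lemma SO1_1 : SO1 T m 1%:M.
Proof. by split; rewrite ?det1// trmx1 mul1mx mulmx1. Qed.

Lemma SO1M A B : SO1 T m A -> SO1 T m B -> SO1 T m (A *m B).
Proof.
move=> [A1 A2] [B1 B2]; split; last by rewrite det_mulmx A2 B2 mulr1.
by rewrite trmx_mul -!mulmxA (mulmxA J) (mulmxA A^T) (mulmxA A^T) A1 mulmxA.
Qed.

End SO1.

Lemma SO1_unit (F : fieldType) m (A : 'M[F]_m) : SO1 F m A ->
  A \in unitmx /\ invmx A = lorinv A.
Proof.
move=> hA; have [Au _] := mulmx1_unit (SO1_mulVr hA); split => //.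
by rewrite -[RHS]mulmx1 -(mulmxV Au) mulmxA SO1_mulV// mul1mx.
Qed.

Lemma SO1_map (R : realType) m (A : 'M[R]_m) : SO1 R m A ->
  SO1 R[i] m (map_mx (fun a : R => a%:C) A).
Proof.
move=> [A1 A2]; split; last by rewrite det_map_mx A2.
have lorE : lor R[i] m = map_mx (real_complex R) (lor R m).
  apply/matrixP => i j; rewrite !mxE rmorphMn/=; congr (_ *+ _).
  by case: ifP => _; rewrite ?rmorphN rmorph1.
have -> : (map_mx (real_complex R) A)^T = map_mx (real_complex R) A^T.
  by apply/matrixP => i j; rewrite !mxE.
by rewrite lorE -!map_mxM A1.
Qed.

(** * Lorentzian frames *)

Section frames.
Variable R : realType.
Notation V := (R * R)%type.

Lemma SO1_cancel (m : nat) (A M : 'M[R[i]]_m) : SO1 R[i] m A ->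
  A *m M *m A^T = 0 -> M = 0.
Proof.
move=> hA; have [Au _] := SO1_unit hA; have Atu : A^T \in unitmx by rewrite unitmx_tr.
move=> /(congr1 (fun X => invmx A *m X *m invmx A^T)).
by rewrite mulmx0 mul0mx !mulmxA mulVmx// mul1mx mulmxK.
Qed.

(** Differentiating G J G^T = J shows that the coefficients of G^-1 dG lie in the complexified Lie
    algebra so(1, m-1). *)
Lemma SO1_mc_skew (m : nat) (G : V -> 'M[R[i]]_m) x a b :
  (\forall y \near x, SO1 R[i] m (G y)) -> is_W G x (G x *m a) (G x *m b) ->
  a *m lor R[i] m + lor R[i] m *m a^T = 0 /\
  b *m lor R[i] m + lor R[i] m *m b^T = 0.
Proof.
move=> hG GW; have Gx := nbhs_singleton hG.
have h1 : is_W (fun y => G y *m lor R[i] m *m (G y)^T) x 0 0.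
  apply: is_W_near (is_W_cst (lor R[i] m) x).
  by apply: filterS hG => y /SO1_AJAT.
have h2 := is_WM (is_WMr (lor R[i] m) GW) (is_WT GW).
have [e1 e2] := is_W_uniq h2 h1.
split; apply: (SO1_cancel Gx).
  by rewrite -[RHS]e1 trmx_mul mulmxDr mulmxDl !mulmxA.
by rewrite -[RHS]e2 trmx_mul mulmxDr mulmxDl !mulmxA.
Qed.

(** Uniqueness for G^-1 dG = a dz + b dzbar: the matrix G J H^T, which is G H^-1 up to the factor J,
    has derivative zero because a and b are skew. *)
Lemma frames_eq (m : nat) (G H a b : V -> 'M[R[i]]_m) (x0 : V) (r : R) :
  (forall x, ball x0 r x -> [/\ SO1 R[i] m (G x), SO1 R[i] m (H x),
     is_W G x (G x *m a x) (G x *m b x) & is_W H x (H x *m a x) (H x *m b x)]) ->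
  G x0 = H x0 -> forall x, ball x0 r x -> G x = H x.
Proof.
move=> GH GH0 x xr; set J := lor R[i] m.
have r0 : 0 < r by have /ball_plane[h _] := xr; exact: le_lt_trans h.
have x0r : ball x0 r x0 by exact: ballxx.
have K y : ball x0 r y -> is_W (fun y => G y *m J *m (H y)^T) y 0 0.
  move=> yr; have [_ _ GW HW] := GH y yr.
  have Hn : \forall z \near y, SO1 R[i] m (H z).
    have : open (ball x0 r) by exact: ball_open.
    by rewrite openE => /(_ y yr); apply: filterS => z /GH[].
  have [s1 s2] := SO1_mc_skew Hn HW.
  have bil (c : 'M[R[i]]_m) : c *m J + J *m c^T = 0 ->
      G y *m c *m J *m (H y)^T + G y *m J *m (H y *m c)^T = 0.
    move=> c0; rewrite trmx_mul -!mulmxA -mulmxDr !mulmxA -mulmxDl c0.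
    by rewrite mul0mx mulmx0.
  by have := is_WM (is_WMr J GW) (is_WT HW); rewrite !bil.
have E := is_W0_const K xr.
have [_ Hx _ _] := GH x xr; have [_ Hx0 _ _] := GH x0 x0r.
have : G x *m J *m (H x)^T = H x *m J *m (H x)^T.
  by rewrite E GH0 !SO1_AJAT.
have [Hu _] := SO1_unit Hx; have Hut : (H x)^T \in unitmx by rewrite unitmx_tr.
move=> /(congr1 (mulmx^~ (invmx (H x)^T))); rewrite !mulmxK//.
move=> /(congr1 (mulmx^~ J)); by rewrite -!mulmxA lorK !mulmx1.
Qed.

Lemma conj_complexify m p (f : V -> 'M[R]_(m, p)) x :
  map_mx conjc (complexify f x) = complexify f x.
Proof. by apply/matrixP => i j; rewrite !mxE/= oppr0. Qed.

Lemma lor_conj m : map_mx conjc (lor R[i] m) = lor R[i] m.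
Proof.
apply/matrixP => i j; rewrite !mxE [LHS]rmorphMn; congr (_ *+ _).
by case: ifP => _; rewrite ?[LHS]rmorphN ?rmorph1.
Qed.

Lemma conj_mulmx m p q (A : 'M[R[i]]_(m, p)) (B : 'M[R[i]]_(p, q)) :
  map_mx conjc (A *m B) = map_mx conjc A *m map_mx conjc B.
Proof. exact: map_mxM. Qed.

Lemma conj_addmx m p (A B : 'M[R[i]]_(m, p)) :
  map_mx conjc (A + B) = map_mx conjc A + map_mx conjc B.
Proof. exact: map_mxD. Qed.

Lemma conj_scalemx m p (c : R[i]) (A : 'M[R[i]]_(m, p)) :
  map_mx conjc (c *: A) = c^*%C *: map_mx conjc A.
Proof. exact: map_mxZ. Qed.

Lemma conj_lorinv m (A : 'M[R[i]]_m) : map_mx conjc (lorinv A) = lorinv (map_mx conjc A).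
Proof.
rewrite /lorinv !conj_mulmx lor_conj; congr (_ *m _ *m _).
by apply/matrixP => i j; rewrite !mxE.
Qed.

Lemma is_W_conj_frame m (G : V -> 'M[R[i]]_m) x a b :
  is_W G x (G x *m a) (G x *m b) -> is_W (fun y => map_mx conjc (G y)) x
    (map_mx conjc (G x) *m map_mx conjc b) (map_mx conjc (G x) *m map_mx conjc a).
Proof. by move=> /is_W_conj; rewrite !conj_mulmx. Qed.

Lemma is_W_frame m (G : V -> 'M[R[i]]_m) x a b : G x \in unitmx ->
  is_W G x (d_z G x) (d_zbar G x) -> mc_z G x = a -> mc_zbar G x = b ->
  is_W G x (G x *m a) (G x *m b).
Proof.
move=> Gu GW <- <-.
have -> : G x *m mc_z G x = d_z G x by exact: mulKVmx.
by have -> : G x *m mc_zbar G x = d_zbar G x by exact: mulKVmx.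
Qed.

Variable n : nat.
Implicit Types A B : 'M[R[i]]_(4 + n).

Lemma sigma_mxK : sigma_mx R n *m sigma_mx R n = 1%:M.
Proof.
rewrite /sigma_mx mulmx_block !mulmx0 !mul0mx !addr0 add0r mulmxN mulNmx opprK !mulmx1.
by rewrite -scalar_mx_block.
Qed.

Lemma sigma_block (a : 'M[R[i]]_4) (b : 'M[R[i]]_(4, n)) c (d : 'M[R[i]]_n) :
  sigma (block_mx a b c d) = block_mx a (- b) (- c) d.
Proof.
have [u _] := mulmx1_unit sigma_mxK.
have -> : @sigma R n = fun A => sigma_mx R n *m A *m sigma_mx R n.
  apply/funext => A; rewrite /sigma; congr (_ *m _).
  by rewrite -[LHS]mulmx1 -sigma_mxK mulmxA mulVmx// mul1mx.
rewrite /sigma_mx !mulmx_block !mulmx0 !mul0mx !addr0 !add0r.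
by rewrite !mulmxN !mulNmx !mulmx1 !mul1mx !opprK.
Qed.

Let half2 m p (A : 'M[R[i]]_(m, p)) : 2^-1 *: (A + A) = A.
Proof. by apply/matrixP => i j; rewrite !mxE; field. Qed.

Lemma kpart_block (a : 'M[R[i]]_4) (b : 'M[R[i]]_(4, n)) c (d : 'M[R[i]]_n) :
  kpart (block_mx a b c d) = block_mx a 0 0 d.
Proof.
rewrite /kpart sigma_block add_block_mx !subrr scale_block_mx !scaler0.
by rewrite !half2.
Qed.

Lemma ppart_block (a : 'M[R[i]]_4) (b : 'M[R[i]]_(4, n)) c (d : 'M[R[i]]_n) :
  ppart (block_mx a b c d) = block_mx 0 b c 0.
Proof.
rewrite /ppart sigma_block opp_block_mx add_block_mx !subrr !opprK scale_block_mx.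
by rewrite !scaler0 !half2.
Qed.

Lemma kpart_conj A : map_mx conjc (kpart A) = kpart (map_mx conjc A).
Proof.
rewrite -[A]submxK map_block_mx !kpart_block map_block_mx.
by rewrite !map_mx0.
Qed.

Lemma ppart_conj A : map_mx conjc (ppart A) = ppart (map_mx conjc A).
Proof.
rewrite -[A]submxK map_block_mx !ppart_block map_block_mx.
by rewrite !map_mx0.
Qed.

Lemma circle_conj (l : R[i]) : `|l| = 1 -> l^*%C = l^-1.
Proof. by move=> l1; rewrite invc_norm l1 expr1n invr1 mul1r. Qed.

Section lift.
Variables (F : V -> 'M[R]_(4 + n)) (x : V).
Hypothesis Fd : forall i j, derivable (fun y => F y i j) x (dir_u R) /\
     derivable (fun y => F y i j) x (dir_v R).
Hypothesis FS : SO1 R (4 + n) (F x).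

Lemma complexify_SO1 : SO1 R[i] (4 + n) (complexify F x).
Proof. exact: SO1_map. Qed.

Lemma complexify_mc : is_W (complexify F) x
  (complexify F x *m mc_z (complexify F) x) (complexify F x *m mc_zbar (complexify F) x).
Proof.
have [Fu _] := SO1_unit complexify_SO1.
exact: (is_W_frame Fu (complexify_is_W Fd) erefl erefl).
Qed.

Lemma conj_mc : map_mx conjc (mc_zbar (complexify F) x) = mc_z (complexify F) x.
Proof.
have h := complexify_is_W Fd.
have h' := is_W_conj h.
have [_ zbarE] : d_z (complexify F) x = map_mx conjc (d_zbar (complexify F) x) /\
    d_zbar (complexify F) x = map_mx conjc (d_z (complexify F) x).
  apply: is_W_uniq h _; move: h'; congr is_W.
  by apply/funext => y; rewrite conj_complexify.
have [_ iE] := SO1_unit complexify_SO1.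
rewrite /mc_z /mc_zbar iE zbarE conj_mulmx conj_lorinv conj_complexify; congr (_ *m _).
by apply/matrixP => i j; rewrite !mxE conjcK.
Qed.

(** For |l| = 1 conjugation inverts l, and since F is real it exchanges the dz- and
    dzbar-coefficients of F^-1 dF: the form alpha_l is real. *)
Lemma conj_alpha (l : R[i]) : `|l| = 1 ->
  map_mx conjc (alpha_zbar F l x) = alpha_z F l x /\
  map_mx conjc (alpha_z F l x) = alpha_zbar F l x.
Proof.
move=> l1.
have h : map_mx conjc (alpha_zbar F l x) = alpha_z F l x.
  rewrite /alpha_zbar /alpha_z; set b := mc_zbar _ x.
  rewrite conj_addmx.
  rewrite [X in _ + X]conj_scalemx (circle_conj l1) addrC.
  by rewrite (kpart_conj b) (ppart_conj b) conj_mc.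
split=> //; rewrite -h; apply/matrixP => i j; rewrite [LHS]mxE [X in X^*%C]mxE.
by rewrite conjcK.
Qed.

End lift.
End frames.

(** * The Birkhoff decomposition for a null potential *)

Section special.
Variables (R : realType) (n : nat).
Notation V := (R * R)%type.

(* The isotropic plane spanned by (1, -1, 0, 0) and (0, 0, 1, i). *)
Definition nullW : 'M[R[i]]_(4, 2) := \matrix_(i, k)
  nth 0 (if k == 0%N :> nat then [:: 1; -1; 0; 0] else [:: 0; 0; 1; 'i]) i.

Definition coefX (f1 f3 : 'I_n -> option R[i] -> R[i]) (p : option R[i]) :
    'M[R[i]]_(2, n) :=
  \matrix_(k, j) if k == 0%N :> nat then f1 j p else f3 j p.

Lemma special_BE f1 f3 p : special_B f1 f3 p = nullW *m coefX f1 f3 p.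
Proof.
apply/matrixP => i j; rewrite !mxE !big_ord_recl big_ord0 !mxE/= addr0.
by case: i => [[|[|[|[|//]]]] ?] /=; ring.
Qed.

Lemma nullW_isotropic : nullW^T *m lor R[i] 4 *m nullW = 0.
Proof.
apply/matrixP => i j; rewrite /lor mul_mx_diag !mxE !big_ord_recl big_ord0 !mxE/=.
have ii := @ii1 R.
by case: i => [[|[|//]] ?]; case: j => [[|[|//]] ?] /=;
  rewrite ?mulr0 ?mul0r ?mulr1 ?mul1r ?mulN1r ?ii ?add0r ?addr0 ?opprK ?subrr ?addNr ?addrN.
Qed.

(** A basis of W inside C^(4+n). [Qb] and [Pb] are the projections onto the last n and onto the
    first four coordinates. *)
Definition Wb : 'M[R[i]]_(4 + n, 2) := col_mx nullW 0.
Definition Qb : 'M[R[i]]_(4 + n) := block_mx 0 0 0 1%:M.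
Definition Pb : 'M[R[i]]_(4 + n) := block_mx 1%:M 0 0 0.

Section eta.
Variable X : 'M[R[i]]_(2, n).
Let eta := potential_mx (nullW *m X).

Lemma eta_Wb : eta *m Wb = 0.
Proof.
rewrite /eta /potential_mx /Wb mul_block_col !mul0mx !mulmx0 !addr0.
by rewrite mulNmx trmx_mul -!mulmxA (mulmxA nullW^T) nullW_isotropic mulmx0 oppr0 col_mx0.
Qed.

Lemma eta_Qb : eta *m Qb = Wb *m row_mx 0 X.
Proof.
rewrite /eta /potential_mx /Wb /Qb mulmx_block mul_col_row.
by rewrite !mulmx0 !mul0mx !addr0 !add0r mulmx1.
Qed.

(** The first summand takes its values in W, which [eta] kills; the second takes its values in the
    last n coordinates, which [eta] sends into W. *)
Lemma eta_split : eta = eta *m Qb + Qb *m eta *m Pb.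
Proof.
rewrite /eta /potential_mx /Pb /Qb !mulmx_block add_block_mx.
by rewrite !(mulmx0, mul0mx, addr0, add0r, mulmx1, mul1mx).
Qed.

End eta.

(** A1, A2 and A3 stand for the values of Em at l, 1 and -1, and k for 1 / l. *)
Lemma interpolate m (A1 A2 A3 : 'M[R[i]]_m) (k : R[i]) :
  A1 - k *: (2^-1 *: (A2 - A3)) - k ^+ 2 *: (2^-1 *: (A2 + A3)) =
    1%:M - k *: (2^-1 *: (1%:M - 1%:M)) - k ^+ 2 *: (2^-1 *: (1%:M + 1%:M)) ->
  A1 = 1%:M + k *: (2^-1 *: (A2 - A3)) + k ^+ 2 *: (2^-1 *: (A2 + A3) - 1%:M).
Proof.
have half2 : 2^-1 *: (1%:M + 1%:M) = 1%:M :> 'M[R[i]]_m.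
  by rewrite -scalemx1 -scalerDl scalerA mulVf ?pnatr_eq0.
rewrite [in X in _ = X -> _]subrr !scaler0 subr0 half2 => h.
rewrite [X in _ = _ + X]scalerBr; move: h; move: (k *: (2^-1 *: (A2 - A3))) (k ^+ 2 *: (2^-1 *: (A2 + A3))) (k ^+ 2 *: 1%:M).
move=> X Y Z h.
by rewrite -[A1](subrK X) -[A1 - X](subrK Y) h addrAC addrA [RHS]addrAC; congr (_ + _); rewrite addrAC.
Qed.

(* The matrices of the potential raise the filtration 0 < W < W^perp < C^(4+n), hence
   three of them multiply to zero and Em is a polynomial of degree 2 in 1/l. *)
Section Em.
Variables (Em : V -> R[i] -> 'M[R[i]]_(4 + n)) (X : V -> 'M[R[i]]_(2, n)) (r : R).
Hypothesis EmW : forall l : R[i], `|l| = 1 -> forall x, ball (0 : V) r x ->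
  is_W (fun y => Em y l) x (Em x l *m (l^-1 *: potential_mx (nullW *m X x))) 0.
Hypothesis Em0 : forall l : R[i], `|l| = 1 -> Em 0 l = 1%:M.

Let n1 : `|1 : R[i]| = 1. Proof. exact: normr1. Qed.
Let nN1 : `|-1 : R[i]| = 1. Proof. by rewrite normrN normr1. Qed.

Lemma Em_Wb l x : `|l| = 1 -> ball (0 : V) r x -> Em x l *m Wb = Wb.
Proof.
move=> l1 xr; rewrite (@is_W0_const _ _ _ (fun y => Em y l *m Wb) 0 r _ x xr).
  by rewrite Em0// mul1mx.
move=> y yr; have := is_WMr Wb (EmW l1 yr).
by rewrite mul0mx -scalemxAr -scalemxAl -mulmxA eta_Wb mulmx0 scaler0.
Qed.

(** The z-derivative of Em Q is l^-1 Em eta Q, and eta Q takes its values in W, which Em fixes: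
    hence l Em Q has a derivative that does not depend on l. *)
Lemma Em_Qb l x : `|l| = 1 -> ball (0 : V) r x ->
  Em x l *m Qb = Qb + l^-1 *: ((Em x 1 - 1%:M) *m Qb).
Proof.
move=> l1 xr; have l0 : l != 0 by rewrite -normr_eq0 l1 oner_eq0.
have h : l *: (Em x l *m Qb) - Em x 1 *m Qb = l *: Qb - Qb.
  rewrite (@is_W0_const _ _ _ (fun y => l *: (Em y l *m Qb) - Em y 1 *m Qb) 0 r _ x xr).
    by rewrite !Em0// !mul1mx.
  move=> y yr.
  have := is_WB (is_WZ l (is_WMr Qb (EmW l1 yr))) (is_WMr Qb (EmW n1 yr)).
  rewrite !mul0mx scaler0 subr0 invr1 scale1r -scalemxAr -scalemxAl scalerA mulfV// scale1r.
  by rewrite -!mulmxA eta_Qb !mulmxA !Em_Wb// subrr.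
rewrite mulmxBl mul1mx; move: (Em x l *m Qb) (Em x 1 *m Qb) h => A B h.
apply: (scalerI l0); rewrite scalerDr scalerA mulfV// scale1r.
by rewrite -[LHS](subrK B) h -addrA [- Qb + B]addrC.
Qed.

Lemma Em_poly l x : `|l| = 1 -> ball (0 : V) r x ->
  Em x l = 1%:M + l^-1 *: (2^-1 *: (Em x 1 - Em x (-1)))
    + (l^-1 ^+ 2) *: (2^-1 *: (Em x 1 + Em x (-1)) - 1%:M).
Proof.
move=> l1 xr; have l0 : l != 0 by rewrite -normr_eq0 l1 oner_eq0.
pose C y := Em y l - l^-1 *: (2^-1 *: (Em y 1 - Em y (-1)))
  - (l^-1 ^+ 2) *: (2^-1 *: (Em y 1 + Em y (-1))).
have h : C x = C 0.
  apply: (@is_W0_const _ _ _ C 0 r _ x xr) => y yr.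
  pose eta := potential_mx (nullW *m X y).
  pose S := eta *m Qb + Qb *m eta *m Pb.
  pose Z := (Em y 1 - 1%:M) *m Qb *m (eta *m Pb).
  (* The z-derivative of Em is l^-1 S + l^-2 Z with S and Z independent of l; the values at 1 and -1
     separate the odd part S from the even part Z. *)
  have A k : `|k| = 1 -> Em y k *m eta = S + k^-1 *: Z.
    move=> k1.
    have e1 : Em y k *m (eta *m Qb) = eta *m Qb.
      by rewrite /eta eta_Qb mulmxA (Em_Wb k1 yr).
    have e2 : Em y k *m (Qb *m eta *m Pb) = Qb *m eta *m Pb + k^-1 *: Z.
      have := Em_Qb k1 yr; rewrite /Z; move: (Em y k) ((Em y 1 - 1%:M) *m Qb) => M N MQ.
      by rewrite -(mulmxA Qb) mulmxA MQ mulmxDl scalemxAl.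
    by rewrite [X in Em y k *m X](eta_split (X y)) mulmxDr e1 e2 addrA.
  have d1 := EmW l1 yr; have d2 := EmW n1 yr; have d3 := EmW nN1 yr.
  have := is_WB (is_WB d1 (is_WZ l^-1 (is_WZ 2^-1 (is_WB d2 d3))))
    (is_WZ (l^-1 ^+ 2) (is_WZ 2^-1 (is_WD d2 d3))).
  rewrite -/eta -!scalemxAr (A _ l1) (A _ n1) (A _ nN1).
  rewrite !subr0 !addr0 !scaler0 !subr0; congr is_W.
  rewrite invr1 invrN1 !scaleN1r !scale1r; clear -l0; move: S Z => S Z.
  by apply/matrixP => i j; rewrite !mxE; field.
move: h; rewrite /C (Em0 l1) (Em0 n1) (Em0 nN1).
exact: interpolate.
Qed.

End Em.
End special.

(** * Matrices depending holomorphically on the loop parameter *)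

Section holmx.
Variable R : realType.

(** Adds the derivative at the centre, which [hol_quadratic] requires of both its functions. *)
Definition hol0 (f : R[i] -> R[i]) := hol f /\ derivable f 0 1.

Lemma hol0M f g : hol0 f -> hol0 g -> hol0 (fun z => f z * g z).
Proof. by move=> [f1 f2] [g1 g2]; split; [exact: holM f1 g1|exact: (derivableM f2 g2)]. Qed.

Lemma hol0D f g : hol0 f -> hol0 g -> hol0 (fun z => f z + g z).
Proof. by move=> [f1 f2] [g1 g2]; split; [exact: holD f1 g1|exact: (derivableD f2 g2)]. Qed.

Lemma hol0_cst c : hol0 (fun=> c).
Proof. by split; [exact: hol_cst|exact: derivable_cst]. Qed.

Lemma hol0_id : hol0 (fun z : R[i] => z).
Proof. by split; [exact: hol_id|exact: derivable_id]. Qed.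

Lemma hol0_sum (I : Type) (r : seq I) (F : I -> R[i] -> R[i]) :
  (forall i, hol0 (F i)) -> hol0 (fun z => \sum_(i <- r) F i z).
Proof.
move=> hF; elim: r => [|i r IH].
  rewrite (_ : (fun _ => _) = (fun=> 0)); first exact: hol0_cst.
  by apply/funext => z; rewrite big_nil.
rewrite (_ : (fun _ => _) = (fun z => F i z + \sum_(i <- r) F i z)).
  exact: hol0D (hF i) IH.
by apply/funext => z; rewrite big_cons.
Qed.

Definition holmx m p (M : R[i] -> 'M[R[i]]_(m, p)) :=
  forall i j, hol0 (fun l => M l i j).

Lemma holmxM m p q (M : R[i] -> 'M[R[i]]_(m, p)) (N : R[i] -> 'M[R[i]]_(p, q)) :
  holmx M -> holmx N -> holmx (fun l => M l *m N l).
Proof.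
move=> hM hN i j; rewrite (_ : (fun _ => _) = (fun l => \sum_k M l i k * N l k j)).
  by apply: hol0_sum => k; exact: hol0M (hM i k) (hN k j).
by apply/funext => l; rewrite mxE.
Qed.

Lemma holmx_cst m p (M : 'M[R[i]]_(m, p)) : holmx (fun=> M).
Proof. by move=> i j; exact: hol0_cst. Qed.

Lemma holmxD m p (M N : R[i] -> 'M[R[i]]_(m, p)) :
  holmx M -> holmx N -> holmx (fun l => M l + N l).
Proof.
move=> hM hN i j; rewrite (_ : (fun _ => _) = (fun l => M l i j + N l i j)).
  exact: hol0D (hM i j) (hN i j).
by apply/funext => l; rewrite mxE.
Qed.

Lemma holmx_scale m p (f : R[i] -> R[i]) (M : 'M[R[i]]_(m, p)) :
  hol0 f -> holmx (fun l => f l *: M).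
Proof.
move=> hf i j; rewrite (_ : (fun _ => _) = (fun l => f l * M i j)).
  exact: hol0M hf (hol0_cst _).
by apply/funext => l; rewrite mxE.
Qed.

Lemma holmxT m p (M : R[i] -> 'M[R[i]]_(m, p)) : holmx M -> holmx (fun l => (M l)^T).
Proof.
move=> hM i j; rewrite (_ : (fun _ => _) = (fun l => M l j i)); first exact: hM.
by apply/funext => l; rewrite mxE.
Qed.

Lemma holmx_lorinv m (M : R[i] -> 'M[R[i]]_m) : holmx M -> holmx (fun l => lorinv (M l)).
Proof.
move=> hM; exact: holmxM (holmxM (holmx_cst _) (holmxT hM)) (holmx_cst _).
Qed.

Lemma holmx_conj m p (M : R[i] -> 'M[R[i]]_(m, p)) : holmx M ->
  holmx (fun l => map_mx conjc (M l^*%C)).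
Proof.
move=> hM i j; have [h1 h2] := hM i j.
rewrite (_ : (fun _ => _) = (fun l => (M l^*%C i j)^*%C)); last first.
  by apply/funext => l; rewrite mxE.
split; first exact: (hol_conj h1).
by apply: (@derivable_conj _ (fun l => M l i j)); rewrite conjc0.
Qed.

End holmx.

Section birkhoff.
Variable R : realType.
Notation V := (R * R)%type.

Lemma disk_extension_holmx n (g X : R[i] -> 'M[R[i]]_(4 + n)) :
  disk_extension g X -> holmx X.
Proof.
move=> [_ _ Xc Xd] i j; split; last first.
  by apply: (nbhs_singleton (Xd 0 i j _)); rewrite normr0.
split; first exact: Xc.
by move=> z _ z1; exact: nbhs_singleton (Xd z i j z1).
Qed.

(* The reality of E = Em Ep turns the polynomial Em into a bound on the degree of Ep. *)
Lemma birkhoff_quadratic m (E Em Ep Xp : R[i] -> 'M[R[i]]_m) M1 M2 :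
  (forall l : R[i], `|l| = 1 -> [/\ E l = Em l *m Ep l, map_mx conjc (E l) = E l,
     Em l = 1%:M + l^-1 *: M1 + (l^-1 ^+ 2) *: M2, SO1 R[i] m (Em l) & Xp l = Ep l]) ->
  holmx Xp ->
  forall i j, exists a b, forall l : R[i], `|l| = 1 ->
    Ep l i j = Xp 0 i j + a * l + b * l ^+ 2.
Proof.
move=> H hX i j.
pose P l := 1%:M + l *: map_mx conjc M1 + l ^+ 2 *: map_mx conjc M2.
pose Q l := l ^+ 2 *: 1%:M + l *: M1 + M2.
have hl2 : hol0 (fun l : R[i] => l ^+ 2) by exact: (hol0M (@hol0_id R) (@hol0_id R)).
have hP : holmx P.
  exact: (holmxD (holmxD (holmx_cst _) (holmx_scale _ (@hol0_id R))) (holmx_scale _ hl2)).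
have hQ : holmx Q.
  exact: (holmxD (holmxD (holmx_scale _ hl2) (holmx_scale _ (@hol0_id R))) (holmx_cst _)).
(* On the circle P is the conjugate of Em and Q is l^2 Em, so that q is l^2 conj(Em)^-1 E. As E is
   real, the conjugate of q is l^-2 Em^-1 E = l^-2 Ep, which is the relation of [hol_quadratic]. *)
pose q l := lorinv (P l) *m Q l *m Xp l.
have hq : holmx q by exact: (holmxM (holmxM (holmx_lorinv hP) hQ) hX).
have qE l : `|l| = 1 -> Xp l = l ^+ 2 *: map_mx conjc (q l).
  move=> l1; have l0 : l != 0 by rewrite -normr_eq0 l1 oner_eq0.
  have [EE Er EmE EmS XE] := H l l1.
  have PE : P l = map_mx conjc (Em l).
    rewrite EmE /P [RHS]conj_addmx [X in _ = X + _]conj_addmx !conj_scalemx.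
    rewrite rmorphXn/= conjc_inv (circle_conj l1) invrK; congr (_ + _ + _).
    by apply/matrixP => a b; rewrite !mxE [RHS]rmorphMn rmorph1.
  have QE : Q l = l ^+ 2 *: Em l.
    have k1 : l ^+ 2 * l^-1 = l by field.
    have k2 : l ^+ 2 * l^-1 ^+ 2 = 1 by field.
    by rewrite EmE /Q !scalerDr !scalerA k1 k2 scale1r.
  have -> : q l = l ^+ 2 *: (lorinv (map_mx conjc (Em l)) *m E l).
    by rewrite /q PE QE XE EE -scalemxAr -scalemxAl mulmxA.
  rewrite conj_scalemx conj_mulmx conj_lorinv Er scalerA XE.
  have -> : map_mx conjc (map_mx conjc (Em l)) = Em l.
    by apply/matrixP => a b; rewrite !mxE conjcK.
  rewrite rmorphXn/= (circle_conj l1) -exprMn mulfV// expr1n scale1r EE mulmxA.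
  by rewrite SO1_mulV// mul1mx.
have [h1 h2] := hX i j; have [h3 h4] := hq i j.
have [|a [b ab]] := @hol_quadratic R (fun l => Xp l i j) (fun l => q l i j) h1 h3 h2 h4.
  by move=> z z1; rewrite (qE z z1) !mxE.
exists a, b => l l1; rewrite -ab//.
by have [_ _ _ _ ->] := H l l1.
Qed.

(** Sums over the fourth roots of unity: the sum of l^k is 4 for k = 0 and 0 for k = 1, 2, 3, which
    covers the exponents of f(l) and of l f(l). *)
Lemma quadratic_average (f : R[i] -> R[i]) (a b c : R[i]) :
  (forall l : R[i], `|l| = 1 -> f l = c + a * l + b * l ^+ 2) ->
  f 1 + f 'i + f (-1) + f (- 'i) = 4 * c /\
  1 * f 1 + 'i * f 'i + (-1) * f (-1) + (- 'i) * f (- 'i) = 0.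
Proof.
move=> H; have ii : 1 + 'i ^+ 2 = 0 :> R[i] by rewrite sqrCi subrr.
have nI : `|'i : R[i]| = 1 by exact: normCi.
rewrite !H ?normrN ?nI ?normr1//; split.
  by rewrite -[RHS](addr0) -(mulr0 (2 * b)) -ii; ring.
by rewrite -[RHS](mulr0 (2 * a)) -ii; ring.
Qed.

Variables (n : nat) (D : surface) (FF : option R[i] -> set 'M[R]_(4 + n)).
Variables (f1 f3 : 'I_n -> option R[i] -> R[i]).

(** The pointwise consequences of the special form of the potential; they hold on a ball about the
    base point, where all later arguments take place. *)
Record birkhoff_at (F : V -> 'M[R]_(4 + n)) (E Em Ep : V -> R[i] -> 'M[R[i]]_(4 + n))
    (x : V) : Prop := BirkhoffAt {
  bF : SO1 R (4 + n) (F x);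
  bFd : forall i j, derivable (fun y => F y i j) x (dir_u R) /\
     derivable (fun y => F y i j) x (dir_v R);
  bE1 : E x 1 = complexify F x;
  bEreal : forall l : R[i], `|l| = 1 -> map_mx conjc (E x l) = E x l;
  bEW : forall l : R[i], `|l| = 1 ->
    is_W (fun y => E y l) x (E x l *m alpha_z F l x) (E x l *m alpha_zbar F l x);
  bEm : forall l : R[i], `|l| = 1 -> SO1 R[i] (4 + n) (Em x l);
  bEmW : forall l : R[i], `|l| = 1 -> is_W (fun y => Em y l) x
    (Em x l *m (l^-1 *: potential_mx (nullW R *m coefX f1 f3 (Some (cplx x))))) 0;
  bEm_Wb : forall l : R[i], `|l| = 1 -> Em x l *m Wb R n = Wb R n;
  bEm_poly : exists M1 M2, forall l : R[i], `|l| = 1 ->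
    Em x l = 1%:M + l^-1 *: M1 + (l^-1 ^+ 2) *: M2;
  bEE : forall l : R[i], `|l| = 1 -> E x l = Em x l *m Ep x l;
  bEp_twisted : twisted (Ep x);
  bXp : exists Xp, disk_extension (Ep x) Xp }.

Lemma normalized_birkhoff : normalized_potential D FF (special_B f1 f3) ->
  exists (U : set V) (F : V -> 'M[R]_(4 + n)) E Em Ep (r : R),
  [/\ local_lift D FF false U F, 0 < r, ball 0 r `<=` U &
    forall x, ball 0 r x -> birkhoff_at F E Em Ep x].
Proof.
move=> [_ [U [E [Em [Ep [[F [FL U0 F0 EP]] birk EmP]]]]]].
have [Uo UD Fs FG] := FL.
have /nbhs_ballP[r /= r0 rU] : nbhs (0 : V) U by exact: open_nbhs_nbhs.
exists U, F, E, Em, Ep, r; split=> //.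
have Fd x : U x -> forall i j, derivable (fun y => F y i j) x (dir_u R) /\
     derivable (fun y => F y i j) x (dir_v R).
  by move=> Ux i j; split; exact: smooth_derivable (Fs i j) Ux.
have FS x : U x -> SO1 R (4 + n) (F x).
  by move=> /FG[] h _; exact: (connected_component_sub h).
have l0 (l : R[i]) : `|l| = 1 -> l != 0 by move=> l1; rewrite -normr_eq0 l1 oner_eq0.
have lV (l : R[i]) : `|l| = 1 -> `|l^-1| = 1 by move=> l1; rewrite normfV l1 invr1.
have EpS x l : U x -> `|l| = 1 -> SO1 R[i] (4 + n) (Ep x l).
  move=> /birk[_ _ _ [X [h1 h2 _ _]] _] l1.
  by rewrite -h1//; apply: h2; rewrite l1.
have EmS x l : U x -> `|l| = 1 -> SO1 R[i] (4 + n) (Em x l).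
  move=> /birk[_ _ _ _ [X [[h1 h2 _ _] _]]] l1.
  rewrite -[l]invrK -(h1 l^-1); last exact: lV.
  by apply: h2; rewrite lV.
have EE x l : U x -> `|l| = 1 -> E x l = Em x l *m Ep x l.
  by move=> /birk[h _ _ _ _]; exact: h.
have ES x l : U x -> `|l| = 1 -> SO1 R[i] (4 + n) (E x l).
  by move=> Ux l1; rewrite (EE x l Ux l1); apply: SO1M; [exact: EmS|exact: EpS].
have EW x l : U x -> `|l| = 1 ->
    is_W (fun y => E y l) x (E x l *m alpha_z F l x) (E x l *m alpha_zbar F l x).
  move=> Ux l1; have [Es _ h] := EP l l1; have [Eu hz hzb] := h x Ux.
  exact: (is_W_frame Eu (smooth_is_W Es Ux) hz hzb).
have EmW x l : U x -> `|l| = 1 -> is_W (fun y => Em y l) x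
    (Em x l *m (l^-1 *: potential_mx (nullW R *m coefX f1 f3 (Some (cplx x))))) 0.
  move=> Ux l1; have [Es h] := EmP l l1; have [h1 h2] := h x Ux.
  have [Eu _] := SO1_unit (EmS x l Ux l1).
  have e2 : d_zbar (fun y => Em y l) x = 0.
    by rewrite -[LHS](mulKVmx Eu) -/(mc_zbar (fun y => Em y l) x) h2 mulmx0.
  rewrite -special_BE -h1 /mc_z mulKVmx// -[X in is_W _ _ _ X]e2.
  exact: smooth_is_W Es Ux.
(* At the base point E = 1, so Em = Ep^-1 on the circle extends holomorphically to both sides and is
   constant, equal to its value 1 at infinity. *)
have Em0 l : `|l| = 1 -> Em 0 l = 1%:M.
  move=> l1; have [_ _ _ [Xp hXp] [Xm [hXm Xm0]]] := birk 0 U0.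
  have hp := disk_extension_holmx hXp; have hm := disk_extension_holmx hXm.
  have onc k : `|k| = 1 -> Em 0 k = lorinv (Xp k) /\ Em 0 k = Xm k^*%C.
    move=> k1; split.
      have [-> //] := hXp; have [_ E0 _] := EP k k1.
      have := EE 0 k U0 k1; rewrite E0 => /esym/(congr1 (mulmx^~ (lorinv (Ep 0 k)))).
      by rewrite -mulmxA SO1_mulVr ?mulmx1 ?mul1mx//; exact: EpS.
    have [-> //] := hXm; first by rewrite (circle_conj k1) invrK.
    by rewrite normcJ.
  apply/matrixP => i j.
  have [q1 _] := holmx_conj hm i j; have [p1 _] := holmx_lorinv hp i j.
  have qp k : `|k| = 1 -> map_mx conjc (Xm k^*%C) i j = (lorinv (Xp k) i j)^*%C.
    by move=> k1; have [h1 h2] := onc k k1; rewrite -h1 -h2 mxE.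
  have := hol_conj_cst q1 p1 qp l1; have [_ <-] := onc l l1.
  by rewrite conjc0 Xm0 !mxE => /(can_inj (@conjcK R)).
have ball_near x (P : V -> Prop) : ball (0 : V) r x -> (forall y, ball (0 : V) r y -> P y) ->
    \forall y \near x, P y.
  move=> xr HP; have : open (ball (0 : V) r) by exact: ball_open.
  by rewrite openE => /(_ x xr); apply: filterS.
(* The conjugate of E solves the same equation as E, with the same value at the base point. *)
have Er x l : ball (0 : V) r x -> `|l| = 1 -> map_mx conjc (E x l) = E x l.
  move=> xr l1.
  apply: (@frames_eq R _ (fun y => map_mx conjc (E y l)) (fun y => E y l)
    (alpha_z F l) (alpha_zbar F l) 0 r _ _ x xr); last first.
    have [_ -> _] := EP l l1.
    by apply/matrixP => i j; rewrite !mxE [LHS]rmorphMn rmorph1.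
  move=> y yr; have Uy := rU y yr; have h := ES y l Uy l1; have hW := EW y l Uy l1.
  split=> //.
    have [h1 h2] := h; split; last by rewrite det_map_mx h2 rmorph1.
    rewrite -[in RHS](lor_conj R) -[in RHS]h1 !conj_mulmx lor_conj; congr (_ *m _ *m _).
    by apply/matrixP => i j; rewrite !mxE.
  have [c1 c2] := conj_alpha (Fd y Uy) (FS y Uy) l1.
  by have := is_W_conj_frame hW; rewrite c1 c2.
have E1 x : ball (0 : V) r x -> E x 1 = complexify F x.
  move=> xr; have n1 : `|1 : R[i]| = 1 by exact: normr1.
  apply: (@frames_eq R _ (fun y => E y 1) (complexify F)
    (alpha_z F 1) (alpha_zbar F 1) 0 r _ _ x xr); last first.
    have [_ -> _] := EP 1 n1.
    by rewrite /complexify F0; apply/matrixP => i j; rewrite !mxE rmorphMn rmorph1.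
  move=> y yr; have Uy := rU y yr; split; [exact: ES|exact: SO1_map (FS y Uy)|exact: EW|].
  have -> : alpha_z F 1 y = mc_z (complexify F) y.
    by rewrite /alpha_z invr1 scale1r -[mc_z _ _]submxK ppart_block kpart_block add_block_mx !addr0 !add0r.
  have -> : alpha_zbar F 1 y = mc_zbar (complexify F) y.
    by rewrite /alpha_zbar scale1r -[mc_zbar _ _]submxK ppart_block kpart_block add_block_mx !addr0 !add0r.
  exact: complexify_mc (Fd y Uy) (FS y Uy).
have EmWb l : `|l| = 1 -> forall x, ball (0 : V) r x -> is_W (fun y => Em y l) x
    (Em x l *m (l^-1 *: potential_mx (nullW R *m coefX f1 f3 (Some (cplx x))))) 0.
  by move=> l1 x xr; exact: EmW (rU x xr) l1.
move=> x xr; have Ux := rU x xr; have [_ _ tw hXp _] := birk x Ux.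
apply: BirkhoffAt.
- exact: FS.
- exact: Fd.
- exact: E1.
- by move=> l; exact: Er.
- by move=> l; exact: EW.
- by move=> l; exact: EmS.
- by move=> l l1; exact: EmW.
- by move=> l l1; exact: (Em_Wb EmWb Em0 l1 xr).
- by do 2!eexists; move=> l l1; exact: (Em_poly EmWb Em0 l1 xr).
- by move=> l; exact: EE.
- exact: tw.
- exact: hXp.
Qed.
End birkhoff.

Section relation.
Variables (R : realType) (n : nat) (f1 f3 : 'I_n -> option R[i] -> R[i]).
Notation V := (R * R)%type.
Variables (F : V -> 'M[R]_(4 + n)) (E Em Ep : V -> R[i] -> 'M[R[i]]_(4 + n)).

Lemma birkhoff_Ep_quadratic x Xp : birkhoff_at f1 f3 F E Em Ep x ->
  disk_extension (Ep x) Xp -> forall i j, exists a b, forall l : R[i], `|l| = 1 ->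
    Ep x l i j = Xp 0 i j + a * l + b * l ^+ 2.
Proof.
move=> bx hXp; have hp := disk_extension_holmx hXp; have [XE _ _ _] := hXp.
have [M1 [M2 MP]] := bEm_poly bx.
apply: (birkhoff_quadratic (E := E x) (Em := Em x) (M1 := M1) (M2 := M2) _ hp) => l l1.
by split; [exact: (bEE bx l1)|exact: (bEreal bx l1)|exact: MP|exact: (bEm bx l1)|exact: XE].
Qed.

Lemma sigma_entry (A : 'M[R[i]]_(4 + n)) i j :
  sigma A i j = (if (i < 4)%N == (j < 4)%N then 1 else -1) * A i j.
Proof.
have li (k : 'I_4) : (lshift n k < 4)%N by rewrite /= ltn_ord.
have ri (k : 'I_n) : (rshift 4 k < 4)%N = false by apply/negbTE; rewrite -leqNgt /= leq_addr.
rewrite -[A]submxK sigma_block.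
by case: (split_ordP i) => a ->; case: (split_ordP j) => b ->;
  rewrite ?block_mxEul ?block_mxEur ?block_mxEdl ?block_mxEdr ?li ?ri/= ?mul1r ?mulN1r ?mxE.
Qed.

(** Twisting is a relation on the circle. The entries of sigma(Xp(l)) - Xp(-l) are holomorphic in
    the disk and vanish on the circle, hence also at the centre. *)
Lemma twisted_center x Xp : birkhoff_at f1 f3 F E Em Ep x ->
  disk_extension (Ep x) Xp -> sigma (Xp 0) = Xp 0.
Proof.
move=> bx hXp; have hp := disk_extension_holmx hXp; have [XE _ _ _] := hXp.
apply/matrixP => i j; rewrite sigma_entry; set s := (if _ then _ else _).
have [h _] := hp i j.
have h1 : hol (fun l => s * Xp l i j - Xp (-1 * l) i j).
  have nN1 : `|-1 : R[i]| = 1 by rewrite normrN normr1.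
  exact: (holD (holM (hol_cst s) h) (holN (hol_rot nN1 h))).
have := hol_zero_boundary h1 _; rewrite mulr0.
move=> H; apply/eqP; rewrite -subr_eq0; apply/eqP/H => l l1.
rewrite !XE ?mulN1r ?normrN// (bEp_twisted bx)// sigma_entry -/s.
by rewrite subrr.
Qed.

Lemma lorinv_fixed m p (A B C : 'M[R[i]]_m) (e : 'M[R[i]]_(m, p)) : SO1 R[i] m A ->
  A *m e = e -> C = A *m B -> lorinv C *m e = lorinv B *m e.
Proof.
move=> hA Ae ->; rewrite lorinvM -(mulmxA (lorinv B)); congr (_ *m _).
by rewrite -{1}Ae mulmxA (SO1_mulV hA) mul1mx.
Qed.

Lemma conj_Im0 (z : R[i]) : z^*%C = z -> complex.Im z = 0.
Proof. by case: z => a b [] h /=; lra. Qed.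

Lemma real_center x Xp (e : 'cV[R[i]]_(4 + n)) : birkhoff_at f1 f3 F E Em Ep x ->
  disk_extension (Ep x) Xp -> map_mx conjc e = e ->
  (forall l : R[i], `|l| = 1 -> Em x l *m e = e) ->
  lorinv (complexify F x) *m e = lorinv (Xp 0) *m e.
Proof.
move=> bx hXp ee Eme; have hp := disk_extension_holmx hXp; have [XE _ _ _] := hXp.
have hc := holmxM (holmx_lorinv hp) (holmx_cst e).
have onc l : `|l| = 1 -> lorinv (Xp l) *m e = lorinv (E x l) *m e.
  move=> l1; rewrite (XE l l1).
  exact/esym/(lorinv_fixed (bEm bx l1) (Eme l l1) (bEE bx l1)).
have n1 : `|1 : R[i]| = 1 by exact: normr1.
apply: (etrans (congr1 (fun M => lorinv M *m e) (esym (bE1 bx)))).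
apply: (etrans (esym (onc 1 n1))); apply/matrixP => i j.
have [h _] := hc i j; apply: (hol_real_cst h) => // l l1.
rewrite (onc l l1).
have := conj_mulmx (lorinv (E x l)) e; rewrite conj_lorinv (bEreal bx l1) ee.
by move=> /matrixP/(_ i j); rewrite mxE; exact: conj_Im0.
Qed.

End relation.

(** * The gauge by the value of F_+ at the centre *)

Definition null_vec (R : realType) n : 'cV[R[i]]_(4 + n) := col ord0 (Wb R n).
Definition normal_mx (R : realType) n : 'M[R[i]]_(4 + n, n) := col_mx 0 1%:M.

Lemma lor_block (T : comNzRingType) n :
  lor T (4 + n) = block_mx (lor T 4) 0 0 1%:M.
Proof.
apply/matrixP => i j; rewrite /lor.
case: (split_ordP i) => a ->; case: (split_ordP j) => b ->;
  rewrite ?block_mxEul ?block_mxEur ?block_mxEdl ?block_mxEdr !mxE.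
- by rewrite (inj_eq (@lshift_inj _ _)).
- by rewrite eq_lrshift.
- by rewrite eq_rlshift.
- by rewrite (inj_eq (@rshift_inj _ _)).
Qed.

Section gauge.
Variables (R : realType) (n : nat) (f1 f3 : 'I_n -> option R[i] -> R[i]).
Notation V := (R * R)%type.
Variables (F : V -> 'M[R]_(4 + n)) (E Em Ep : V -> R[i] -> 'M[R[i]]_(4 + n)).
Variable r : R.
Hypothesis bx : forall x, ball 0 r x -> birkhoff_at f1 f3 F E Em Ep x.

Let eta x := potential_mx (nullW R *m coefX f1 f3 (Some (cplx x))).
(** Smoothness in x is given for [Em] and [E]; this expression inherits it, and on the circle it
    agrees with [Ep]. *)
Let Ep' y l := lorinv (Em y l) *m E y l.

Let EpE x l : ball 0 r x -> `|l| = 1 -> Ep' x l = Ep x l.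
Proof.
move=> /bx b l1; have EE := bEE b l1; have mV := SO1_mulV (bEm b l1).
by rewrite /Ep' EE mulmxA mV mul1mx.
Qed.

Let ball_near x (P : V -> Prop) : ball 0 r x -> (forall y, ball 0 r y -> P y) ->
  \forall y \near x, P y.
Proof.
move=> xr HP; have : open (ball (0 : V) r) by exact: ball_open.
by rewrite openE => /(_ x xr); apply: filterS.
Qed.

(** The product rule for E = Em Ep, multiplied on the left by Em^-1. *)
Let Ep_W x l : ball 0 r x -> `|l| = 1 -> exists c d,
  is_W (fun y => Ep' y l) x c d /\ l^-1 *: (eta x *m Ep x l) + c = Ep x l *m alpha_z F l x.
Proof.
move=> xr l1; have b := bx xr.
have h1 := is_WMr (lor R[i] (4 + n)) (is_WMl (lor R[i] (4 + n)) (is_WT (bEmW b l1))).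
have h2 := is_WM h1 (bEW b l1).
do 2!eexists; split; first exact: h2.
move: h2; set c := (X in is_W _ _ X _); set d := (X in is_W _ _ _ X) => h2.
have h3 := is_WM (bEmW b l1) h2.
have h4 : is_W (fun y => Em y l *m Ep' y l) x (E x l *m alpha_z F l x) (E x l *m alpha_zbar F l x).
  apply: is_W_near (bEW b l1); apply: (ball_near xr) => y yr.
  by rewrite (EpE yr l1) (bEE (bx yr) l1).
have [h5 _] := is_W_uniq h3 h4.
have mV := SO1_mulV (bEm b l1).
have h6 := congr1 (mulmx (lorinv (Em x l))) h5.
have EE := bEE b l1; have EpE' := EpE xr l1; rewrite /Ep' in EpE'.
rewrite EpE' EE in h6.
by rewrite mulmxDr !mulmxA mV !mul1mx -scalemxAl in h6.
Qed.

(** Let a' be the p-part and a'' the k-part of [mc_z]. Multiplied by l, [Ep_W] reads Ep a' + l Ep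
    a'' = eta Ep + l dEp/dz. Summed over the fourth roots of unity, the terms with the factor l
    cancel, because l Ep has only the exponents 1, 2, 3 in l; the sum of Ep is 4 [Xp 0]. *)
Lemma gauge_relation x Xp : ball 0 r x -> disk_extension (Ep x) Xp ->
  Xp 0 *m ppart (mc_z (complexify F) x) = eta x *m Xp 0.
Proof.
move=> xr hXp; set A := mc_z (complexify F) x.
have n1 : `|1 : R[i]| = 1 by exact: normr1.
have nN1 : `|-1 : R[i]| = 1 by rewrite normrN normr1.
have nI : `|'i : R[i]| = 1 by exact: normCi.
have nNI : `|- 'i : R[i]| = 1 by rewrite normrN.
have l0 (l : R[i]) : `|l| = 1 -> l != 0 by move=> l1; rewrite -normr_eq0 l1 oner_eq0.
have rel l : `|l| = 1 -> exists c d, is_W (fun y => l *: Ep' y l) x c d /\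
    Ep x l *m ppart A + l *: Ep x l *m kpart A = eta x *m Ep x l + c.
  move=> l1; have [c [d [h1 h2]]] := Ep_W xr l1.
  exists (l *: c), (l *: d); split; first exact: is_WZ.
  have := congr1 (fun M => l *: M) h2; rewrite scalerDr scalerA mulfV ?l0// scale1r => ->.
  by rewrite /alpha_z -/A mulmxDr -(scalemxAr l^-1) scalerDr scalerA mulfV ?l0// scale1r scalemxAl.
have [c1 [d1 [W1 E1]]] := rel _ n1; have [c2 [d2 [W2 E2]]] := rel _ nI.
have [c3 [d3 [W3 E3]]] := rel _ nN1; have [c4 [d4 [W4 E4]]] := rel _ nNI.
have sum0 y : ball 0 r y ->
    1 *: Ep y 1 + 'i *: Ep y 'i + (-1) *: Ep y (-1) + (- 'i) *: Ep y (- 'i) = 0.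
  move=> yr; have b := bx yr; have [Xq hXq] := bXp b.
  apply/matrixP => i j; have [a' [b' H]] := birkhoff_Ep_quadratic b hXq i j.
  by have [_ h] := quadratic_average H; rewrite !mxE.
have c0 : c1 + c2 + c3 + c4 = 0.
  have h1 := is_WD (is_WD (is_WD W1 W2) W3) W4.
  have h2 : is_W (fun y => 1 *: Ep' y 1 + 'i *: Ep' y 'i + (-1) *: Ep' y (-1) +
      (- 'i) *: Ep' y (- 'i)) x 0 0.
    apply: is_W_near (is_W_cst 0 x); apply: (ball_near xr) => y yr.
    by rewrite (EpE yr n1) (EpE yr nI) (EpE yr nN1) (EpE yr nNI) (sum0 y yr).
  by have [] := is_W_uniq h1 h2.
have sum4 : Ep x 1 + Ep x 'i + Ep x (-1) + Ep x (- 'i) = 4 *: Xp 0.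
  apply/matrixP => i j; have [a' [b' H]] := birkhoff_Ep_quadratic (bx xr) hXp i j.
  by have [h _] := quadratic_average H; rewrite !mxE.
have n4 : (4 : R[i]) != 0 by rewrite pnatr_eq0.
apply: (scalerI n4); rewrite scalemxAl -sum4 scalemxAr -sum4.
have s0 := congr1 (fun M => M *m kpart A) (sum0 x xr); rewrite mul0mx in s0.
have := congr2 +%R (congr2 +%R (congr2 +%R E1 E2) E3) E4.
move: s0 c0; rewrite !mulmxDl !mulmxDr.
move: (Ep x 1 *m ppart A) (Ep x 'i *m ppart A) (Ep x (-1) *m ppart A) (Ep x (- 'i) *m ppart A).
move: (1 *: Ep x 1 *m kpart A) ('i *: Ep x 'i *m kpart A) (-1 *: Ep x (-1) *m kpart A)
  (- 'i *: Ep x (- 'i) *m kpart A).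
move: (eta x *m Ep x 1) (eta x *m Ep x 'i) (eta x *m Ep x (-1)) (eta x *m Ep x (- 'i)).
move=> e1 e2 e3 e4 k1 k2 k3 k4 p1 p2 p3 p4 k0 c0 H.
have <- : p1 + k1 + (p2 + k2) + (p3 + k3) + (p4 + k4) = p1 + p2 + p3 + p4.
  by rewrite !(addrACA _ k1, addrACA _ (k1 + k2), addrACA _ (k1 + k2 + k3)) k0 addr0.
by rewrite H !(addrACA _ c1, addrACA _ (c1 + c2), addrACA _ (c1 + c2 + c3)) c0 addr0.
Qed.

Lemma sigma_fixed_block (X : 'M[R[i]]_(4 + n)) : sigma X = X ->
  exists k1 k2, X = block_mx k1 0 0 k2.
Proof.
have h (m p : nat) (M : 'M[R[i]]_(m, p)) : - M = M -> M = 0.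
  move=> /matrixP MM; apply/matrixP => i j; rewrite [RHS]mxE.
  have := MM i j; rewrite mxE => /eqP; rewrite eq_sym -addr_eq0 -mulr2n mulrn_eq0/=.
  by move/eqP.
move=> sig; exists (ulsubmx X), (drsubmx X).
move: sig; rewrite -{1 2}[X]submxK sigma_block => /eq_block_mx[_ /h u /h v _].
by rewrite -{1}[X]submxK u v.
Qed.

(** The upper right block of the gauge relation. The value at the centre is block diagonal because
    sigma fixes it, and both blocks are invertible because its determinant is the product of
    theirs. *)
Lemma B1_gauge x : ball 0 r x -> exists k1 k2, [/\ k1 \in unitmx, k2 \in unitmx &
  k1 *m B1 F x = special_B f1 f3 (Some (cplx x)) *m k2].
Proof.
move=> xr; have b := bx xr; have [Xp hXp] := bXp b.
have rel := gauge_relation xr hXp; have sig := twisted_center b hXp.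
have XS : SO1 R[i] (4 + n) (Xp 0) by have [_ h _ _] := hXp; apply: h; rewrite normr0.
set X := Xp 0 in rel sig XS; have [k1 [k2 XE]] := sigma_fixed_block sig.
have Xd : \det X \is a GRing.unit by have [Xu _] := SO1_unit XS; rewrite -unitmxE.
move: Xd rel; rewrite XE det_ublock unitrM => /andP[u1 u2] rel.
exists k1, k2; rewrite !unitmxE u1 u2; split=> //; move: rel; rewrite special_BE.
rewrite -[mc_z _ x]submxK ppart_block /eta /potential_mx !mulmx_block.
by rewrite !(mul0mx, mulmx0, addr0, add0r) => /eq_block_mx[_ h _ _].
Qed.

(* By reality F^-1 e does not depend on l, so that the null vector e, which is fixed
   by Em, belongs to the Lorentzian subspace F(x). *)
Lemma null_vector_in_lift x : ball 0 r x ->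
  (complexify F x *m normal_mx R n)^T *m lor R[i] (4 + n) *m null_vec R n = 0.
Proof.
move=> xr; have b := bx xr; have [Xp hXp] := bXp b.
have [k1 [k2 XE]] := sigma_fixed_block (twisted_center b hXp).
have ee : map_mx conjc (null_vec R n) = null_vec R n.
  apply/matrixP => i j; rewrite !mxE; case: split_ordP => k _; rewrite !mxE ?conjc0//.
  by case: k => [[|[|[|[|//]]]] ?] /=; apply/eqP; rewrite eq_complex/= ?oppr0 ?eqxx.
have Eme l : `|l| = 1 -> Em x l *m null_vec R n = null_vec R n.
  by move=> l1; rewrite /null_vec -[in RHS](bEm_Wb b l1) !colE mulmxA.
have h := real_center b hXp ee Eme.
have KJ : (normal_mx R n)^T *m lor R[i] (4 + n) = (normal_mx R n)^T.
  rewrite lor_block /normal_mx tr_col_mx trmx0 trmx1 mul_row_block.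
  by rewrite !(mul0mx, mulmx0, addr0, add0r, mul1mx, mulmx1).
rewrite trmx_mul -[in LHS]KJ.
have -> : (normal_mx R n)^T *m lor R[i] (4 + n) *m (complexify F x)^T *m lor R[i] (4 + n)
  *m null_vec R n = (normal_mx R n)^T *m (lorinv (complexify F x) *m null_vec R n).
  by rewrite /lorinv !mulmxA.
rewrite h XE /lorinv lor_block tr_block_mx /normal_mx /null_vec /Wb col_col_mx.
rewrite tr_col_mx !mulmx_block mul_block_col mul_row_col.
by rewrite !(trmx0, trmx1, mul0mx, mulmx0, addr0, add0r, mul1mx, mulmx1, col0).
Qed.

End gauge.

(** * The conformal Gauss map *)

Section lorentz.
Variables (R : realType) (n : nat).
Notation C := R[i].
Notation Kb := (normal_mx R n).
Notation J := (lor C (4 + n)).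

Lemma normal_mx_lor : Kb^T *m J = Kb^T.
Proof.
rewrite lor_block /normal_mx tr_col_mx trmx0 trmx1 mul_row_block.
by rewrite !(mul0mx, mulmx0, addr0, add0r, mul1mx, mulmx1).
Qed.

(** Orthogonality to the last n columns of F means that the coordinates F^-1 X end in zeros. As F
    preserves the form, pairing X with the derivative of these columns is pairing c with the upper
    right block of F^-1 dF. *)
Lemma perp_coordinates (F dF : 'M[C]_(4 + n)) (X : 'cV[C]_(4 + n)) :
  SO1 C (4 + n) F -> (F *m Kb)^T *m J *m X = 0 ->
  exists c : 'cV[C]_4, X = F *m (col_mx c 0 : 'cV[C]_(4 + n)) /\
    c^T *m lor C 4 *m ursubmx (invmx F *m dF) = X^T *m J *m (dF *m Kb).
Proof.
move=> hF FX; have [_ iF] := SO1_unit hF.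
pose c := usubmx (lorinv F *m X).
have cE : lorinv F *m X = col_mx c 0.
  rewrite -[LHS]vsubmxK; congr col_mx.
  have -> : dsubmx (lorinv F *m X) = Kb^T *m (lorinv F *m X).
    rewrite -[lorinv F *m X in RHS]vsubmxK /normal_mx tr_col_mx trmx0 trmx1 mul_row_col.
    by rewrite mul0mx add0r mul1mx.
  by rewrite /lorinv !mulmxA normal_mx_lor -trmx_mul.
exists c; split; first by rewrite -cE mulmxA (SO1_mulVr hF) mul1mx.
rewrite iF; set A := lorinv F *m dF.
transitivity ((lorinv F *m X)^T *m J *m (A *m Kb)).
  rewrite cE -[A in RHS]submxK /normal_mx (lor_block C n) mul_block_col tr_col_mx mul_row_block mul_row_col.
  by rewrite !(trmx0, mul0mx, mulmx0, addr0, add0r, mulmx1).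
have e : (lorinv F)^T *m J *m lorinv F = J.
  rewrite /lorinv !trmx_mul trmxK lorT !mulmxA -(mulmxA (J *m F) J J) lorK mulmx1.
  by rewrite -!mulmxA (mulmxA F) (mulmxA (F *m J)) (SO1_AJAT hF) lorK mulmx1.
move: e; rewrite /A -mulmxA; move: (lorinv F) => G' e.
by rewrite trmx_mul -!mulmxA (mulmxA J G') (mulmxA G'^T) e.
Qed.

(** In C^4 the orthogonal of a plane has dimension 2, so an isotropic plane equals its orthogonal.
    Thus c lies in the column space of M, to which d is orthogonal. *)
Lemma isotropic_kernel (M : 'M[C]_(4, n)) (c d : 'cV[C]_4) : \rank M = 2%N ->
  M^T *m lor C 4 *m M = 0 -> c^T *m lor C 4 *m M = 0 -> d^T *m lor C 4 *m M = 0 ->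
  c^T *m lor C 4 *m d = 0.
Proof.
move=> rM MM cM dM; pose N := lor C 4 *m M.
have rN : \rank N = 2%N.
  have lu : lor C 4 \in unitmx by have [] := mulmx1_unit (lorK C 4).
  by rewrite /N -mxrank_tr trmx_mul mxrankMfree ?mxrank_tr// row_free_unit unitmx_tr.
have MK : (M^T <= kermx N)%MS by apply/sub_kermxP; rewrite mulmxA.
have cK : (c^T <= kermx N)%MS by apply/sub_kermxP; rewrite /N mulmxA; exact: cM.
have KM : (kermx N <= M^T)%MS.
  have /mxrank_leqif_sup h := MK.
  by rewrite -(h.2) mxrank_tr rM mxrank_ker rN.
have /submxP[s ->] := submx_trans cK KM.
have -> : s *m M^T *m lor C 4 *m d = s *m (d^T *m lor C 4 *m M)^T.
  by rewrite !trmx_mul lorT trmxK !mulmxA.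
by rewrite dM trmx0 mulmx0.
Qed.

Lemma perp_rank2 (F dF : 'M[C]_(4 + n)) (X Z : 'cV[C]_(4 + n)) (B := ursubmx (invmx F *m dF)) :
  SO1 C (4 + n) F -> \rank B = 2%N -> B^T *m lor C 4 *m B = 0 ->
  (F *m Kb)^T *m J *m X = 0 -> X^T *m J *m (dF *m Kb) = 0 ->
  (F *m Kb)^T *m J *m Z = 0 -> Z^T *m J *m (dF *m Kb) = 0 ->
  X^T *m J *m Z = 0.
Proof.
move=> hF rB BB X0 X1 Z0 Z1.
have [c [cE cB]] := perp_coordinates dF hF X0.
have [d [dE dB]] := perp_coordinates dF hF Z0.
have := isotropic_kernel rB BB (etrans cB X1) (etrans dB Z1).
have [FJF _] := hF.
have -> : X^T *m J *m Z = (col_mx c 0 : 'cV[C]_(4 + n))^T *m J *m (col_mx d 0).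
  by rewrite cE dE trmx_mul -[in RHS]FJF !mulmxA.
rewrite (lor_block C n) tr_col_mx mul_row_block mul_row_col.
by rewrite !(trmx0, mul0mx, mulmx0, addr0, add0r).
Qed.

End lorentz.

Section gauss.
Variables (R : realType) (n : nat).
Notation V := (R * R)%type.
Notation C := R[i].
Notation Kb := (normal_mx R n).
Notation J := (lor C (4 + n)).

Lemma derivable_expR_comp (h : V -> R) x w : derivable h x w ->
  derivable (fun y => expR (h y)) x w.
Proof.
move=> hd; apply/derivable1P; have /derivable1P/derivable1_diffP hd' := hd.
have /derivable1_diffP ed := @derivable_expR R (h (0 *: w + x)).
apply/derivable1_diffP.
exact: (differentiable_comp hd' ed).
Qed.

Lemma pd_complexify m p w (f : V -> 'M[R]_(m, p)) x :
  pd_cmx w (complexify f) x = map_mx (real_complex R) (pd_mx w f x).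
Proof.
apply/matrixP => i j; rewrite !mxE.
rewrite (_ : (fun y => complex.Re _) = fun y => f y i j); last first.
  by apply/funext => y; rewrite !mxE.
rewrite (_ : (fun y => complex.Im _) = cst 0); last first.
  by apply/funext => y; rewrite !mxE.
by rewrite derive_cst.
Qed.

Lemma light_lift_derivable rho (y : V -> 'cV[R]_(3 + n)) x w :
  derivable rho x w -> (forall i j, derivable (fun z => y z i j) x w) ->
  forall i j, derivable (fun z => light_lift rho y z i j) x w.
Proof.
move=> rd yd i j.
rewrite (_ : (fun z => _) = (fun z => expR (- rho z)) *
   (fun z => (col_mx 1%:M (y z) : 'cV[R]_(1 + (3 + n))) i j)); last first.
  by apply/funext => z; rewrite /light_lift mxE.
apply: derivableM; first by apply: derivable_expR_comp; exact: derivableN.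
case: (@split_ordP 1 (3 + n) i) => k ->.
  rewrite (_ : (fun z => _) = cst (1%:M k j)); first exact: derivable_cst.
  by apply/funext => z; rewrite col_mxEu.
rewrite (_ : (fun z => _) = (fun z => y z k j)); first exact: yd.
by apply/funext => z; rewrite col_mxEd.
Qed.

(** g and F differ by a block diagonal matrix, so the first four columns of g are combinations of
    those of F, which are orthogonal to the remaining columns of F. *)
Lemma gauss_frame_perp (F g : 'M[R]_(4 + n)) (P : 'M[R]_4) :
  SO1 R (4 + n) F -> cosetK F = cosetK g ->
  (F *m col_mx 0 1%:M)^T *m lor R (4 + n) *m (lsubmx g *m P) = 0.
Proof.
move=> [FJF _] Fg.
have gg : cosetK g g.
  exists 1%:M; last by rewrite mulmx1.
  exists 1%:M, 1%:M; split; last by rewrite -scalar_mx_block.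
    apply: connected_component_refl; exact: SO1_1.
  by split; rewrite ?det1// trmx1 mul1mx.
move: gg; rewrite -Fg => -[k [A1 [A2 [_ _ ->]] <-]].
have -> : lsubmx (F *m block_mx A1 0 0 A2) = F *m col_mx A1 0.
  have -> : block_mx A1 0 0 A2 = row_mx (col_mx A1 0) (col_mx 0 A2) by rewrite -block_mxEh.
  by rewrite mul_mx_row row_mxKl.
rewrite trmx_mul -!mulmxA (mulmxA (lor R (4 + n))) (mulmxA F^T) (mulmxA F^T) FJF.
rewrite (lor_block R n) tr_col_mx (mul_col_mx A1 0 P) mul_block_col mul_row_col.
by rewrite !(trmx0, trmx1, mul0mx, mulmx0, addr0, add0r, mulmx1, mul1mx).
Qed.

Lemma mul_row4_eq0 m p (N : 'M[R]_(m, p)) (X1 X2 X3 X4 : 'cV[R]_p) :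
  N *m (row_mx X1 (row_mx X2 (row_mx X3 X4)) : 'M[R]_(p, 1 + (1 + (1 + 1)))) = 0 ->
  [/\ N *m X1 = 0, N *m X3 = 0 & N *m X4 = 0].
Proof.
by rewrite !mul_mx_row -!row_mx0 => /eq_row_mx[h1 /eq_row_mx[_ /eq_row_mx[h2 h3]]].
Qed.

Lemma mulmx_lincomb0 m p q (N : 'M[C]_(m, p)) (A1 A2 : 'M[C]_(p, q)) (a b : C) :
  N *m A1 = 0 -> N *m A2 = 0 -> N *m (a *: (A1 - b *: A2)) = 0.
Proof.
by move=> h1 h2; rewrite -scalemxAr mulmxBr -scalemxAr h1 h2 scaler0 subr0 scaler0.
Qed.

(** Y is orthogonal to the normal columns of every lift. Differentiating this relation, the product
    of Y with their derivative is minus the product of dY with them, which vanishes since Y_u and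
    Y_v also lie in the subspace. *)
Lemma gauss_map_perp D O (y : option R[i] -> 'cV[R]_(3 + n)) FF (c : bool) :
  smooth_sphere_map D O y -> conformal_Gauss_map D O y FF ->
  exists rho : V -> R, forall U F, local_lift D FF c U F -> forall x,
  (\forall z \near x, U z /\ chart_set D O c z) ->
  let Y := complexify (light_lift rho (in_chart y c)) in
  (complexify F x *m Kb)^T *m J *m Y x = 0 /\
  (Y x)^T *m J *m (d_z (complexify F) x *m Kb) = 0.
Proof.
move=> ys /(_ c)[rho [rs HG]]; exists rho => U F [Uo UD Fs FG] x Ux Y.
have [ysc _] := ys c.
have [Ux0 Ox0] := nbhs_singleton Ux.
pose L := light_lift rho (in_chart y c).
have perp z : U z -> chart_set D O c z ->
    let N := (F z *m col_mx 0 1%:M)^T *m lor R (4 + n) in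
    [/\ N *m L z = 0, N *m pd_mx (dir_u R) L z = 0 & N *m pd_mx (dir_v R) L z = 0].
  move=> Uz Oz N; have [Fz FFz] := FG z Uz.
  have FS : SO1 R (4 + n) (F z) by exact: (connected_component_sub Fz).
  have [g [P [_ gE _ PE]]] := HG z Oz.
  have := gauss_frame_perp P FS (etrans (esym FFz) gE).
  rewrite -PE -/N -/L; exact: mul_row4_eq0.
have cplxK : Kb = map_mx (real_complex R) (col_mx 0 1%:M).
  by rewrite map_col_mx map_mx0 map_mx1.
have cplxJ : J = map_mx (real_complex R) (lor R (4 + n)).
  apply/matrixP => i j; rewrite !mxE rmorphMn/=; congr (_ *+ _).
  by case: ifP => _; rewrite ?rmorphN rmorph1.
have perpC z (M : 'cV[R]_(4 + n)) : (F z *m col_mx 0 1%:M)^T *m lor R (4 + n) *m M = 0 ->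
    (complexify F z *m Kb)^T *m J *m map_mx (real_complex R) M = 0.
  move=> h; rewrite cplxK cplxJ -map_mxM.
  have -> (A : 'M[R]_(4 + n, n)) : (map_mx (real_complex R) A)^T = map_mx (real_complex R) A^T.
    by apply/matrixP => i j; rewrite !mxE.
  by rewrite -!map_mxM h map_mx0.
have Yperp z : U z -> chart_set D O c z -> (complexify F z *m Kb)^T *m J *m Y z = 0.
  by move=> Uz Oz; have [h _ _] := perp z Uz Oz; exact: perpC h.
split; first exact: Yperp.
have Ld i j : derivable (fun z => L z i j) x (dir_u R) /\ derivable (fun z => L z i j) x (dir_v R).
  by split; apply: light_lift_derivable => [|k l];
    [exact: smooth_derivable rs Ox0|exact: smooth_derivable (ysc k l) Ox0|
     exact: smooth_derivable rs Ox0|exact: smooth_derivable (ysc k l) Ox0].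
have Fd i j : derivable (fun y => F y i j) x (dir_u R) /\ derivable (fun y => F y i j) x (dir_v R).
  by split; exact: smooth_derivable (Fs i j) Ux0.
have YW := complexify_is_W Ld; have FW := complexify_is_W Fd.
have h1 := is_WM (is_WMr J (is_WT YW)) (is_WMr Kb FW).
have h2 : is_W (fun z => (complexify L z)^T *m J *m (complexify F z *m Kb)) x 0 0.
  apply: is_W_near (is_W_cst 0 x); apply: filterS Ux => z [Uz Oz].
  have := congr1 trmx (Yperp z Uz Oz).
  by rewrite !trmx_mul !trmxK lorT trmx0 !mulmxA.
have [h3 _] := is_W_uniq h1 h2.
have [_ Nu Nv] := perp x Ux0 Ox0.
have hz : (d_z (complexify L) x)^T *m J *m (complexify F x *m Kb) = 0.
  have : (complexify F x *m Kb)^T *m J *m d_z (complexify L) x = 0.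
    rewrite /d_z !pd_complexify; exact: (mulmx_lincomb0 _ _ (perpC x _ Nu) (perpC x _ Nv)).
  by move=> /(congr1 trmx); rewrite !trmx_mul !trmxK lorT trmx0 !mulmxA.
by move: h3; rewrite hz add0r.
Qed.

Lemma null_vecE (k : 'I_(4 + n)) :
  null_vec R n k ord0 = if k == 0%N :> nat then 1 else if k == 1%N :> nat then -1 else 0.
Proof.
rewrite !mxE; case: split_ordP => l ->; rewrite !mxE/=.
  by case: l => [[|[|[|[|//]]]] ?].
by [].
Qed.

Lemma lorE (k : 'I_(4 + n)) (X : 'rV[C]_(4 + n)) :
  (X *m J) ord0 k = X ord0 k * (if k == 0%N :> nat then -1 else 1).
Proof. by rewrite /lor mul_mx_diag !mxE. Qed.

(** The product of Y and e is -exp(-rho) * (1 + y_0), where y_0 is the first coordinate of y. *)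
Lemma null_vec_dot (rho : V -> R) (y : V -> 'cV[R]_(3 + n)) x :
  (complexify (light_lift rho y) x)^T *m J *m null_vec R n = 0 ->
  y x (lshift n (ord0 : 'I_3)) ord0 = -1.
Proof.
move=> /matrixP/(_ ord0 ord0); rewrite mxE.
pose k0 : 'I_(4 + n) := lshift n (ord0 : 'I_4).
pose k1 : 'I_(4 + n) := lshift n (Ordinal (isT : (1 < 4)%N)).
rewrite (bigD1 k0)//= (bigD1 k1)//= big1 ?addr0; last first.
  move=> k /andP[kk0 kk1]; rewrite null_vecE.
  have [h|_] := eqVneq (k : nat) 0%N; first by case/eqP: kk0; exact: val_inj.
  have [h|_] := eqVneq (k : nat) 1%N; first by case/eqP: kk1; exact: val_inj.
  by rewrite mulr0.
have e0 : (complexify (light_lift rho y) x)^T ord0 k0 = (expR (- rho x))%:C.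
  have -> : k0 = @lshift 1 (3 + n) ord0 by exact: val_inj.
  rewrite mxE [LHS]mxE /light_lift [X in X%:C]mxE col_mxEu mxE eqxx.
  by rewrite mulr1.
have e1 : (complexify (light_lift rho y) x)^T ord0 k1 =
    (expR (- rho x) * y x (lshift n (ord0 : 'I_3)) ord0)%:C.
  have -> : k1 = @rshift 1 (3 + n) (lshift n (ord0 : 'I_3)) by exact: val_inj.
  by rewrite mxE [LHS]mxE /light_lift [X in X%:C]mxE col_mxEd.
rewrite !lorE !null_vecE/= e0 e1 mxE.
set a := y x _ _; have r0 := expR_gt0 (- rho x).
set r := expR _ in r0 *.
have -> : r%:C * -1 * 1 + (r * a)%:C * 1 * -1 = (- (r * (1 + a)))%:C.
  by rewrite rmorphN !rmorphM rmorphD/= rmorph1; ring.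
move=> /(congr1 (@complex.Re R)) /= /eqP; rewrite oppr_eq0 mulf_eq0 gt_eqF//=.
by rewrite addrC addr_eq0 => /eqP.
Qed.

Lemma null_gauss_map_false D O (y : option R[i] -> 'cV[R]_(3 + n)) (c : bool)
    (rho : V -> R) (U : set V) x0 :
  smooth_sphere_map D O y -> conformal_immersion D O y -> open U ->
  U x0 -> U `<=` chart_set D O c ->
  (forall x, U x -> (complexify (light_lift rho (in_chart y c)) x)^T *m J *m null_vec R n = 0) ->
  False.
Proof.
move=> ys yc Uo Ux0 UO Unull.
pose k0 : 'I_(3 + n) := lshift n (ord0 : 'I_3).
have yE x : U x -> in_chart y c x = \col_k (if k == k0 then -1 else 0).
  move=> Ux; have y0 := null_vec_dot (Unull x Ux).
  have [_ /(_ x (UO x Ux))] := ys c; rewrite /dot mxE.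
  move: y0; move: (in_chart y c x) => v v0.
  (* As y_0 = -1 and y is a unit vector, the squares of the other coordinates sum to 0. *)
  rewrite (bigD1 k0)//= mxE v0 mulrNN mulr1.
  move=> /eqP; rewrite -subr_eq0 addrAC subrr add0r psumr_eq0; last first.
    by move=> k _; rewrite mxE -expr2 sqr_ge0.
  move=> /allP h; apply/matrixP => k j; rewrite ord1 mxE.
  have [->//|kk0] := eqVneq k k0.
  have := h k (mem_index_enum k); rewrite kk0/= mxE -expr2 sqrf_eq0 => /eqP.
  exact.
have [yu _ _] := yc c x0 (UO x0 Ux0); move: yu.
have -> : pd_mx (dir_u R) (in_chart y c) x0 = 0.
  apply/matrixP => i j; rewrite !mxE.
  rewrite (@near_eq_derive _ _ _ _ (cst ((\col_k (if k == k0 then -1 else 0) : 'cV[R]_(3 + n)) i j))).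
    by rewrite derive_cst.
  move: (Uo); rewrite openE => /(_ x0 Ux0); apply: filterS => x Ux.
  by rewrite yE.
by rewrite /dot mulmx0 mxE ltxx.
Qed.

End gauss.

(** * Potentials of rank 2 *)

Section rank.
Variables (R : realType) (n : nat) (f1 f3 : 'I_n -> option R[i] -> R[i]).
Notation V := (R * R)%type.
Notation C := R[i].

(** The 2 by 2 minors of [coefX]. Since [nullW] has a left inverse, they detect the points where the
    rank is 2. *)
Definition minor (i j : 'I_n) (p : option C) : C := f1 i p * f3 j p - f1 j p * f3 i p.

Lemma special_rank_le2 p : (\rank (special_B f1 f3 p) <= 2)%N.
Proof. by rewrite special_BE; exact: mulmx_max_rank. Qed.

Lemma minor_rank i j p : minor i j p != 0 -> \rank (special_B f1 f3 p) = 2%N.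
Proof.
move=> m0; apply/eqP; rewrite eqn_leq special_rank_le2/=.
(* [L] extracts rows 0 and 2, the rows of f1 and f3, and [S] extracts columns i and j; [N] is the
   adjugate of the resulting block [M]. *)
pose L : 'M[C]_(2, 4) := \matrix_(a, b) if (b == (a * 2)%N :> nat) then 1 else 0.
pose S : 'M[C]_(n, 2) := \matrix_(b, a) if b == (if a == 0%N :> nat then i else j) then 1 else 0.
pose N : 'M[C]_2 := \matrix_(a, b) (if a == b then
    (if a == 0%N :> nat then f3 j p else f1 i p)
  else (if a == 0%N :> nat then - f1 j p else - f3 i p)).
pose M : 'M[C]_2 := \matrix_(a, b)
  (if a == 0%N :> nat then f1 else f3) (if b == 0%N :> nat then i else j) p.
have LBS : L *m special_B f1 f3 p *m S = M.
  have LB : L *m special_B f1 f3 p = coefX f1 f3 p.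
    rewrite special_BE mulmxA; have -> : L *m nullW R = 1%:M.
      apply/matrixP => a b; rewrite !mxE !big_ord_recl big_ord0 !mxE/=.
      by case: a => [[|[|//]] ?]; case: b => [[|[|//]] ?] /=;
        rewrite ?mulr0 ?mul0r ?mulr1 ?addr0 ?add0r.
    by rewrite mul1mx.
  rewrite LB; apply/matrixP => a b; rewrite !mxE.
  rewrite (bigD1 (if b == 0%N :> nat then i else j))//= !mxE eqxx mulr1 big1 ?addr0.
    by case: ifP.
  by move=> k kn; rewrite !mxE (negbTE kn) mulr0.
have MN : M *m N = (minor i j p)%:M.
  apply/matrixP => a b; rewrite !mxE !big_ord_recl big_ord0 !mxE/= /minor addr0.
  by case: a => [[|[|//]] ?]; case: b => [[|[|//]] ?]; rewrite /= -?val_eqE/= ?mulr1n ?mulr0n; ring.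
have Mu : M \in unitmx.
  rewrite unitmxE unitfE; apply/negP => /eqP M0.
  have := congr1 determinant MN; rewrite det_mulmx M0 mul0r det_scalar => /esym/eqP.
  by rewrite expf_eq0 (negbTE m0).
rewrite -[X in (X <= _)%N](mxrank_unit Mu) -LBS.
exact: leq_trans (mxrankM_maxl _ _) (mxrankM_maxr _ _).
Qed.

Lemma rank2_minor p : \rank (special_B f1 f3 p) = 2%N -> exists i j, minor i j p != 0.
Proof.
move=> rB; apply: contrapT => no.
have m0 i j : minor i j p = 0 by apply/eqP/negPn/negP => ij; apply: no; exists i, j.
suff [v [w vw]] : exists (v : 'cV[C]_2) (w : 'rV[C]_n), coefX f1 f3 p = v *m w.
  have : (\rank (special_B f1 f3 p) <= 1)%N.
    by rewrite special_BE vw mulmxA; exact: mulmx_max_rank.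
  by rewrite rB.
have [[i fi]|f0] := pselect (exists i, f1 i p != 0).
  exists (\col_k if k == 0%N :> nat then 1 else f3 i p / f1 i p), (\row_j f1 j p).
  apply/matrixP => k j; rewrite !mxE big_ord1 !mxE; case: ifP => _; first by rewrite mul1r.
  have /eqP := m0 i j; rewrite subr_eq0 => /eqP e.
  by apply: (mulfI fi); rewrite e; field.
exists (\col_k if k == 0%N :> nat then 0 else 1), (\row_j f3 j p).
apply/matrixP => k j; rewrite !mxE big_ord1 !mxE; case: ifP => _; rewrite ?mul1r ?mul0r//.
by apply/eqP/negPn/negP => fj; apply: f0; exists j.
Qed.

Lemma max_rank_minor D :
  (forall j, meromorphic_on D (f1 j)) -> (forall j, meromorphic_on D (f3 j)) ->
  max_rank D (special_B f1 f3) 2%N ->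
  exists i j, (forall c z, chart_dom D c z -> laurent (fun w => minor i j (chart c w)) z) /\
    ~ punctured0 (fun w => minor i j (Some w)) 0.
Proof.
move=> h1 h3 [_ [c [z [[Dz reg] /rank2_minor[i [j mij]]]]]].
have ml c' z' : chart_dom D c' z' -> laurent (fun w => minor i j (chart c' w)) z'.
  move=> Dz'; apply: laurentB; apply: laurentM; apply: meromorphic_laurent.
  - exact: h1.
  - exact: h3.
  - exact: h1.
  - exact: h3.
exists i, j; split=> // m0; move/eqP: mij; apply.
apply: (@meromorphic_identity R D (minor i j) ml m0) => //.
(* Rows 0 and 2 of the potential are f1 and f3, so that its regularity at z makes the minor
   continuous there. *)
have k1 k : {for z, continuous (fun w => f1 k (chart c w))}.
  apply: derivable_continuous; have /nbhs_singleton := reg (Ordinal (isT : (0 < 4)%N)) k.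
  by rewrite (_ : (fun w => _) = (fun w => f1 k (chart c w)))//; apply/funext => w; rewrite mxE.
have k3 k : {for z, continuous (fun w => f3 k (chart c w))}.
  apply: derivable_continuous; have /nbhs_singleton := reg (Ordinal (isT : (2 < 4)%N)) k.
  by rewrite (_ : (fun w => _) = (fun w => f3 k (chart c w)))//; apply/funext => w; rewrite mxE.
exact: (cvgB (cvgM (k1 i) (k3 j)) (cvgM (k1 j) (k3 i))).
Qed.

End rank.

(** The ball is centred at a point w != 0 and avoids 0, where f may have a pole. Its radius e / 2
    comes from bounding the modulus by |Re| + |Im|. *)
Lemma laurent_nonzero_ball (R : realType) (f : R[i] -> R[i]) (r : R) : 0 < r ->
  laurent f 0 -> ~ punctured0 f 0 ->
  exists (x0 : R * R) (d : R), 0 < d /\ forall x, ball x0 d x -> ball 0 r x /\ f (cplx x) != 0.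
Proof.
move=> r0 [m [g [/nearC[d1 d10 gd] /nearC[d2 d20 fg]]]] f0.
pose d := Num.min r (Num.min d1 d2).
have d0 : 0 < d by rewrite /d !lt_min r0 d10.
have [w [wd w0 fw]] : exists w, [/\ cabs w < d, w != 0 & f w != 0].
  apply: contrapT => no; apply: f0; apply/nearC; exists d => // w; rewrite subr0 => wd w0.
  by apply/eqP/negPn/negP => fw; apply: no; exists w.
have dr : d <= r by rewrite /d ge_min lexx.
have dd1 : d <= d1 by rewrite /d !ge_min lexx !orbT.
have dd2 : d <= d2 by rewrite /d !ge_min lexx !orbT.
have fE v : cabs v < d -> v != 0 -> f v = g v / v ^+ m.
  move=> vd v0; rewrite -[X in X ^+ m]subr0; apply: fg => //.
  by rewrite subr0; exact: lt_le_trans vd dd2.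
have gw : g w != 0 by move: fw; rewrite fE// mulf_eq0 negb_or => /andP[].
have gc : {for w, continuous g}.
  by apply: derivable_continuous; apply: gd; rewrite subr0; exact: lt_le_trans wd dd1.
have /nearC[e1 e10 e1P] : \forall v \near w, g v != 0.
  have := gc; move=> /cvgrPdist_lt/(_ `|g w|); rewrite normr_gt0 => /(_ gw).
  by apply: filterS => v; apply: contraTneq => ->; rewrite subr0 ltxx.
have cw : 0 < d - cabs w by rewrite subr_gt0.
have cw0 : 0 < cabs w by rewrite cabs_gt0.
pose e := Num.min e1 (Num.min (cabs w) (d - cabs w)).
have e0 : 0 < e by rewrite /e !lt_min e10 cw0.
have [ee1 ew ed] : [/\ e <= e1, e <= cabs w & e <= d - cabs w].
  by rewrite /e !ge_min !lexx !orbT.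
exists (complex.Re w, complex.Im w), (e / 2); split; first by rewrite divr_gt0.
move=> x /ball_plane[/= h1 h2].
have vw : cabs (cplx x - w) < e.
  apply: le_lt_trans (cabs_le _) _.
  have -> : complex.Re (cplx x - w) = x.1 - complex.Re w by case: w {wd w0 fw gw gc e1P cw cw0 e e0 ee1 ew ed h1 h2}.
  have -> : complex.Im (cplx x - w) = x.2 - complex.Im w by case: w {wd w0 fw gw gc e1P cw cw0 e e0 ee1 ew ed h1 h2}.
  lra.
have vd : cabs (cplx x) < d.
  have := cabsD (cplx x - w) w; rewrite subrK => h; lra.
have v0 : cplx x != 0.
  by apply/eqP => x0; move: vw; rewrite x0 sub0r cabsN ltNge ew.
split.
  have hr := cabs_ge_Re (cplx x); have hi := cabs_ge_Im (cplx x).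
  by apply/ball_plane; rewrite !subr0; split; [exact: le_lt_trans hr (lt_le_trans vd dr)|
    exact: le_lt_trans hi (lt_le_trans vd dr)].
by rewrite fE// mulf_neq0// ?invr_eq0 ?expf_neq0//; apply: e1P; exact: lt_le_trans vw ee1.
Qed.

Lemma rank2_not_gauss_map (R : realType) (n : nat) (D : surface)
    (FF : option R[i] -> set 'M[R]_(4 + n)) (f1 f3 : 'I_n -> option R[i] -> R[i])
    (y : option R[i] -> 'cV[R]_(3 + n)) :
  strongly_conformally_harmonic D FF ->
  (forall j, meromorphic_on D (f1 j)) -> (forall j, meromorphic_on D (f3 j)) ->
  normalized_potential D FF (special_B f1 f3) -> max_rank D (special_B f1 f3) 2%N ->
  willmore_surface D y -> conformal_Gauss_map D setT y FF -> False.
Proof.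
move=> [_ sc] h1 h3 np mr [ys yc _] GM.
have [i [j [ml m0]]] := max_rank_minor h1 h3 mr.
have [U [F [E [Em [Ep [r [FL r0 rU bx]]]]]]] := normalized_birkhoff np.
have D0 : chart_dom D false (0 : R[i]) by case: (D) => //=; rewrite normr0 ltr01.
have [x0 [d [d0 dP]]] := laurent_nonzero_ball r0 (ml false 0 D0) m0.
have [rho GP] := gauss_map_perp false ys GM.
have [Uo UD _ _] := FL.
have bo (a : R * R) (e : R) x : ball a e x -> \forall z \near x, ball a e z.
  have : open (ball a e) by exact: ball_open.
  by rewrite openE => h /h.
apply: (@null_gauss_map_false R n D setT y false (rho) (ball x0 d) x0 ys yc).
- exact: ball_open.
- exact: ballxx.
- by move=> x /dP[/rU/UD].
move=> x xd; have [xr mx] := dP x xd; have b := bx x xr.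
have [g1 g2] : let Y := complexify (light_lift rho (in_chart y false)) in
    (complexify F x *m normal_mx R n)^T *m lor R[i] (4 + n) *m Y x = 0 /\
    (Y x)^T *m lor R[i] (4 + n) *m (d_z (complexify F) x *m normal_mx R n) = 0.
  apply: (GP U F FL x); apply: filterS (bo _ _ x xr) => z zr.
  by split; [exact: rU|exact/UD/rU].
have rB := minor_rank (mx : minor f1 f3 i j (Some (cplx x)) != 0).
have rk : \rank (B1 F x) = 2%N.
  have [k1 [k2 [u1 u2 e]]] := B1_gauge bx xr.
  have e1 : \rank (k1 *m B1 F x) = \rank (B1 F x).
    by rewrite -[LHS]mxrank_tr trmx_mul mxrankMfree ?mxrank_tr// row_free_unit unitmx_tr.
  by rewrite -e1 e mxrankMfree ?rB// row_free_unit.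
have FW := complexify_is_W (bFd b).
have n0 := null_vector_in_lift bx xr.
have n1 : (null_vec R n)^T *m lor R[i] (4 + n) *m (d_z (complexify F) x *m normal_mx R n) = 0.
  have h : is_W (fun z => (null_vec R n)^T *m lor R[i] (4 + n) *m (complexify F z *m normal_mx R n)) x 0 0.
    apply: is_W_near (is_W_cst 0 x); apply: filterS (bo _ _ x xr) => z zr.
    have := congr1 trmx (null_vector_in_lift bx zr).
    by rewrite !trmx_mul !trmxK lorT trmx0 !mulmxA.
  have h' := is_WMl ((null_vec R n)^T *m lor R[i] (4 + n)) (is_WMr (normal_mx R n) FW).
  have [e1 _] := is_W_uniq h' h; exact: e1.
exact: (perp_rank2 (SO1_map (bF b)) rk (sc _ _ _ FL x (rU x xr)) g1 g2 n0 n1).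
Qed.

(** * Symmetry of the second derivatives *)

Section schwarz.
Variable R : realType.
Notation V := (R * R)%type.

Lemma double_difference (h hu huv : R -> R -> R) (a b d : R) : 0 < d ->
  (forall s t, a <= s <= a + d -> b <= t <= b + d ->
     is_derive s 1 (fun s => h s t) (hu s t) /\ is_derive t 1 (hu s) (huv s t)) ->
  exists s t, [/\ a <= s <= a + d, b <= t <= b + d &
    h (a + d) (b + d) - h (a + d) b - (h a (b + d) - h a b) = huv s t * d * d].
Proof.
move=> d0 hd; have ad : a < a + d by lra.
have bd : b < b + d by lra.
have b1 : b <= b <= b + d by lra.
have b2 : b <= b + d <= b + d by lra.
have D1 s : a <= s <= a + d ->
    is_derive s 1 (fun s => h s (b + d) - h s b) (hu s (b + d) - hu s b).
  by move=> hs; have [h1 _] := hd s _ hs b1; have [h2 _] := hd s _ hs b2; exact: is_deriveB.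
have [s sab sE] : exists2 s, s \in `]a, (a + d)[ &
    h (a + d) (b + d) - h (a + d) b - (h a (b + d) - h a b) =
    (hu s (b + d) - hu s b) * (a + d - a).
  apply: (MVT (f := fun s => h s (b + d) - h s b)) => // [x|].
    by rewrite in_itv/= => hx; apply: D1; lra.
  apply: derivable_within_continuous => x; rewrite in_itv/= => hx.
  by have [] := D1 x hx.
move: sab; rewrite in_itv/= => sab; have hs : a <= s <= a + d by lra.
have [t tab tE] : exists2 t, t \in `]b, (b + d)[ &
    hu s (b + d) - hu s b = huv s t * (b + d - b).
  apply: (MVT (f := hu s)) => // [x|].
    by rewrite in_itv/= => hx; have [] := hd s x hs _; first lra.
  apply: derivable_within_continuous => x; rewrite in_itv/= => hx.
  by have [_ []] := hd s x hs hx.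
move: tab; rewrite in_itv/= => tab; exists s, t; split=> //; first lra.
by rewrite sE tE; ring.
Qed.

Let dd_cancel (d a b c e A B : R) : 0 < d -> a - b - (c - e) = A * d * d ->
  a - c - (b - e) = B * d * d -> A = B.
Proof.
move=> d0 h1 h2; have dn : d != 0 by rewrite gt_eqF.
apply: (mulIf dn); apply: (mulIf dn); rewrite -h1 -h2; ring.
Qed.

Let split_lt (a b c d : R) : a = b -> 0 < `|c - d| -> `|c - a| < `|c - d| / 2 ->
  `|d - b| < `|c - d| / 2 -> False.
Proof.
move=> -> D0 h1 h2; have := ler_normB (c - b) (d - b).
have -> : c - b - (d - b) = c - d by ring.
lra.
Qed.

(** On a square of side d at x, the second difference of h is d^2 times either mixed derivative,
    each taken at some point of the square. By continuity at x the two derivatives cannot differ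
    there. *)
Lemma schwarz (U : set V) (h : V -> R) x : open U -> smooth U h -> U x ->
  'D_(dir_v R) (fun y => 'D_(dir_u R) h y) x = 'D_(dir_u R) (fun y => 'D_(dir_v R) h y) x.
Proof.
move=> Uo hs Ux; have [_ h1] := hs 2%N.
pose hu y := 'D_(dir_u R) h y; pose hv y := 'D_(dir_v R) h y.
pose huv y := 'D_(dir_v R) hu y; pose hvu y := 'D_(dir_u R) hv y.
have [du [_ h2u]] := h1 (dir_u R); have [dv [_ h2v]] := h1 (dir_v R).
have [duv [cuv _]] := h2u (dir_v R); have [dvu [cvu _]] := h2v (dir_u R).
apply/eqP; rewrite -subr_eq0; apply: contrapT => /negP; rewrite -normr_gt0.
rewrite -/(huv x) -/(hvu x); set D := `|_| => D0.
have D2 : 0 < D / 2 by lra.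
have n1 : \forall y \near x, `|huv x - huv y| < D / 2.
  by have /cvgrPdist_lt/(_ _ D2) := cuv x Ux.
have n2 : \forall y \near x, `|hvu x - hvu y| < D / 2.
  by have /cvgrPdist_lt/(_ _ D2) := cvu x Ux.
have n3 : \forall y \near x, U y by exact: open_nbhs_nbhs.
have /nbhs_ballP[r /= r0 rP] : nbhs x (fun y => U y /\ `|huv x - huv y| < D / 2 /\ `|hvu x - hvu y| < D / 2).
  by apply: filterI n3 _; exact: filterI n1 n2.
pose d := r / 2; have d0 : 0 < d by rewrite /d; lra.
have box s t : x.1 <= s <= x.1 + d -> x.2 <= t <= x.2 + d -> ball x r (s, t).
  move=> hs' ht; apply/ball_plane => /=.
  by split; rewrite ger0_norm; rewrite /d in hs' ht; lra.
have UD s t : x.1 <= s <= x.1 + d -> x.2 <= t <= x.2 + d -> U (s, t).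
  by move=> hs' ht; have [] := rP _ (box s t hs' ht).
have [s [t [hs1 ht1 e1]]] := @double_difference (fun s t => h (s, t)) (fun s t => hu (s, t))
  (fun s t => huv (s, t)) x.1 x.2 d d0 (fun s t hs' ht =>
    conj (slice_u (derivableP (du _ (UD s t hs' ht)))) (slice_v (derivableP (duv _ (UD s t hs' ht))))).
have [t' [s' [ht2 hs2 e2]]] := @double_difference (fun t s => h (s, t)) (fun t s => hv (s, t))
  (fun t s => hvu (s, t)) x.2 x.1 d d0 (fun t s ht hs' =>
    conj (slice_v (derivableP (dv _ (UD s t hs' ht)))) (slice_u (derivableP (dvu _ (UD s t hs' ht))))).
have [_ [a1 _]] := rP _ (box s t hs1 ht1); have [_ [_ a2]] := rP _ (box s' t' hs2 ht2).
have e3 : huv (s, t) = hvu (s', t').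
  exact: dd_cancel d0 e1 e2.
exact: split_lt e3 D0 a1 a2.
Qed.

End schwarz.

Section second_order.
Variable R : realType.
Notation V := (R * R)%type.

(* The mixed second derivatives of f are equal. *)
Definition is_W2 m p (f a b : V -> 'M[R[i]]_(m, p)) x := exists a1 q b2,
  [/\ \forall z \near x, is_W f z (a z) (b z), is_W a x a1 q & is_W b x q b2].

Lemma is_W2M m p q (f a b : V -> 'M[R[i]]_(m, p)) (g c d : V -> 'M[R[i]]_(p, q)) x :
  is_W2 f a b x -> is_W2 g c d x ->
  is_W2 (fun y => f y *m g y) (fun y => a y *m g y + f y *m c y)
    (fun y => b y *m g y + f y *m d y) x.
Proof.
move=> [a1 [r1 [b2 [nf aW bW]]]] [c1 [r2 [d2 [ng cW dW]]]].
have fx := nbhs_singleton nf; have gx := nbhs_singleton ng.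
have h1 := is_WD (is_WM aW gx) (is_WM fx cW).
have h2 := is_WD (is_WM bW gx) (is_WM fx dW).
do 3!eexists; split; [|exact: h1|].
  by near=> y; apply: is_WM; [apply: (near nf y)|apply: (near ng y)].
rewrite (addrACA (r1 *m g x)) in h2; exact: h2.
Unshelve. all: by end_near. Qed.

Lemma d_zC m p (f : V -> 'M[R]_(m, p)) x : d_z (complexify f) x =
  2^-1 *: (complexify (pd_mx (dir_u R) f) x - 'i *: complexify (pd_mx (dir_v R) f) x).
Proof. by rewrite /d_z !pd_complexify. Qed.

Lemma d_zbarC m p (f : V -> 'M[R]_(m, p)) x : d_zbar (complexify f) x =
  2^-1 *: (complexify (pd_mx (dir_u R) f) x + 'i *: complexify (pd_mx (dir_v R) f) x).
Proof. by rewrite /d_zbar !pd_complexify. Qed.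

Let wirtinger_swap m p (A B C : 'M[R[i]]_(m, p)) :
  2^-1 *: (A + 'i *: B) - 'i *: (2^-1 *: (B + 'i *: C)) =
  2^-1 *: (A - 'i *: B) + 'i *: (2^-1 *: (B - 'i *: C)).
Proof.
have ii := @ii1 R; apply/matrixP => i j; rewrite !mxE.
move: (A i j) (B i j) (C i j) ii; move: ('i : R[i]) => I a b c ii.
have -> : I * (2^-1 * (b + I * c)) = 2^-1 * (I * b + I * I * c) by ring.
have -> : I * (2^-1 * (b - I * c)) = 2^-1 * (I * b - I * I * c) by ring.
by rewrite ii; field.
Qed.

(** Applied to the partial derivatives f_u and f_v of one map, this is the equality of its two mixed
    Wirtinger derivatives. *)
Lemma d_zbar_conjugate m p (f g : V -> 'M[R]_(m, p)) x :
  pd_mx (dir_v R) f x = pd_mx (dir_u R) g x ->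
  d_zbar (complexify f) x - 'i *: d_zbar (complexify g) x =
    d_z (complexify f) x + 'i *: d_z (complexify g) x.
Proof.
rewrite !d_zC !d_zbarC => e; rewrite /complexify e; exact: wirtinger_swap.
Qed.

Let mixed m p (f : V -> 'M[R]_(m, p)) U x : open U -> smooth_mx U f -> U x ->
  pd_mx (dir_v R) (pd_mx (dir_u R) f) x = pd_mx (dir_u R) (pd_mx (dir_v R) f) x.
Proof.
move=> Uo fs Ux; apply/matrixP => i j; rewrite [LHS]mxE [RHS]mxE.
have E w : (fun y => pd_mx w f y i j) = (fun y => 'D_w (fun z => f z i j) y).
  by apply/funext => y; rewrite mxE.
by rewrite !E; exact: schwarz Uo (fs i j) Ux.
Qed.

Lemma smooth_is_W2 m p (f : V -> 'M[R]_(m, p)) U x : open U -> smooth_mx U f -> U x ->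
  is_W2 (complexify f) (d_z (complexify f)) (d_zbar (complexify f)) x.
Proof.
move=> Uo fs Ux.
have fW y : U y -> is_W (complexify f) y (d_z (complexify f) y) (d_zbar (complexify f) y).
  by move=> Uy; apply: complexify_is_W => i j; split; exact: smooth_derivable (fs i j) Uy.
have pW w : is_W (complexify (pd_mx w f)) x (d_z (complexify (pd_mx w f)) x)
    (d_zbar (complexify (pd_mx w f)) x).
  apply: complexify_is_W => i j; have [_ /(_ w)[_ [_ h]]] := fs i j 2%N.
  rewrite (_ : (fun y => _) = (fun y => 'D_w (fun z => f z i j) y)); last first.
    by apply/funext => y; rewrite mxE.
  by have [hu _] := h (dir_u R); have [hv _] := h (dir_v R); split; [exact: hu|exact: hv].
set P := complexify (pd_mx (dir_u R) f); set Q := complexify (pd_mx (dir_v R) f).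
have aE : d_z (complexify f) = (fun y => 2^-1 *: (P y - 'i *: Q y)).
  by apply/funext => y; rewrite d_zC.
have bE : d_zbar (complexify f) = (fun y => 2^-1 *: (P y + 'i *: Q y)).
  by apply/funext => y; rewrite d_zbarC.
have hP := pW (dir_u R); have hQ := pW (dir_v R).
exists (2^-1 *: (d_z P x - 'i *: d_z Q x)), (2^-1 *: (d_zbar P x - 'i *: d_zbar Q x)),
  (2^-1 *: (d_zbar P x + 'i *: d_zbar Q x)); split.
- by move: Uo; rewrite openE => /(_ x Ux); apply: filterS.
- by rewrite aE; exact: is_WZ (is_WB hP (is_WZ 'i hQ)).
- rewrite bE; have -> : d_zbar P x - 'i *: d_zbar Q x = d_z P x + 'i *: d_z Q x.
    exact: (d_zbar_conjugate (mixed Uo fs Ux)).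
  exact: is_WZ (is_WD hP (is_WZ 'i hQ)).
Qed.

End second_order.

(** * A harmonic map with constant null vector *)

Section null_rotation.
Variables (T : comNzRingType).

Definition null4 : 'M[T]_(4, 1) := \matrix_(i, j) nth 0 [:: 1; -1; 0; 0] i.

(** An infinitesimal null rotation: it lies in so(1, 4) by [nilp_skew], and its cube is zero, so
    that its exponential is the quadratic polynomial [nexp]. *)
Definition nilp : 'M[T]_(4 + 1) := block_mx 0 null4 (- (null4^T *m lor T 4)) 0.

Lemma null4_isotropic : null4^T *m lor T 4 *m null4 = 0.
Proof.
apply/matrixP => i j; rewrite /lor mul_mx_diag !mxE !big_ord_recl big_ord0 !mxE/=.
ring.
Qed.

Lemma nilp_null4 : nilp *m (col_mx null4 0 : 'M[T]_(4 + 1, 1)) = 0.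
Proof.
rewrite /nilp mul_block_col !mul0mx mulmx0 !addr0 mulNmx null4_isotropic oppr0.
by rewrite col_mx0.
Qed.

Lemma nilp3 : nilp *m nilp *m nilp = 0.
Proof.
rewrite /nilp !mulmx_block !(mulmx0, mul0mx, addr0, add0r) !mulNmx null4_isotropic.
by rewrite -mulmxA mulNmx null4_isotropic !(oppr0, mul0mx, mulmx0) block_mx0.
Qed.

Lemma nilp_skew : nilp^T *m lor T (4 + 1) = - (lor T (4 + 1) *m nilp).
Proof.
rewrite /nilp (lor_block T 1) tr_block_mx !mulmx_block opp_block_mx.
rewrite !(trmx0, mulmx0, mul0mx, addr0, add0r, mulmx1, mul1mx, oppr0, opprK).
by rewrite linearN/= trmx_mul trmxK lorT.
Qed.

End null_rotation.

Section nexp.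
Variable R : realType.
Notation N := (nilp R).
Notation V := (R * R)%type.

Definition nexp (t : R) : 'M[R]_(4 + 1) := 1%:M + t *: N + (t ^+ 2 / 2) *: (N *m N).

Lemma nexp0 : nexp 0 = 1%:M.
Proof. by rewrite /nexp expr0n mul0r !scale0r !addr0. Qed.

Lemma nexpD s t : nexp s *m nexp t = nexp (s + t).
Proof.
have n3 := nilp3 R; have n3' : N *m (N *m N) = 0 by rewrite mulmxA.
have n4 : N *m N *m (N *m N) = 0 by rewrite mulmxA n3 mul0mx.
have [M NN] : {M | N *m N = M} by exists (N *m N).
rewrite /nexp; rewrite !NN in n3 n3' n4 *.
rewrite !mulmxDl !mulmxDr -!scalemxAl -!scalemxAr !mul1mx !mulmx1 NN n3 n3' n4.
by apply/matrixP => i j; rewrite !mxE; field.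
Qed.

Lemma nexp_lor t : (nexp t)^T *m lor R (4 + 1) = lor R (4 + 1) *m nexp (- t).
Proof.
have -> : (nexp t)^T = 1%:M + t *: N^T + (t ^+ 2 / 2) *: (N^T *m N^T).
  by rewrite /nexp !linearD/= !linearZ/= trmx1 trmx_mul.
rewrite /nexp !mulmxDl !mulmxDr mul1mx mulmx1 -!scalemxAl -!scalemxAr.
rewrite -mulmxA nilp_skew mulmxN mulmxA nilp_skew mulNmx opprK.
by rewrite -mulmxA sqrrN scaleNr scalerN.
Qed.

Lemma nexp_SO1 t : SO1 R (4 + 1) (nexp t).
Proof.
have J s : (nexp s)^T *m lor R (4 + 1) *m nexp s = lor R (4 + 1).
  by rewrite nexp_lor -mulmxA nexpD addNr nexp0 mulmx1.
(* The determinant of [nexp t] is the square of that of [nexp (t / 2)], and a matrix preserving the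
   form has a determinant of square 1. *)
split=> //; have -> : t = t / 2 + t / 2 by field.
have := congr1 determinant (J (t / 2)); rewrite !det_mulmx det_tr mulrAC -nexpD det_mulmx.
move=> /(congr1 (fun x => x * \det (lor R (4 + 1)))).
have J1 : \det (lor R (4 + 1)) * \det (lor R (4 + 1)) = 1 by rewrite -det_mulmx lorK det1.
by rewrite -[X in X = _ -> _]mulrA J1 mulr1.
Qed.

Lemma nexp_continuous : continuous nexp.
Proof.
move=> t; apply: (@cvgD _ _ _ _ _ (fun t : R => 1%:M + t *: N)).
  by apply: cvgD; [exact: cvg_cst|apply: cvgZr_tmp; exact: cvg_id].
by apply: cvgZr_tmp; apply: cvgMl; apply: exprn_continuous.
Qed.

Lemma nexp_SO1plus t : SO1plus R (4 + 1) (nexp t).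
Proof.
exists (range nexp); last by exists t.
split; first by exists 0; rewrite ?nexp0.
  by move=> _ [s _ <-]; exact: nexp_SO1.
apply: connected_continuous_connected; last first.
  by apply: continuous_subspaceT; exact: nexp_continuous.
by apply/connected_intervalP => x y /= _ _ z _.
Qed.

Lemma quadratic_derive (a b c : R) (x v : V) :
  is_derive x v (fun x : V => a + b * x.1 + c * x.1 ^+ 2) (b * v.1 + (2 * c * v.1) * x.1).
Proof.
have D0 : is_derive x v (fst : V -> R) v.1.
  have h : (fun h : R => h^-1 *: (((fst : V -> R) \o shift x) (h *: v) - x.1)) @ 0^' --> v.1.
    apply: cvg_near_cst; near=> h.
    have h0 : h != 0 by near: h; exact: nbhs_dnbhs_neq.
    by rewrite /= addrK -[_ *: _]/(h^-1 * (h * v.1)) mulrA mulVf ?mul1r.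
  apply: DeriveDef; [exact: cvgP h|exact: cvg_lim h].
have h1 : is_derive x v (fun x : V => b * x.1) (b * v.1) by exact: (is_deriveZ b D0).
have h2 : is_derive x v (fun x : V => c * x.1 ^+ 2) (c * (x.1 * v.1 + x.1 * v.1)).
  exact: (is_deriveZ c (is_deriveM D0 D0)).
have h3 := is_deriveD (is_deriveD (is_derive_cst a x v) h1) h2.
by apply: (is_derive_eq h3); ring.
Unshelve. all: by end_near. Qed.

(** Induction on the order of differentiability: these polynomials are stable under directional
    derivatives. *)
Lemma quadratic_smooth (a b c : R) : smooth setT (fun x : V => a + b * x.1 + c * x.1 ^+ 2).
Proof.
have Q (a' b' c' : R) : continuous (fun x : V => a' + b' * x.1 + c' * x.1 ^+ 2).
  move=> x; apply: cvgD.
    by apply: cvgD; [exact: cvg_cst|apply: cvgMr; exact: cvg_fst].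
  apply: cvgMr; rewrite expr2; under eq_fun do rewrite expr2.
  by apply: cvgM; exact: cvg_fst.
move=> k; elim: k a b c => [|k IH] a b c; first by split=> // x _; exact: Q.
split=> [x _|v]; first exact: Q.
split=> [x _|]; first by have [] := quadratic_derive a b c x v.
rewrite [X in is_Ck _ _ X](_ : _ = (fun x : V => b * v.1 + (2 * c * v.1) * x.1 + 0 * x.1 ^+ 2)).
  exact: IH.
by apply/funext => x; rewrite (derive_val (is_derive := quadratic_derive a b c x v)) mul0r addr0.
Qed.

Lemma nexp_entry (e : R) (x : V) i j : nexp (e * x.1) i j =
  (1%:M : 'M[R]_(4 + 1)) i j + (e * N i j) * x.1 + (e ^+ 2 * (N *m N) i j / 2) * x.1 ^+ 2.
Proof.
rewrite /nexp; move: (N *m N) => M; move: N => N0.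
by rewrite !mxE; field.
Qed.

Lemma nexp_smooth (e : R) : smooth_mx setT (fun x : V => nexp (e * x.1)).
Proof.
move=> i j.
rewrite (_ : (fun x : V => _) = (fun x : V => (1%:M : 'M[R]_(4 + 1)) i j + (e * N i j) * x.1 +
  (e ^+ 2 * (N *m N) i j / 2) * x.1 ^+ 2)); first exact: quadratic_smooth.
by apply/funext => x; rewrite nexp_entry.
Qed.

Lemma nexp_pd (x w : V) : pd_mx w (fun x : V => nexp x.1) x = w.1 *: (nexp x.1 *m N).
Proof.
apply/matrixP => i j; rewrite [LHS]mxE [RHS]mxE.
have -> : nexp x.1 *m N = N + x.1 *: (N *m N).
  by rewrite /nexp !mulmxDl mul1mx -!scalemxAl nilp3 scaler0 addr0.
rewrite (_ : (fun x : V => _) = (fun x : V => (1%:M : 'M[R]_(4 + 1)) i j + (1 * N i j) * x.1 +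
  (1 ^+ 2 * (N *m N) i j / 2) * x.1 ^+ 2)); last first.
  by apply/funext => y; rewrite -[in LHS](mul1r y.1) nexp_entry.
rewrite (derive_val (is_derive := quadratic_derive _ _ _ x w)).
rewrite [(N + _) i j]mxE [X in _ = _ * (_ + X)]mxE; by field.
Qed.

End nexp.

Lemma map_nilp (R : realType) : map_mx (real_complex R) (nilp R) = nilp R[i].
Proof.
have e : map_mx (real_complex R) (null4 R) = null4 R[i].
  apply/matrixP => i j; rewrite !mxE.
  by case: i => [[|[|[|[|//]]]] ?] /=; rewrite ?rmorphN ?rmorph1 ?rmorph0.
have l : map_mx (real_complex R) (lor R 4) = lor R[i] 4.
  apply/matrixP => i j; rewrite !mxE rmorphMn/=; congr (_ *+ _).
  by case: ifP => _; rewrite ?rmorphN rmorph1.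
have t : map_mx (real_complex R) (null4 R)^T = (null4 R[i])^T.
  by rewrite -e; apply/matrixP => i j; rewrite !mxE.
by rewrite /nilp map_block_mx !map_mx0 map_mxN map_mxM t e l.
Qed.

(** * Flatness of the family of connections *)

Section flatness.
Variable R : realType.
Notation V := (R * R)%type.

(** The hypotheses are the equations of P = K^-1 M K, A = K^-1 K_z and B = K^-1 K_zbar, with M
    constant and Q = K^-1 K_{z zbar}; [li] is the inverse of l. P is the common p-part of both
    coefficients, so that [P, P] = 0 is the only bracket of p-parts, and the terms in l, in l^-1 and
    free of l cancel separately. *)
Lemma commuting_flat m (P A B : V -> 'M[R[i]]_m) x (Q a b : 'M[R[i]]_m) (l li : R[i]) :
  is_W P x (P x *m A x - A x *m P x) (P x *m B x - B x *m P x) ->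
  is_W A x a (Q - B x *m A x) -> is_W B x (Q - A x *m B x) b -> li * l = 1 ->
  d_z (fun y => l *: P y + B y) x - d_zbar (fun y => li *: P y + A y) x +
    ((li *: P x + A x) *m (l *: P x + B x) - (l *: P x + B x) *m (li *: P x + A x)) = 0.
Proof.
move=> hP hA hB lil.
rewrite (d_zE (is_WD (is_WZ l hP) hB)) (d_zbarE (is_WD (is_WZ li hP) hA)).
move: (P x) (A x) (B x) => p a' b'.
rewrite !mulmxDl !mulmxDr -!scalemxAl -!scalemxAr !scalerA lil mulrC lil !scale1r.
move: (p *m p) (p *m a') (p *m b') (a' *m p) (a' *m b') (b' *m p) (b' *m a') => m1 m2 m3 m4 m5 m6 m7.
by apply/matrixP => i j; rewrite !mxE; ring.
Qed.

Lemma is_W_cong m p (f : V -> 'M[R[i]]_(m, p)) x a b a' b' :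
  a = a' -> b = b' -> is_W f x a b -> is_W f x a' b'.
Proof. by move=> -> ->. Qed.

Lemma is_W_lorinv m (K : V -> 'M[R[i]]_m) x a b :
  (\forall y \near x, SO1 R[i] m (K y)) -> is_W K x a b ->
  is_W (fun y => lorinv (K y)) x (- (lorinv (K x) *m a *m lorinv (K x)))
    (- (lorinv (K x) *m b *m lorinv (K x))).
Proof.
move=> hK KW; have Kx := nbhs_singleton hK.
have h1 := is_WMr (lor R[i] m) (is_WMl (lor R[i] m) (is_WT KW)).
have h2 : is_W (fun y => lorinv (K y) *m K y) x 0 0.
  by apply: is_W_near (is_W_cst 1%:M x); apply: filterS hK => y /SO1_mulV.
have [h3 h4] := is_W_uniq (is_WM h1 KW) h2.
have key (M a' : 'M[R[i]]_m) : M *m K x + lorinv (K x) *m a' = 0 ->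
    - (lorinv (K x) *m a' *m lorinv (K x)) = M.
  move=> /eqP; rewrite addr_eq0 => /eqP/(congr1 (mulmx^~ (lorinv (K x)))).
  by rewrite -(mulmxA M) (SO1_mulVr Kx) mulmx1 mulNmx.
by rewrite (key _ _ h3) (key _ _ h4).
Qed.

End flatness.

Section sigma.
Variables (R : realType) (n : nat).
Implicit Types A B : 'M[R[i]]_(4 + n).

Let sigma_unit : sigma_mx R n \in unitmx.
Proof. by have [] := mulmx1_unit (sigma_mxK R n). Qed.

Lemma sigmaM A B : sigma (A *m B) = sigma A *m sigma B.
Proof. by rewrite /sigma !mulmxA mulmxKV. Qed.

Lemma sigmaD A B : sigma (A + B) = sigma A + sigma B.
Proof. by rewrite /sigma mulmxDr mulmxDl. Qed.

Lemma sigma1 : sigma 1%:M = 1%:M :> 'M[R[i]]_(4 + n).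
Proof. by rewrite /sigma mulmx1 mulmxV. Qed.

Lemma sigma_lorinv A : SO1 R[i] (4 + n) A -> sigma A = A -> sigma (lorinv A) = lorinv A.
Proof.
move=> hA sA; have e : sigma (lorinv A) *m A = 1%:M.
  by rewrite -{2}sA -sigmaM (SO1_mulV hA) sigma1.
by rewrite -[LHS]mulmx1 -(SO1_mulVr hA) mulmxA e mul1mx.
Qed.

Lemma kpart_split A B : sigma A = - A -> sigma B = B -> kpart (A + B) = B.
Proof.
move=> sA sB; rewrite /kpart sigmaD sA sB.
by apply/matrixP => i j; rewrite !mxE; field.
Qed.

Lemma ppart_split A B : sigma A = - A -> sigma B = B -> ppart (A + B) = A.
Proof.
move=> sA sB; rewrite /ppart sigmaD sA sB.
by apply/matrixP => i j; rewrite !mxE; field.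
Qed.

Lemma sigma_mul_fixed A B : sigma A = A -> sigma B = B -> sigma (A *m B) = A *m B.
Proof. by move=> sA sB; rewrite sigmaM sA sB. Qed.

Lemma sigma_mul_odd A B X : sigma A = A -> sigma B = B -> sigma X = - X ->
  sigma (A *m X *m B) = - (A *m X *m B).
Proof. by move=> sA sB sX; rewrite !sigmaM sA sB sX mulmxN mulNmx. Qed.

Lemma is_W_sigma (K : R * R -> 'M[R[i]]_(4 + n)) x a b :
  (\forall y \near x, sigma (K y) = K y) -> is_W K x a b -> sigma a = a /\ sigma b = b.
Proof.
move=> sK KW; have h1 := is_WMr (invmx (sigma_mx R n)) (is_WMl (sigma_mx R n) KW).
exact: (is_W_uniq h1 (is_W_near (filterS (fun y h => esym h) sK) KW)).
Qed.

End sigma.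

Section example.
Variable R : realType.
Notation V := (R * R)%type.
Notation C := R[i].

(** [set0] is a default value at infinity, which is not a point of the plane. *)
Definition null_map (p : option C) : set 'M[R]_(4 + 1) :=
  if p is Some z then cosetK (nexp (complex.Re z)) else set0.

Lemma cosetK_refl n (g : 'M[R]_(4 + n)) : cosetK g g.
Proof.
exists 1%:M; last by rewrite mulmx1.
exists 1%:M, 1%:M; split; last by rewrite -scalar_mx_block.
- exact/connected_component_refl/SO1_1.
- by split; rewrite ?det1// trmx1 mulmx1.
Qed.

Lemma null_map_lift : local_lift Plane null_map false setT (fun x => nexp x.1).
Proof.
split=> [|//| |x _]; first exact: openT.
  rewrite (_ : (fun x : V => _) = (fun x : V => nexp (1 * x.1))).
    exact: nexp_smooth.
  by apply/funext => x; rewrite mul1r.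
by split; first exact: nexp_SO1plus.
Qed.

Let M : 'M[C]_(4 + 1) := 2^-1 *: nilp C.

(** The map depends on u only, so its derivatives in z and zbar are both half of its derivative in
    u. *)
Lemma nexp_W x : is_W (complexify (fun x : V => nexp x.1)) x
  (complexify (fun x : V => nexp x.1) x *m M) (complexify (fun x : V => nexp x.1) x *m M).
Proof.
have [_ _ s _] := null_map_lift.
have h : is_W (complexify (fun x : V => nexp x.1)) x
    (d_z (complexify (fun x : V => nexp x.1)) x) (d_zbar (complexify (fun x : V => nexp x.1)) x).
  by apply: complexify_is_W => i j; split; exact: smooth_derivable (s i j) I.
have half (X Y Z : 'M[C]_(4 + 1)) : X = Z *m nilp C -> Y = 0 ->
    2^-1 *: (X - 'i *: Y) = Z *m M /\ 2^-1 *: (X + 'i *: Y) = Z *m M.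
  by move=> -> ->; rewrite /M scaler0 subr0 addr0 -scalemxAr.
have e1 : complexify (pd_mx (dir_u R) (fun x : V => nexp x.1)) x =
    complexify (fun x : V => nexp x.1) x *m nilp C.
  by rewrite /complexify nexp_pd scale1r map_mxM map_nilp.
have e2 : complexify (pd_mx (dir_v R) (fun x : V => nexp x.1)) x = 0.
  by rewrite /complexify nexp_pd scale0r map_mx0.
have [h1 h2] := half _ _ _ e1 e2.
have d1 := etrans (d_zC (fun x : V => nexp x.1) x) h1.
have d2 := etrans (d_zbarC (fun x : V => nexp x.1) x) h2.
by rewrite d1 d2 in h.
Qed.

Section lift.
Variables (U : set V) (F : V -> 'M[R]_(4 + 1)).
Hypothesis FL : local_lift Plane null_map false U F.

Let G : V -> 'M[C]_(4 + 1) := complexify (fun x : V => nexp x.1).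
Let H : V -> 'M[C]_(4 + 1) := complexify (fun x : V => nexp (-1 * x.1)).
Let Fc := complexify F.
(** An arbitrary lift is F = G K, with G = exp(Re z N) and H its inverse. K is block diagonal
    because F and G have the same coset, and the formula K = H F gives its derivatives up to order
    2. *)
Let K y := H y *m Fc y.
Let a y := d_z H y *m Fc y + H y *m d_z Fc y.
Let b y := d_zbar H y *m Fc y + H y *m d_zbar Fc y.

Let GH y : G y *m H y = 1%:M.
Proof. by rewrite /G /H /complexify -map_mxM nexpD mulN1r subrr nexp0 map_mx1. Qed.

Let FE y : Fc y = G y *m K y.
Proof. by rewrite /K mulmxA GH mul1mx. Qed.

Let K_block y : U y -> exists A1 A2, [/\ SO1 C 4 A1, A2^T *m A2 = 1%:M & K y = block_mx A1 0 0 A2].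
Proof.
have [_ _ _ FG] := FL; move=> /FG[_ e].
have : cosetK (F y) (F y) by exact: cosetK_refl.
rewrite -e => -[k [A1 [A2 [hA1 [hA2 _] kE]]] FkE].
exists (map_mx (real_complex R) A1), (map_mx (real_complex R) A2); split.
- exact: SO1_map (connected_component_sub hA1).
- have t : (map_mx (real_complex R) A2)^T = map_mx (real_complex R) A2^T.
    by apply/matrixP => i j; rewrite !mxE.
  by rewrite t -map_mxM hA2 map_mx1.
rewrite /K /Fc /H /complexify -map_mxM -FkE mulmxA nexpD mulN1r addNr nexp0 mul1mx kE.
by rewrite map_block_mx !map_mx0.
Qed.

Let K_SO1 y : U y -> SO1 C (4 + 1) (K y).
Proof.
have [_ _ _ FG] := FL; move=> /FG[h _]; apply: SO1M.
- exact/SO1_map/nexp_SO1.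
- exact: SO1_map (connected_component_sub h).
Qed.

Let K_sigma y : U y -> sigma (K y) = K y.
Proof. by move=> /K_block[A1 [A2 [_ _ ->]]]; rewrite sigma_block !oppr0. Qed.

Let U_near x (P : V -> Prop) : U x -> (forall y, U y -> P y) -> \forall y \near x, P y.
Proof.
have [Uo _ _ _] := FL; move=> Ux HP; move: Uo; rewrite openE => /(_ x Ux).
exact: filterS.
Qed.

Let K_W2 x : U x -> is_W2 K a b x.
Proof.
have [Uo _ Fs _] := FL; move=> Ux.
exact: is_W2M (smooth_is_W2 openT (nexp_smooth (-1)) I) (smooth_is_W2 Uo Fs Ux).
Qed.

Let K_W x : U x -> is_W K x (a x) (b x).
Proof. by move=> /K_W2[? [? [? [/nbhs_singleton]]]]. Qed.

Let ab_sigma x : U x -> sigma (a x) = a x /\ sigma (b x) = b x.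
Proof. by move=> Ux; exact: (is_W_sigma (U_near Ux K_sigma) (K_W Ux)). Qed.

(** F^-1 dF is (P + A) dz + (P + B) dzbar. Under sigma, P is odd and A, B are even, so that these
    are the p-part and the k-part. *)
Let P y := lorinv (K y) *m M *m K y.
Let A y := lorinv (K y) *m a y.
Let B y := lorinv (K y) *m b y.

Let sigma_M : sigma M = - M.
Proof.
by rewrite /M /nilp scale_block_mx !scaler0 sigma_block opp_block_mx !oppr0.
Qed.

Let P_sigma y : U y -> sigma (P y) = - P y.
Proof.
move=> Uy; have sK := K_sigma Uy; have sL := sigma_lorinv (K_SO1 Uy) sK.
exact: sigma_mul_odd sL sK sigma_M.
Qed.

Let AB_sigma y : U y -> sigma (A y) = A y /\ sigma (B y) = B y.
Proof.
move=> Uy; have sL := sigma_lorinv (K_SO1 Uy) (K_sigma Uy); have [sa sb] := ab_sigma Uy.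
by split; [exact: sigma_mul_fixed sL sa|exact: sigma_mul_fixed sL sb].
Qed.

Let mc y : U y -> mc_z Fc y = P y + A y /\ mc_zbar Fc y = P y + B y.
Proof.
move=> Uy; have GS : SO1 C (4 + 1) (G y) by exact/SO1_map/nexp_SO1.
have FW : is_W Fc y (G y *m M *m K y + G y *m a y) (G y *m M *m K y + G y *m b y).
  apply: is_W_near (is_WM (nexp_W y) (K_W Uy)); apply: filterS filterT => z _.
  by rewrite -/(G z) -FE.
have Fi : invmx (Fc y) = lorinv (K y) *m lorinv (G y).
  have FS : SO1 C (4 + 1) (Fc y) by rewrite FE; exact: SO1M GS (K_SO1 Uy).
  by have [_ ->] := SO1_unit FS; rewrite FE lorinvM.
have gen (L Gi G' K' a' : 'M[C]_(4 + 1)) : Gi *m G' = 1%:M ->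
    L *m Gi *m (G' *m M *m K' + G' *m a') = L *m M *m K' + L *m a'.
  move=> GG; rewrite mulmxDr -!mulmxA (mulmxA Gi G') (mulmxA Gi G' a') GG !mul1mx.
  by [].
rewrite /mc_z /mc_zbar (d_zE FW) (d_zbarE FW) Fi.
by split; exact: gen (SO1_mulV GS).
Qed.

Lemma null_map_flat l : `|l| = 1 -> flat U (alpha_z F l) (alpha_zbar F l).
Proof.
move=> l1 x Ux.
have az y : U y -> alpha_z F l y = l^-1 *: P y + A y.
  move=> Uy; have [mz _] := mc Uy; have sP := P_sigma Uy; have [sA _] := AB_sigma Uy.
  by rewrite /alpha_z -/Fc mz (ppart_split sP sA) (kpart_split sP sA).
have azb y : U y -> alpha_zbar F l y = l *: P y + B y.
  move=> Uy; have [_ mzb] := mc Uy; have sP := P_sigma Uy; have [_ sB] := AB_sigma Uy.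
  by rewrite /alpha_zbar -/Fc mzb (ppart_split sP sB) (kpart_split sP sB) addrC.
have LW := is_W_lorinv (U_near Ux K_SO1) (K_W Ux).
have [a1 [q [b2 [_ aW bW]]]] := K_W2 Ux.
have KV := SO1_mulVr (K_SO1 Ux).
have gen1 (L K' X : 'M[C]_(4 + 1)) : K' *m L = 1%:M ->
    - (L *m X *m L) *m M *m K' + L *m M *m X = L *m M *m K' *m (L *m X) - L *m X *m (L *m M *m K').
  move=> KL; rewrite addrC !mulNmx; congr (_ - _); last by rewrite !mulmxA.
  by rewrite -[RHS]mulmxA (mulmxA K') KL mul1mx.
have gen2 (L X Y Z : 'M[C]_(4 + 1)) : - (L *m X *m L) *m Y + L *m Z = L *m Z - L *m X *m (L *m Y).
  by rewrite addrC mulNmx !mulmxA.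
have PW : is_W P x (P x *m A x - A x *m P x) (P x *m B x - B x *m P x).
  have h := is_WM (is_WMr M LW) (K_W Ux).
  exact: is_W_cong (gen1 _ _ (a x) KV) (gen1 _ _ (b x) KV) h.
have AW : is_W A x (lorinv (K x) *m a1 - A x *m A x) (lorinv (K x) *m q - B x *m A x).
  exact: is_W_cong (gen2 _ (a x) (a x) a1) (gen2 _ (b x) (a x) q) (is_WM LW aW).
have BW : is_W B x (lorinv (K x) *m q - A x *m B x) (lorinv (K x) *m b2 - B x *m B x).
  exact: is_W_cong (gen2 _ (a x) (b x) q) (gen2 _ (b x) (b x) b2) (is_WM LW bW).
have l0 : l != 0 by rewrite -normr_eq0 l1 oner_eq0.
have h1 := is_WD (is_WZ l PW) BW; have h2 := is_WD (is_WZ l^-1 PW) AW.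
have := commuting_flat PW AW BW (mulVf l0).
rewrite (d_zE h1) (d_zbarE h2) -(az x Ux) -(azb x Ux).
have n1 : \forall y \near x, l *: P y + B y = alpha_zbar F l y.
  by apply: U_near Ux _ => y /azb.
have n2 : \forall y \near x, l^-1 *: P y + A y = alpha_z F l y.
  by apply: U_near Ux _ => y /az.
by rewrite (d_zE (is_W_near n1 h1)) (d_zbarE (is_W_near n2 h2)).
Qed.

(** B_1 is half of A1^-1 e A2: an isometry of the form and a factor of size 1 by 1 applied to the
    isotropic vector e. *)
Lemma null_map_isotropic x : U x -> (B1 F x)^T *m lor C 4 *m B1 F x = 0.
Proof.
move=> Ux; have [mz _] := mc Ux; have [sA _] := AB_sigma Ux.
have [A1 [A2 [hA1 hA2 KE]]] := K_block Ux.
have lorinv_block : lorinv (block_mx A1 0 0 A2) = block_mx (lorinv A1) 0 0 A2^T.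
  rewrite /lorinv (lor_block C 1) tr_block_mx !mulmx_block.
  by rewrite !(trmx0, mulmx0, mul0mx, addr0, add0r, mulmx1, mul1mx).
have ur (L k1 : 'M[C]_4) (T A' k2 : 'M[C]_1) (c : C) (N : 'M[C]_(4, 1)) X :
    ursubmx (block_mx L 0 0 T *m (c *: block_mx 0 N X 0) *m block_mx A1 0 0 A' +
      block_mx k1 0 0 k2) = c *: (L *m N *m A').
  rewrite scale_block_mx !mulmx_block add_block_mx block_mxKur.
  by rewrite !(mulmx0, mul0mx, addr0, add0r, scaler0) -scalemxAr -scalemxAl.
have -> : B1 F x = 2^-1 *: (lorinv A1 *m null4 C *m A2).
  have [k1 [k2 AE]] := sigma_fixed_block sA.
  by rewrite /B1 -/Fc mz AE /P KE lorinv_block ur.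
have h : (lorinv A1)^T *m lor C 4 *m lorinv A1 = lor C 4.
  rewrite /lorinv !trmx_mul trmxK lorT !mulmxA -(mulmxA (lor C 4 *m A1)) lorK mulmx1.
  by rewrite -!mulmxA (mulmxA A1) (mulmxA (A1 *m _)) (SO1_AJAT hA1) lorK mulmx1.
move: (lorinv A1) h => L h.
have e : (L *m null4 C *m A2)^T *m lor C 4 *m (L *m null4 C *m A2) =
    A2^T *m ((null4 C)^T *m (L^T *m lor C 4 *m L) *m null4 C) *m A2.
  by rewrite !trmx_mul !mulmxA.
have e' (c : C) (Y : 'M[C]_(4, 1)) : (c *: Y)^T *m lor C 4 *m (c *: Y) =
    c *: (c *: (Y^T *m lor C 4 *m Y)).
  by rewrite -scalemxAr; congr (_ *: _); rewrite [(c *: Y)^T]linearZ/= -!scalemxAl.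
by rewrite e' e h null4_isotropic mulmx0 mul0mx !scaler0.
Qed.

End lift.

Lemma nexp_null_vec (x : V) :
  complexify (fun x : V => nexp x.1) x *m null_vec R 1 = null_vec R 1.
Proof.
have -> : null_vec R 1 = map_mx (real_complex R) (col_mx (null4 R) 0 : 'M[R]_(4 + 1, 1)).
  apply/matrixP => i j; rewrite ord1 null_vecE [RHS]mxE mxE.
  case: split_ordP => k ->; rewrite !mxE/=; last by [].
  by case: k => [[|[|[|[|//]]]] ?] /=; rewrite ?rmorphN.
rewrite /complexify -map_mxM; congr map_mx.
by rewrite /nexp !mulmxDl mul1mx -!scalemxAl -mulmxA nilp_null4 mulmx0 !scaler0 !addr0.
Qed.

Let M_normal : M *m normal_mx R 1 = 2^-1 *: null_vec R 1.
Proof.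
rewrite /M -scalemxAl; congr (_ *: _).
rewrite /nilp /normal_mx mul_block_col !(mulmx0, mul0mx) mulmx1 add0r addr0.
apply/matrixP => i j; rewrite ord1 null_vecE mxE.
case: split_ordP => k ->; rewrite !mxE//=.
by case: k => [[|[|[|[|//]]]] ?].
Qed.

Let U_near_self (W : set V) x : open W -> W x -> \forall z \near x, setT z /\ W z.
Proof. by rewrite openE => h /h; apply: filterS. Qed.

Lemma null_map_sch : strongly_conformally_harmonic Plane null_map.
Proof.
(* The chart at infinity has empty domain on the plane, so its lifts live over the empty set. *)
have vac U F : local_lift Plane null_map true U F -> forall x, ~ U x.
  by move=> [_ h _ _] x /h[].
split; first split.
- move=> [|] x; first by case.
  move=> _; by exists setT, (fun x => nexp x.1); split=> //; exact: null_map_lift.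
- move=> [|] U F FL l l1; first by move=> x /(vac _ _ FL).
  exact: null_map_flat.
- move=> [|] U F FL x; first by move=> /(vac _ _ FL).
  exact: null_map_isotropic.
Qed.

Lemma null_map_not_gauss_map (y : option C -> 'cV[R]_(3 + 1)) :
  ~ willmore_map_with_Gauss_map Plane y null_map.
Proof.
move=> [_ [Om [Oo Od [ys yc _] GM]]].
have [rho GP] := gauss_map_perp false ys GM.
have [x0 [_ Ox0]] : (setT `&` chart_set Plane Om false) !=set0.
  by apply: Od => //; [exact: openT|exists 0].
apply: (@null_gauss_map_false R 1 Plane Om y false rho _ x0 ys yc (Oo false) Ox0 (fun _ h => h)) => x Ox.
(* The z-derivative of the normal column of the lift is e / 2, because [nexp] fixes e; so the second
   half of [gauss_map_perp] is the orthogonality of Y and e. *)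
have [_] := GP setT _ null_map_lift x (U_near_self (Oo false) Ox).
have e : (2^-1 : C) != 0 by rewrite invr_eq0 pnatr_eq0.
rewrite (d_zE (nexp_W x)) -(mulmxA (complexify (fun x : V => nexp x.1) x) M) M_normal -scalemxAr nexp_null_vec -scalemxAr => h.
by apply: (scalerI e); rewrite h scaler0.
Qed.

End example.

Theorem corollary1p5 (R : realType) :
  (forall (n : nat) (D : surface) (FF : option R[i] -> set 'M[R]_(4 + n))
          (f1 f3 : 'I_n -> option R[i] -> R[i]),
      (0 < n)%N ->
      strongly_conformally_harmonic D FF ->
      (forall j, meromorphic_on D (f1 j)) ->
      (forall j, meromorphic_on D (f3 j)) ->
      normalized_potential D FF (special_B f1 f3) ->
      max_rank D (special_B f1 f3) 2%N ->
      ~ exists y : option R[i] -> 'cV[R]_(3 + n),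
          willmore_surface D y /\ conformal_Gauss_map D setT y FF)
  /\
  (exists (n : nat) (D : surface) (FF : option R[i] -> set 'M[R]_(4 + n)),
      (0 < n)%N /\
      strongly_conformally_harmonic D FF /\
      ~ exists y : option R[i] -> 'cV[R]_(3 + n),
          willmore_map_with_Gauss_map D y FF).
Proof.
split=> [n D FF f1 f3 _ sch h1 h3 np mr [y [ys GM]]|].
  exact: (rank2_not_gauss_map sch h1 h3 np mr ys GM).
exists 1%N, Plane, (@null_map R); split=> //; split; first exact: null_map_sch.
by move=> [y]; exact: null_map_not_gauss_map.
Qed.
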